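(* Let $u\in L^1_{w^*}(0,T;\mathrm{BV}(\Omega))$ and $w\in\mathrm{BV}(\Omega)\cap L^2(\Omega)$, and for $\delta>0$ let $$u^\delta(x,t)=e^{-\frac t\delta}w(x)+\frac1\delta\int_0^te^{\frac{s-t}{\delta}}u(x,s)\,ds.$$ Then $u^\delta\in L^1_{w^*}(0,T;\mathrm{BV}(\Omega))$, and for some sequence $\delta_i>0$, $i\in\mathbb{N}$, with $\delta_i\to0$ as $i\to\infty$, we have $u^{\delta_i}\to u$ area-strictly in $\Omega_T$ as $i\to\infty$.
   Context: $\Omega\subset\mathbb{R}^n$ is a bounded Lipschitz domain, $T>0$, $\Omega_T=\Omega\times(0,T)$. For $v\in\mathrm{BV}(\Omega)$ with Lebesgue decomposition $Dv=\nabla v\,\mathcal{L}^n+D^sv$, the area functional is $\mathcal{A}(Dv)(\Omega)=\int_\Omega\sqrt{1+|\nabla v|^2}\,dx+|D^sv|(\Omega)$. $\mathrm{BV}(\Omega)$ is identified with the dual of a separable space whose elements have the form $\phi-\operatorname{div}\Phi$, $\phi\in C_0^0(\Omega)$, $\Phi\in C_0^0(\Omega;\mathbb{R}^n)$, and $L^1_{w^*}(0,T;\mathrm{BV}(\Omega))$ is the space of (equivalence classes of) weakly*-measurable $v:[0,T]\to\mathrm{BV}(\Omega)$ with $t\mapsto\|v(t)\|_{\mathrm{BV}(\Omega)}\in L^1(0,T)$. A sequence $u_i\in L^1_{w^*}(0,T;\mathrm{BV}(\Omega))$ converges area-strictly to $u$ in $\Omega_T$ if $u_i\to u$ in $L^1(\Omega_T)$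 and $\lim_{i\to\infty}\int_0^T|\mathcal{A}(Du)(\Omega)-\mathcal{A}(Du_i)(\Omega)|\,dt=0$ (gradients in the space variable). *)

(* Defs.v *)
From HB Require Import structures.
From mathcomp Require Import all_boot all_order all_algebra.
From mathcomp Require Import all_classical all_reals all_analysis.
From mathcomp Require Import measurable_realfun.

Set Implicit Arguments.
Unset Strict Implicit.
Unset Printing Implicit Defensive.

Import Order.TTheory GRing.Theory Num.Theory.
Import numFieldNormedType.Exports.

Local Open Scope classical_set_scope.
Local Open Scope ring_scope.

(* The Borel sigma-algebra of R^n, R^n being the space of row vectors. *)
Fact rV_borel_display : measure_display.
Proof. exact. Qed.

Section borel_rV.
Context {R : realType} {n : nat}.
Let G : set (set 'rV[R]_n) := @open 'rV[R]_n.

HB.instance Definition _ := @isMeasurable.Build rV_borel_display 'rV[R]_n <<s G >>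
  (@sigma_algebra0 _ setT G) (@sigma_algebraC _ G) (@sigma_algebra_bigcup _ setT G).
End borel_rV.

Lemma open_bigcup_ball (R : realType) n (U : set 'rV[R]_n) : open U ->
  exists D : set ('rV[rat]_n * nat),
    U = \bigcup_(p in D) ball (map_mx ratr p.1 : 'rV[R]_n) p.2.+1%:R^-1.
Proof.
move=> oU.
exists [set p | ball (map_mx ratr p.1 : 'rV[R]_n) p.2.+1%:R^-1 `<=` U].
apply/seteqP; split=> [x Ux|x [p pU]]; last exact: pU.
have /nbhs_ballP[e /= e0 eU] : nbhs x U by exact: open_nbhs_nbhs.
have [k ke] : exists k : nat, k.+1%:R^-1 < e / 2.
  have := near_infty_natSinv_lt (PosNum (divr_gt0 e0 (ltr0n R 2))).
  by move=> [k _ kP]; exists k; exact: (kP k (leqnn k)).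
have k0 : 0 < (k.+1%:R^-1 : R) by [].
have qP i : exists q : rat, `|x ord0 i - ratr q| < k.+1%:R^-1.
  have [z [/= b [q _ qz]]] := @dense_rat R (ball (x ord0 i) k.+1%:R^-1)
    (ex_intro _ (x ord0 i) (ballxx (x ord0 i) k0)) (ball_open (x ord0 i) k.+1%:R^-1).
  by exists q; rewrite qz.
have [q {}qP] := choice qP.
exists (\row_i q i, k) => /=.
  move=> y [_ yq]; apply: eU; split => // i j; rewrite !ord1.
  have := yq ord0 j; rewrite !mxE /ball/= => yj.
  rewrite -(subrKA (ratr (q j))) (le_lt_trans (ler_normD _ _))//.
  by rewrite (splitr e) ltrD// (lt_trans _ ke).
split=> // i j; rewrite !ord1 !mxE /ball/= distrC.
exact: qP.
Qed.

Lemma measurable_fun_rVP d (T : measurableType d) (R : realType) n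
    (f : T -> 'rV[R]_n) :
  measurable_fun setT f <-> forall i, measurable_fun setT (fun t => f t ord0 i).
Proof.
split=> [mf i|mf].
  have mi : measurable_fun setT (fun x : 'rV[R]_n => x ord0 i).
    apply: (measurability _ (RGenOpens.measurableE R)).
    move=> _ [_ [a [b ->]] <-].
    rewrite setTI; apply: sub_sigma_algebra.
    apply: open_comp (interval_open _ _) => // x _; exact: coord_continuous.
  exact: (measurableT_comp mi mf).
apply: (measurability (@open 'rV[R]_n)) => //.
move=> _ [U oU <-]; rewrite setTI.
have [D ->] := open_bigcup_ball oU.
rewrite preimage_bigcup bigcup_mkcond.
apply: countable_bigcupT_measurable => [|p]; first exact: countableP.
case: ifPn => // _.
rewrite (_ : _ @^-1` _ = \bigcap_(i in [set: 'I_n])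
  (fun t => f t ord0 i) @^-1` ball (ratr (p.1 ord0 i) : R) p.2.+1%:R^-1); last first.
  apply/seteqP; split=> [t [_ ft] i _|t ft]; first by have := ft ord0 i; rewrite mxE.
  by split => // i j; rewrite !ord1 mxE; exact: ft.
apply: fin_bigcap_measurable => // i _.
rewrite -[X in measurable X]setTI; apply: mf => //.
exact: measurable_ball.
Qed.

Definition rV_cons {R : realType} {n : nat} (p : R * 'rV[R]_n) : 'rV[R]_n.+1 :=
  row_mx p.1%:M p.2 : 'rV[R]_(1 + n).

Lemma rV_cons0 (R : realType) n (p : R * 'rV[R]_n) :
  rV_cons p ord0 ord0 = p.1.
Proof.
transitivity (row_mx (p.1%:M : 'M[R]_(1,1)) p.2 ord0 (lshift n ord0)).
  by congr (row_mx _ _ _ _); exact/val_inj.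
by rewrite row_mxEl mxE eqxx.
Qed.

Lemma rV_consS (R : realType) n (p : R * 'rV[R]_n) i :
  rV_cons p ord0 (lift ord0 i) = p.2 ord0 i.
Proof.
transitivity (row_mx (p.1%:M : 'M[R]_(1,1)) p.2 ord0 (rshift 1 i)).
  by congr (row_mx _ _ _ _); exact/val_inj.
by rewrite row_mxEr.
Qed.

Lemma measurable_rV_cons (R : realType) n :
  measurable_fun setT (@rV_cons R n).
Proof.
apply/measurable_fun_rVP => i.
rewrite (_ : (fun _ => _) = fun p : R * 'rV[R]_n =>
  match fintype.split (i : 'I_(1 + n)) with inl _ => p.1 | inr j => p.2 ord0 j end).
  case: fintype.split => j; first exact: measurable_fst.
  exact: ((measurable_fun_rVP _).1 (@measurable_snd _ _ _ _) j).
apply/funext => p; rewrite /rV_cons [LHS]mxE; case: fintype.split => // j.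
by rewrite !ord1 mxE eqxx.
Qed.

(* Lebesgue measure on R^n, by induction on n: the image under rV_cons of the
   product of the Lebesgue measures on R and on R^(n-1); lebesgue_rV_box below
   gives its values on boxes. *)
Section lebesgue_rV_succ.
Local Open Scope ereal_scope.
Context {R : realType} {n : nat}.
Variable mu : {sigma_finite_measure set 'rV[R]_n -> \bar R}.

Definition lebesgue_rV_succ : set 'rV[R]_n.+1 -> \bar R :=
  pushforward (@lebesgue_measure R \x mu) rV_cons.


Let prod : {measure set (measurableTypeR R * 'rV[R]_n)%type -> \bar R} :=
  (@lebesgue_measure R \x mu)%E.

Let mcons : measurable_fun setT (@rV_cons R n : measurableTypeR R * 'rV[R]_n -> _).
Proof. exact: measurable_rV_cons. Qed.

HB.instance Definition _ := Measure.copy lebesgue_rV_succ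
  (measure_function_pushforward__canonical__measure_function_Measure
    prod mcons).

Let sigma_finite_lebesgue_rV_succ : sigma_finite setT lebesgue_rV_succ.
Proof.
have /sigma_finiteP[F [TF ndF Foo]] := sigma_finiteT (@lebesgue_measure R).
have /sigma_finiteP[G [TG ndG Goo]] := sigma_finiteT mu.
pose tl (x : 'rV[R]_n.+1) : R * 'rV[R]_n :=
  (x ord0 ord0, \row_i x ord0 (lift ord0 i)).
have mcoord i : measurable_fun setT (fun x : 'rV[R]_n.+1 => x ord0 i).
  exact: ((measurable_fun_rVP _).1 (@measurable_id _ _ _) i).
have mtl : measurable_fun setT tl.
  apply/measurable_fun_pairP; split => /=; first exact: mcoord.
  apply/measurable_fun_rVP => i.
  rewrite (_ : (fun _ => _) = fun x : 'rV[R]_n.+1 => x ord0 (lift ord0 i)) //.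
  by apply/funext => x /=; rewrite mxE.
have tlK p : tl (rV_cons p) = p.
  case: p => a b; rewrite /tl; congr pair; first exact: rV_cons0.
  by apply/rowP => i; rewrite mxE rV_consS.
exists (fun k => tl @^-1` (F k `*` G k)).
  apply/seteqP; split=> // x _.
  have [i _ Fi] : (\bigcup_k F k) (tl x).1 by rewrite -TF.
  have [j _ Gj] : (\bigcup_k G k) (tl x).2 by rewrite -TG.
  exists (maxn i j) => //; split.
    by move: Fi; exact/subsetPset/ndF/leq_maxl.
  by move: Gj; exact/subsetPset/ndG/leq_maxr.
move=> k; have [mFk Fkoo] := Foo k; have [mGk Gkoo] := Goo k; split.
  by rewrite -[X in measurable X]setTI; apply: mtl => //; exact: measurableX.
rewrite /lebesgue_rV_succ /pushforward.
rewrite (_ : _ @^-1` _ = F k `*` G k); last first.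
  by apply/seteqP; split=> p; rewrite /preimage /mkset tlK.
by rewrite product_measure1E// lte_mul_pinfty// ge0_fin_numE.
Qed.

HB.instance Definition _ := Measure_isSigmaFinite.Build _ _ _ lebesgue_rV_succ
  sigma_finite_lebesgue_rV_succ.

End lebesgue_rV_succ.

Fixpoint lebesgue_rV {R : realType} (n : nat) :
    {sigma_finite_measure set 'rV[R]_n -> \bar R} :=
  match n with
  | 0 => \d_(0 : 'rV[R]_0)
  | m.+1 => lebesgue_rV_succ (lebesgue_rV m)
  end.

Lemma lebesgue_rV_box (R : realType) n (A : 'I_n -> set R) :
  (forall i, measurable (A i)) ->
  lebesgue_rV n [set x | forall i, A i (x ord0 i)] =
  (\prod_(i < n) lebesgue_measure (A i))%E.
Proof.
elim: n A => [|n ih] A mA.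
  by rewrite big_ord0 /= diracE mem_set// => -[].
set B := [set x : 'rV[R]_n | forall i, A (lift ord0 i) (x ord0 i)].
have mB : measurable B.
  rewrite (_ : B = \bigcap_(i in [set: 'I_n])
    (fun x : 'rV[R]_n => x ord0 i) @^-1` A (lift ord0 i)); last first.
    by apply/seteqP; split=> x h i => [_|]; exact: h.
  apply: fin_bigcap_measurable => // i _; rewrite -[X in measurable X]setTI.
  by apply: ((measurable_fun_rVP _).1 (@measurable_id _ _ setT) i).
rewrite big_ord_recl -(ih (fun i => A (lift ord0 i)) (fun i => mA _)).
rewrite /= /lebesgue_rV_succ /pushforward.
rewrite -/B -product_measure1E//; last exact: (mA ord0).
congr (_ _); apply/seteqP; split=> -[a b] /= h.
  split=> [|i].
    by have := h ord0; rewrite rV_cons0.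
  by have := h (lift ord0 i); rewrite rV_consS.
by move=> i; case: (unliftP ord0 i) => [j|] ->; rewrite ?rV_cons0 ?rV_consS;
  [exact: h.2 | exact: h.1].
Qed.

Section bv.
Context {R : realType} {n : nat}.
Implicit Types (Omega : set 'rV[R]_n) (v : 'rV[R]_n -> R).

Definition enorm (x : 'rV[R]_n) : R := Num.sqrt (\sum_(i < n) x ord0 i ^+ 2).

(* Near each boundary point, after an orthogonal change of coordinates Q and for
   a suitable coordinate i, Omega is the set lying above the graph of a
   Lipschitz function g of the other n - 1 coordinates. *)
Definition lipschitz_boundary Omega : Prop :=
  forall x, (closure Omega `\` Omega) x ->
  exists (r : R) (Q : 'M[R]_n) (i : 'I_n) (g : 'rV[R]_n.-1 -> R),
    [/\ 0 < r, Q *m Q^T = 1%:M, lipschitz g &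
      forall y, ball x r y ->
        (Omega y <-> g (col' i (y *m Q)) < (y *m Q) ord0 i)].

Definition bounded_lipschitz_domain Omega : Prop :=
  [/\ Omega !=set0, open Omega, connected Omega, bounded_set Omega &
      lipschitz_boundary Omega].

Definition Cc1 Omega (phi : 'rV[R]_n -> R) : Prop :=
  [/\ forall x, differentiable phi x,
      forall i : 'I_n, continuous ('D_(delta_mx ord0 i) phi) &
      exists K, [/\ compact K, K `<=` Omega & forall x, ~ K x -> phi x = 0]].

(* C_0^0(Omega), the closure of C_c^0(Omega) in the sup norm. *)
Definition C0 Omega (phi : 'rV[R]_n -> R) : Prop :=
  (forall x, Omega x -> {for x, continuous phi}) /\
  (forall e : R, 0 < e -> compact [set x | Omega x /\ e <= `|phi x|]).

(* The i-th component of an R^n-valued measure D is the charge D i. *)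
Definition vcharge := 'I_n -> {charge set 'rV[R]_n -> \bar R}.

Definition vcharge0 : vcharge := fun=> czero.

(* |D|(A) for the Euclidean norm of R^n; finite disjoint families of subsets give
   the same supremum as countable partitions of A. *)
Definition vvariation (D : vcharge) (A : set 'rV[R]_n) : \bar R :=
  ereal_sup [set s | exists (m : nat) (B : 'I_m -> set 'rV[R]_n),
    [/\ forall k, measurable (B k), forall k, B k `<=` A, trivIset setT B &
      s = (\sum_(k < m) enorm (\row_i fine (D i (B k))))%:E]].

Definition hahnP (nu : {charge set 'rV[R]_n -> \bar R}) :=
  svalP (cid (svalP (cid (Hahn_decomposition nu)))).

(* The integral of f over A with respect to nu, through the Jordan
   decomposition of nu; it does not depend on the Hahn decomposition chosen. *)
Definition charge_integral (nu : {charge set 'rV[R]_n -> \bar R})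
    (A : set 'rV[R]_n) (f : 'rV[R]_n -> R) : R :=
  \int[jordan_pos (hahnP nu)]_(x in A) f x -
  \int[jordan_neg (hahnP nu)]_(x in A) f x.

(* D is the distributional derivative of v in Omega. *)
Definition is_derivative_measure Omega v (D : vcharge) : Prop :=
  forall phi (i : 'I_n), Cc1 Omega phi ->
    \int[lebesgue_rV n]_(x in Omega) (v x * 'D_(delta_mx ord0 i) phi x) =
    - charge_integral (D i) Omega phi.

(* Functions stand for their classes modulo a.e. equality in Omega. *)
Definition BV Omega v : Prop :=
  (lebesgue_rV n).-integrable Omega (EFin \o v) /\
  exists D, is_derivative_measure Omega v D.

(* Dv; on the Borel subsets of Omega it is determined by the class of v. *)
Definition BVD Omega v : vcharge :=
  @xget {classic vcharge} vcharge0 (is_derivative_measure Omega v).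

Definition BVnorm Omega v : \bar R :=
  (\int[lebesgue_rV n]_(x in Omega) `|v x|%:E + vvariation (BVD Omega v) Omega)%E.

(* D = g L^n + S in Omega, with S singular with respect to L^n; gS = (g, S). *)
Definition is_lebesgue_decomposition Omega (D : vcharge)
    (gS : ('rV[R]_n -> 'rV[R]_n) * vcharge) : Prop :=
  [/\ forall i, (lebesgue_rV n).-integrable Omega (fun x => (gS.1 x ord0 i)%:E),
      exists N, [/\ measurable N, lebesgue_rV n N = 0%E &
        vvariation gS.2 (Omega `\` N) = 0%E] &
      forall i B, measurable B -> B `<=` Omega ->
        (D i B = \int[lebesgue_rV n]_(x in B) (gS.1 x ord0 i)%:E + gS.2 i B)%E].

Definition lebesgue_decomposition Omega (D : vcharge) :
    ('rV[R]_n -> 'rV[R]_n) * vcharge :=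
  @xget {classic ('rV[R]_n -> 'rV[R]_n) * vcharge} (fun=> 0, vcharge0)
    (is_lebesgue_decomposition Omega D).

Definition BVgrad Omega v := (lebesgue_decomposition Omega (BVD Omega v)).1.

Definition BVDs Omega v := (lebesgue_decomposition Omega (BVD Omega v)).2.

(* A(Dv)(Omega) *)
Definition area Omega v : \bar R :=
  (\int[lebesgue_rV n]_(x in Omega)
     (Num.sqrt (1 + enorm (BVgrad Omega v x) ^+ 2))%:E +
   vvariation (BVDs Omega v) Omega)%E.

(* The duality pairing of v with phi - div Phi. *)
Definition predual_pairing Omega v (phi : 'rV[R]_n -> R)
    (Phi : 'rV[R]_n -> 'rV[R]_n) : R :=
  \int[lebesgue_rV n]_(x in Omega) (v x * phi x) +
  \sum_(i < n) charge_integral (BVD Omega v i) Omega (fun x => Phi x ord0 i).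

(* L^1_{w*}(0,T;BV(Omega)), an element v being given by v t x = v(x,t). The first
   clause only concerns the choice of the representative: by Pettis' theorem each
   class has one that is jointly measurable, and this is what makes v(x,t) a
   function on Omega_T. As for measurability in x, measurable means Borel. *)
Definition L1w_BV Omega (T : R) (v : R -> 'rV[R]_n -> R) : Prop :=
  [/\ measurable_fun (Omega `*` `[0, T])
        (fun z : 'rV[R]_n * R => v z.2 z.1),
      forall t, t \in `[0, T] -> BV Omega (v t),
      forall phi (Phi : 'rV[R]_n -> 'rV[R]_n), C0 Omega phi ->
        (forall i, C0 Omega (fun x => Phi x ord0 i)) ->
        measurable_fun `[0, T] (fun t => predual_pairing Omega (v t) phi Phi) &
      lebesgue_measure.-integrable `]0, T[ (fun t => BVnorm Omega (v t))].

Definition area_strict_cvg Omega (T : R) (u_ : nat -> R -> 'rV[R]_n -> R)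
    (u : R -> 'rV[R]_n -> R) : Prop :=
  (\int[lebesgue_rV n \x lebesgue_measure]_(z in Omega `*` `]0%R, T[)
     `|u_ i z.2 z.1 - u z.2 z.1|%:E)%E @[i --> \oo] --> 0%E /\
  (\int[lebesgue_measure]_(t in `]0%R, T[)
     `|area Omega (u t) - area Omega (u_ i t)|)%E @[i --> \oo] --> 0%E.

Definition time_mollification (w : 'rV[R]_n -> R) (u : R -> 'rV[R]_n -> R)
    (delta : R) : R -> 'rV[R]_n -> R :=
  fun t x => expR (- (t / delta)) * w x +
    delta^-1 * \int[lebesgue_measure]_(s in `[0, t])
      (expR ((s - t) / delta) * u s x).

End bv.

(* Main.v *)
From HB Require Import structures.
Require Import Defs.
From mathcomp Require Import all_boot all_order all_algebra.
From mathcomp Require Import all_classical all_reals all_analysis.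
From mathcomp Require Import measurable_realfun.
From mathcomp Require Import zify ring lra.

Set Implicit Arguments.
Unset Strict Implicit.
Unset Printing Implicit Defensive.

Import Order.TTheory GRing.Theory Num.Theory.
Import numFieldNormedType.Exports.

Local Open Scope classical_set_scope.
Local Open Scope ring_scope.

(** Write D s for the derivative measure of u(s) and D^d t for that of the
    mollification at time t. Everything rests on the fact that the mollification
    is, in time, an average against the kernel exp((s-t)/d)/d on [0,t], of mass
    1 - exp(-t/d), and that taking derivative measures commutes with it:

      D^d t (B) = exp(-t/d) Dw (B) + (1/d) int_0^t exp((s-t)/d) D s (B) ds

    for every Borel subset B of Omega (mollified_BVDE). The right-hand side is a
    vector measure because s |-> D s (B) is measurable, being determined by the
    pairings with test functions (measurable_BVD_family), and bounded by the
    integrable function s |-> |D s|(Omega). It is the derivative of the mollification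
    by Fubini's theorem and the uniqueness of the distributional derivative. Hence
    the mollification belongs to BV at every time; its pairings with the predual are
    again mollifications of measurable functions, and Jensen's inequality bounds its
    total variation by the mollification of |D s|(Omega), which is integrable.

    The area of v is the total variation on Omega of the measure (L^n, Dv) with n + 1
    components (area_tvar): the graph of v has the density (1, grad v) and the
    singular part (0, D^s v). The constant component L^n is preserved by the
    mollification with initial value L^n, so that the areas are the variations of a
    mollified family of vector measures, and tvar_mollified_cvg applies. There,
    scalar mollifications converge in L^1(0,T) as d -> 0 (emol_cvgL1): the
    mollification is a contraction of L^1(0,T) and converges on continuous functions.
    Jensen's inequality bounds the variation of the mollified measure from above by
    the scalar mollification of the variations of the D s, which converges to the
    right limit. From below the variation is bounded by its value V_k along a finite
    partition of Omega. The partitions are taken from one fixed sequence, generated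
    by the rational balls, along which the values V_k increase to the variation of
    any measure (tvar_sup_atom_variation); since V_k involves finitely many scalar functions
    of time, it passes to the limit d -> 0, and then k is let to infinity by
    dominated convergence. The convergence in L^1 of space-time is dominated
    convergence over x of the scalar convergence in time. As no subsequence is
    extracted at any place, every sequence d_i -> 0 does, such as 1/(i+1). *)

(** * The exponential mollification of a function of time *)

Section exponential_mollification.
Context {R : realType}.
Notation mu := (@lebesgue_measure R).
Implicit Types (d t T : R) (f g : R -> R).

(** The solution of d v' + v = f with v(0) = 0. The mollification with initial value
    w(x) is exp(-t/d) w(x) + emol d (u x) t, so that everything about the time
    variable reduces to this linear operator. *)
Definition emol d f t : R :=
  d^-1 * \int[mu]_(s in `[0, t]) (expR ((s - t) / d) * f s).

Lemma continuous_expR_affine (c d : R) : continuous (fun x => expR (c * x + d)).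
Proof.
move=> x; apply: continuous_comp; last exact: continuous_expR.
apply: (@cvgD _ _ _ _ _ (fun x => c * x) (cst d)); last exact: cvg_cst.
exact: mulrl_continuous.
Qed.

Lemma integral_expR_affine (c d a b : R) : c != 0 -> a <= b ->
  (\int[mu]_(x in `[a, b]) (c * expR (c * x + d))%:E =
   (expR (c * b + d) - expR (c * a + d))%:E)%E.
Proof.
move=> c0; rewrite le_eqVlt => /predU1P[->|ab].
  by rewrite set_itv1 integral_set1 subrr.
have der (x : R) : is_derive x 1 (fun x => expR (c * x + d)) (c * expR (c * x + d)).
  have H : is_derive x 1 (fun x => c * x + d) c.
    by apply: is_derive_eq; rewrite addr0; exact: mulr1.
  have := @is_derive1_comp _ expR (fun x => c * x + d) x _ _ (is_derive_expR (c * x + d)) H.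
  by rewrite mulrC.
rewrite (@continuous_FTC2 _ (fun x => c * expR (c * x + d)) (fun x => expR (c * x + d)))//.
- apply: continuous_subspaceT => x.
  apply: (@cvgM _ _ _ _ (cst c)); first exact: cvg_cst.
  exact: continuous_expR_affine.
- split.
  + by move=> x _; case: (der x).
  + exact/cvg_at_right_filter/continuous_expR_affine.
  + exact/cvg_at_left_filter/continuous_expR_affine.
- by move=> x _; rewrite derive1E; case: (der x).
Qed.

Definition ekern d t s : R := d^-1 * expR ((s - t) / d).

Lemma ekern_ge0 d t s : 0 < d -> 0 <= ekern d t s.
Proof. by move=> d0; rewrite mulr_ge0 ?expR_ge0// invr_ge0 ltW. Qed.

Lemma ekern_le d t s : 0 < d -> s <= t -> ekern d t s <= d^-1.
Proof.
move=> d0 st; rewrite ler_piMr ?invr_ge0 ?(ltW d0)//.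
by rewrite -expR0 ler_expR pmulr_lle0 ?invr_gt0// subr_le0.
Qed.

Lemma measurable_ekern2 d :
  measurable_fun setT (fun z : R * R => ekern d z.1 z.2).
Proof.
apply: measurable_funM => //; apply: measurableT_comp => //.
apply: measurable_funM => //; apply: measurable_funB; first exact: measurable_snd.
exact: measurable_fst.
Qed.

Lemma measurable_ekern d t : measurable_fun setT (ekern d t).
Proof.
apply: measurable_funM => //; apply: measurableT_comp => //.
by apply: measurable_funM => //; exact: measurable_funB.
Qed.

Lemma integral_ekern d t : 0 < d -> 0 <= t ->
  (\int[mu]_(s in `[0%R, t]) (ekern d t s)%:E = (1 - expR (- (t / d)))%:E)%E.
Proof.
move=> d0 t0.
under eq_integral do rewrite /ekern mulrBl [_ / d]mulrC.
rewrite integral_expR_affine ?invr_eq0 ?gt_eqF//.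
by rewrite mulr0 add0r [d^-1 * t]mulrC subrr expR0.
Qed.

(** The kernel is integrated here in its other variable t: this mass bound is what
    makes the mollification a contraction of L^1(0,T). *)
Lemma integral_ekern_le1 d s T : 0 < d ->
  (\int[mu]_(t in `[s, T]) (ekern d t s)%:E <= 1)%E.
Proof.
move=> d0; have [sT|Ts] := leP s T; last first.
  by rewrite set_itv_ge ?integral_set0 ?lee01// -leNgt bnd_simp -?ltNge.
have -> : (\int[mu]_(t in `[s, T]) (ekern d t s)%:E =
    \int[mu]_(t in `[s, T]) - (- d^-1 * expR (- d^-1 * t + s / d))%:E)%E.
  apply: eq_integral => t _; rewrite -EFinN /ekern mulNr opprK mulrBl [t / d]mulrC addrC.
  by rewrite mulNr.
rewrite integralN; last first.
  apply: integrable_add_def => //.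
  apply: continuous_compact_integrable; first exact: segment_compact.
  apply: continuous_subspaceT => x.
  apply: (@cvgM _ _ _ _ (cst (- d^-1))); first exact: cvg_cst.
  exact: continuous_expR_affine.
rewrite integral_expR_affine ?oppr_eq0 ?invr_eq0 ?gt_eqF//.
rewrite -EFinN lee_fin opprB mulNr [d^-1 * s]mulrC addNr expR0.
by rewrite gerBl expR_ge0.
Qed.

Lemma integrable_ekernM d f t : 0 < d -> mu.-integrable `[0, t] (EFin \o f) ->
  mu.-integrable `[0, t] (EFin \o (fun s => ekern d t s * f s)).
Proof.
move=> d0 fi.
apply: (@integrableMr _ _ _ mu _ _ (ekern d t) (EFin \o f)) => //.
  exact: measurable_funTS (measurable_ekern d t).
exists d^-1; split; first by rewrite num_real.
move=> y dy s /=; rewrite in_itv/= => /andP[s0 st].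
by rewrite ger0_norm ?ekern_ge0// (le_trans (ekern_le d0 st))// ltW.
Qed.

Lemma emolE d f t : 0 < d -> mu.-integrable `[0, t] (EFin \o f) ->
  emol d f t = \int[mu]_(s in `[0, t]) (ekern d t s * f s).
Proof.
move=> d0 fi.
have -> : emol d f t = d^-1 * \int[mu]_(s in `[0, t]) (d * (ekern d t s * f s)).
  congr *%R; apply: eq_Rintegral => s _.
  by rewrite /ekern !mulrA divff ?gt_eqF// mul1r.
rewrite RintegralZl//; last exact: integrable_ekernM.
by rewrite mulrA mulVf ?mul1r ?gt_eqF.
Qed.

Lemma le_emol d f g t : 0 < d -> mu.-integrable `[0, t] (EFin \o f) ->
  mu.-integrable `[0, t] (EFin \o g) ->
  (forall s, 0 <= s <= t -> f s <= g s) -> emol d f t <= emol d g t.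
Proof.
move=> d0 fi gi fg; rewrite !emolE//.
apply: le_Rintegral => //; [exact: integrable_ekernM|exact: integrable_ekernM|].
by move=> s /=; rewrite in_itv/= => /fg ?; rewrite ler_wpM2l ?ekern_ge0.
Qed.

Lemma emolD d f g t : 0 < d -> mu.-integrable `[0, t] (EFin \o f) ->
  mu.-integrable `[0, t] (EFin \o g) ->
  emol d (fun s => f s + g s) t = emol d f t + emol d g t.
Proof.
move=> d0 fi gi; rewrite [X in _ = X + _]emolE// [X in _ = _ + X]emolE// emolE//.
  rewrite -RintegralD//; [|exact: integrable_ekernM|exact: integrable_ekernM].
  by apply: eq_Rintegral => s _; rewrite mulrDr.
exact: (integrableD _ fi gi).
Qed.

Lemma emolZ d k f t : 0 < d -> mu.-integrable `[0, t] (EFin \o f) ->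
  emol d (fun s => k * f s) t = k * emol d f t.
Proof.
move=> d0 fi; rewrite [X in _ = _ * X]emolE// emolE//.
  rewrite -RintegralZl//; last exact: integrable_ekernM.
  by apply: eq_Rintegral => s _; rewrite mulrCA.
exact: (integrableZl _ k fi).
Qed.

Lemma ler_norm_emol d f t : 0 < d -> mu.-integrable `[0, t] (EFin \o f) ->
  `|emol d f t| <= emol d (fun s => `|f s|) t.
Proof.
move=> d0 fi; rewrite !emolE//; last exact: integrable_norm.
rewrite (le_trans (le_normr_Rintegral _ _))//; first exact: integrable_ekernM.
rewrite le_eqVlt; apply/orP; left; apply/eqP; apply: eq_Rintegral => s _ /=.
by rewrite normrM (ger0_norm (ekern_ge0 _ _ d0)).
Qed.

Lemma emol_cst d c t : 0 < d -> 0 <= t ->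
  emol d (cst c) t = c * (1 - expR (- (t / d))).
Proof.
move=> d0 t0; have ci : mu.-integrable `[0, t] (EFin \o cst (1:R)).
  apply: continuous_compact_integrable; first exact: segment_compact.
  by apply: continuous_subspaceT => x; exact: cvg_cst.
transitivity (emol d (fun s => c * cst 1 s) t).
  by congr (emol _ _ _); apply/funext => s; rewrite /= mulr1.
rewrite emolZ// emolE//; congr *%R.
rewrite -[RHS]/(fine (1 - expR (- (t / d)))%:E) -integral_ekern// /Rintegral.
by congr fine; apply: eq_integral => s _ /=; rewrite mulr1.
Qed.

End exponential_mollification.

Section emol_param.
Context {R : realType}.
Notation mu := (@lebesgue_measure R).
Implicit Types (t T : R) (f g : R -> R).

Lemma measurable_le_set dZ (Z : measurableType dZ) (f g : Z -> R) :
  measurable_fun setT f -> measurable_fun setT g ->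
  measurable [set z | f z <= g z].
Proof.
by move=> mf mg; have := measurable_fun_le measurableT mf mg; rewrite setTI.
Qed.

(** The interval of integration depends on the point, so the integrand is extended
    by zero to the whole line and Tonelli's theorem is applied to its positive and
    negative parts; the real-valued integral is the finite part of the difference of
    the two integrals even where neither is finite. *)
Lemma measurable_emol2 dZ (Z : measurableType dZ) (d : R) (U : Z * R -> R) :
  measurable_fun setT U ->
  measurable_fun setT (fun z : Z * R => emol d (fun s => U (z.1, s)) z.2).
Proof.
move=> mU.
pose A := [set y : (Z * R) * R | 0 <= y.2] `&` [set y | y.2 <= y.1.2].
have m12 : measurable_fun setT (fun y : (Z * R) * R => y.1.2).
  exact: (measurableT_comp measurable_snd measurable_fst).
have mA : measurable A.
  by apply: measurableI; apply: measurable_le_set => //; exact: measurable_snd.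
pose h (y : (Z * R) * R) := expR ((y.2 - y.1.2) / d) * U (y.1.1, y.2).
have mh : measurable_fun setT h.
  apply: measurable_funM.
    apply: measurableT_comp => //; apply: measurable_funM => //.
    by apply: measurable_funB => //; exact: measurable_snd.
  apply: (measurableT_comp mU); apply/measurable_fun_pairP; split => /=.
    exact: (measurableT_comp measurable_fst measurable_fst).
  exact: measurable_snd.
pose H := (EFin \o h) \_ A.
have mH : measurable_fun setT H.
  by apply/(measurable_restrictT _ mA)/measurable_EFinP; exact: measurable_funTS.
apply: measurable_funM => //.
rewrite (_ : (fun _ => _) = fun z => fine
  (fubini_F mu H^\+ z - fubini_F mu H^\- z)%E).
  apply: measurableT_comp => //; apply: emeasurable_funB.
    apply: measurable_fun_fubini_tonelli_F => //; exact: measurable_funepos.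
  apply: measurable_fun_fubini_tonelli_F => //; exact: measurable_funeneg.
apply/funext => -[z t]; congr fine.
have -> : (\int[mu]_(s in `[0%R, t]) (expR ((s - t) / d) * U (z, s))%:E =
    \int[mu]_s H ((z, t), s))%E.
  rewrite integral_mkcond; apply: eq_integral => s _; rewrite /H /patch/=.
  suff -> : (((z, t), s) \in A) = (s \in `[0, t]%classic) by [].
  by apply/idP/idP; rewrite !inE /A /= in_itv/=; [case=> -> ->|move=> /andP[]; split].
by rewrite integralE; congr (_ - _)%E; apply: eq_integral => s _; rewrite ?funeposE ?funenegE.
Qed.

Lemma eq_emol (d : R) f g t : (forall s, 0 <= s <= t -> f s = g s) ->
  emol d f t = emol d g t.
Proof.
move=> fg; congr *%R; apply: eq_Rintegral => s; rewrite inE/= in_itv/= => /fg.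
by move=> ->.
Qed.

Lemma emol_restrict (d : R) f t T : t <= T -> emol d f t = emol d (f \_ `[0, T]) t.
Proof.
move=> tT; apply: eq_emol => s /andP[s0 st].
by rewrite patchE mem_set//= in_itv/= s0 (le_trans st).
Qed.

Lemma integrable_itvS f t T : t <= T -> mu.-integrable `[0, T] (EFin \o f) ->
  mu.-integrable `[0, t] (EFin \o f).
Proof.
move=> tT; apply: integrableS => // s /=; rewrite !in_itv/= => /andP[-> st].
exact: le_trans st tT.
Qed.

Lemma measurable_emol (d : R) f T : measurable_fun `[0, T] f ->
  measurable_fun `[0, T] (emol d f).
Proof.
move=> mf; apply: (eq_measurable_fun (emol d (f \_ `[0, T]))).
  by move=> t; rewrite inE/= in_itv/= => /andP[_ tT]; rewrite [RHS](emol_restrict _ _ tT).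
apply: measurable_funTS.
have mF : measurable_fun setT (fun y : R * R => (f \_ `[0, T]) y.2).
  apply: (measurableT_comp _ measurable_snd).
  exact: ((measurable_restrictT _ (measurable_itv _)).1 mf).
apply: (measurableT_comp (measurable_emol2 d mF) (_ : measurable_fun setT (fun t : R => (t, t)))).
by apply/measurable_fun_pairP; split; exact: measurable_id.
Qed.

(** Tonelli's theorem: for fixed s the kernel has mass at most one in t. *)
Lemma emol_contraction (d : R) f T : 0 < d -> mu.-integrable `[0, T] (EFin \o f) ->
  (\int[mu]_(t in `[0%R, T]) `|emol d f t|%:E <=
   \int[mu]_(t in `[0%R, T]) `|f t|%:E)%E.
Proof.
move=> d0 fi; have mf : measurable_fun `[0, T] f.
  by move/integrableP: fi => [/measurable_EFinP].
pose F := f \_ `[0, T].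
have mF : measurable_fun setT F.
  exact: ((measurable_restrictT _ (measurable_itv _)).1 mf).
pose A := [set z : R * R | 0 <= z.2] `&` [set z | z.2 <= z.1] `&` [set z | z.1 <= T].
have mA : measurable A.
  by apply: measurableI; first apply: measurableI; exact: measurable_le_set.
pose h (z : R * R) : \bar R := (ekern d z.1 z.2 * `|F z.2| * \1_A z)%:E.
have h0 z : (0 <= h z)%E by rewrite lee_fin; do 2 apply: mulr_ge0 => //; exact: ekern_ge0.
have mh : measurable_fun setT h.
  apply/measurable_EFinP; apply: measurable_funM => //.
  apply: measurable_funM; first exact: measurable_ekern2.
  by apply: measurableT_comp => //; exact: (measurableT_comp mF measurable_snd).
apply: (@le_trans _ _ (\int[mu]_(t in `[0%R, T]) \int[mu]_s h (t, s))%E).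
  apply: ge0_le_integral => //.
  - by apply/measurable_EFinP; apply: measurableT_comp => //; exact: measurable_emol.
  - by apply: measurable_funTS; exact: (measurable_fun_fubini_tonelli_F (m2 := mu) h).
  - move=> t /=; rewrite in_itv/= => /andP[t0 tT].
    have fit := integrable_itvS tT fi.
    apply: (@le_trans _ _ (emol d (fun s => `|f s|) t)%:E).
      by rewrite lee_fin ler_norm_emol.
    rewrite emolE//; last exact: integrable_norm.
    rewrite fineK; last first.
      by apply: integrable_fin_num => //; apply: integrable_ekernM => //; exact: integrable_norm.
    rewrite integral_mkcond le_eqVlt; apply/orP; left; apply/eqP.
    apply: eq_integral => s _; rewrite /h /F !patchE indicE/=.
    have -> : ((t, s) \in A) = (s \in `[0, t]%classic).
      by apply/idP/idP; rewrite !inE /A /= in_itv/=; [case=> -[-> ->]|move=> /andP[]; split].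
    case: ifPn => st; last by rewrite mulr0.
    rewrite mulr1 ifT//; move: st; rewrite !inE/= !in_itv/= => /andP[-> st].
    exact: le_trans st tT.
apply: (@le_trans _ _ (\int[mu]_t \int[mu]_s h (t, s))%E).
  apply: ge0_subset_integral => //.
  - exact: (measurable_fun_fubini_tonelli_F (m2 := mu) h).
  - by move=> t _; exact: integral_ge0.
rewrite fubini_tonelli//.
rewrite [leRHS]integral_mkcond; apply: ge0_le_integral => //.
- by move=> s _; exact: integral_ge0.
- exact: (measurable_fun_fubini_tonelli_G (m1 := mu) h).
- apply/(measurable_restrictT _ (measurable_itv _)); apply/measurable_EFinP.
  exact: measurableT_comp.
- move=> s _.
  have -> : (((fun t => `|f t|%:E) \_ `[0%R, T]) s = `|F s|%:E)%E.
    by rewrite /F !patchE; case: ifP => //; rewrite normr0.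
  apply: (@le_trans _ _ (\int[mu]_(t in `[s, T]) (`|F s|%:E * (ekern d t s)%:E))%E).
    rewrite [leRHS]integral_mkcond; apply: ge0_le_integral => //.
    + exact: (measurableT_comp mh (pair2_measurable s)).
    + apply/(measurable_restrictT _ (measurable_itv _)).
      apply/measurable_EFinP/measurable_funM => //; apply: measurable_funTS.
      exact: (measurableT_comp (measurable_ekern2 d) (pair2_measurable s)).
    + move=> t _; rewrite /h patchE indicE/=.
      have [|] := boolP ((t, s) \in A).
        rewrite inE /A /= => -[[s0 st tT]]; rewrite ifT; last by rewrite inE/= in_itv/= st.
        by rewrite -EFinM lee_fin mulr1 mulrC.
      move=> _; rewrite mulr0; case: ifPn => // _.
      by rewrite -EFinM lee_fin; apply: mulr_ge0 => //; exact: ekern_ge0.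
  rewrite ge0_integralZl//.
  + by rewrite -[leRHS]mule1 lee_wpmul2l// integral_ekern_le1.
  + apply/measurable_EFinP/measurable_funTS.
    exact: (measurableT_comp (measurable_ekern2 d) (pair2_measurable s)).
  + by move=> t _; rewrite lee_fin ekern_ge0.
Qed.

End emol_param.

(** * Convergence of the mollifications in L^1(0,T) *)

Section emol_L1.
Context {R : realType}.
Notation mu := (@lebesgue_measure R).
Implicit Types (t T : R) (f g : R -> R).

Lemma integrable_continuous_itv g a b : continuous g ->
  mu.-integrable `[a, b] (EFin \o g).
Proof.
move=> cg; apply: continuous_compact_integrable; first exact: segment_compact.
exact: continuous_subspaceT.
Qed.

Lemma Rintegral_ekern_le1 (d t : R) : 0 < d -> 0 <= t ->
  \int[mu]_(s in `[0, t]) ekern d t s <= 1.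
Proof.
move=> d0 t0; rewrite /Rintegral integral_ekern//= lerBlDl lerDr; exact: expR_ge0.
Qed.

(** Since x exp(-x) <= 2 exp(-x/2), the weight t - s costs a factor d and a kernel of
    twice the parameter, whose mass is still at most one. *)
Lemma ekernMB_le (d t s : R) : 0 < d -> s <= t ->
  ekern d t s * (t - s) <= 4 * d * ekern (2 * d) t s.
Proof.
move=> d0 st; rewrite /ekern; set x := (t - s) / d.
have x0 : 0 <= x by rewrite divr_ge0 ?subr_ge0// ltW.
have -> : (s - t) / (2 * d) = - (x / 2).
  by rewrite /x -mulNr -mulNr opprB invfM [2^-1 * _]mulrC mulrA.
have -> : (s - t) / d = - (x / 2) + - (x / 2).
  by rewrite -opprD -splitr /x -mulNr opprB.
have -> : t - s = x * d by rewrite /x mulfVK// gt_eqF.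
have -> : 4 * d * ((2 * d)^-1 * expR (- (x / 2))) = 2 * expR (- (x / 2)).
  by field; rewrite gt_eqF.
rewrite expRD (_ : d^-1 * _ * _ = (x * expR (- (x / 2))) * expR (- (x / 2))); last first.
  by field; rewrite gt_eqF.
rewrite ler_wpM2r ?expR_ge0// expRN ler_pdivrMr ?expR_gt0//.
by have := expR_ge1Dx (x / 2); lra.
Qed.

(** By continuity at t and boundedness, |g s - g t| <= e + K (t - s) on [0,t]; the first
    term is averaged by a kernel of mass at most one and the second one gains a
    factor d. The missing mass exp(-t/d) of the kernel is at most d/t. *)
Lemma emol_continuous_estimate g t e : continuous g -> 0 < t -> 0 < e ->
  exists2 C, 0 <= C & forall d, 0 < d -> `|emol d g t - g t| <= e + C * d.
Proof.
move=> cg t0 e0.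
have cng : continuous (fun s => `|g s|).
  by move=> s; apply: continuous_comp; [exact: cg|exact: norm_continuous].
have [c _ cM] := EVT_max (ltW t0) (continuous_subspaceT cng).
set M := `|g c| in cM.
have M0 : 0 <= M by exact: normr_ge0.
have /cvgrPdist_le/(_ _ e0)/nbhs_ballP[eta /= eta0 geta] := cg t.
have est s : 0 <= s <= t -> `|g s - g t| <= e + (2 * M / eta) * (t - s).
  move=> /andP[s0 st]; have [ts|ts] := ltP (t - s) eta.
    rewrite distrC (le_trans (geta s _))//.
      by rewrite /ball/= ger0_norm ?subr_ge0.
    by rewrite lerDl mulr_ge0 ?subr_ge0// divr_ge0 ?mulr_ge0// ltW.
  rewrite (le_trans (ler_normB _ _))//.
  have := cM s; rewrite in_itv/= s0 st => /(_ isT) gs.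
  have := cM t; rewrite in_itv/= lexx (ltW t0) => /(_ isT) gt.
  apply: (@le_trans _ _ (2 * M)); first by rewrite mulr2n mulrDl mul1r lerD.
  rewrite -[leLHS]add0r lerD ?(ltW e0)//.
  by rewrite -mulrA ler_peMr ?mulr_ge0// mulrC ler_pdivlMr// mul1r.
exists (8 * M / eta + M / t) => [|d d0].
  by rewrite addr_ge0// divr_ge0 ?mulr_ge0// ltW.
have t0' := ltW t0.
have kint d' : 0 < d' -> mu.-integrable `[0, t] (EFin \o ekern d' t).
  move=> d'0; have := integrable_ekernM d'0 (@integrable_continuous_itv (cst 1) 0 t (@cst_continuous _ _ _)).
  by apply: eq_integrable => // s _ /=; rewrite mulr1.
have cB : continuous (fun s => g s - g t).
  by move=> s; apply: cvgB; [exact: cg|exact: cvg_cst].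
have cN : continuous (fun s => `|g s - g t|).
  by move=> s; exact: cvg_norm (cB s).
have -> : emol d g t - g t = emol d (fun s => g s - g t) t - g t * expR (- (t / d)).
  have := @emol_cst R d (- g t) t d0 t0'.
  rewrite (emolD (g := cst (- g t)) d0)//; last 2 first.
    exact: integrable_continuous_itv.
    by apply: (@integrable_continuous_itv (cst (- g t))); exact: cst_continuous.
  by move=> ->; ring.
rewrite (le_trans (ler_normB _ _))// mulrDl addrA lerD//; last first.
  rewrite normrM -mulrA ler_pM//.
    by have := cM t; rewrite in_itv/= lexx (ltW t0) => /(_ isT).
  rewrite ger0_norm ?expR_ge0// expRN (_ : t^-1 * d = (t / d)^-1); last first.
    by rewrite invfM invrK.
  rewrite lef_pV2 ?posrE ?expR_gt0 ?divr_gt0//.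
  by apply: le_trans (expR_ge1Dx (t / d)); rewrite lerDr.
rewrite (le_trans (ler_norm_emol _ _))//; first exact: integrable_continuous_itv.
rewrite emolE//; last exact: integrable_continuous_itv.
have d20 : 0 < 2 * d by rewrite mulr_gt0.
apply: (@le_trans _ _ (\int[mu]_(s in `[0, t])
    (e * ekern d t s + 8 * M / eta * d * ekern (2 * d) t s))).
  apply: le_Rintegral => //.
  - by apply: integrable_ekernM => //; exact: integrable_continuous_itv.
  - exact: (integrableD _ (integrableZl _ e (kint _ d0))
      (integrableZl _ (8 * M / eta * d) (kint _ d20))).
  - move=> s /=; rewrite in_itv/= => /[dup] /andP[s0 st] /est gs.
    apply: (le_trans (ler_wpM2l (ekern_ge0 _ _ d0) gs)).
    rewrite mulrDr mulrC lerD2l mulrCA -[8](_ : 2 * 4 = _); last by rewrite -natrM.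
    rewrite (_ : 2 * 4 * M / eta * d * _ = 2 * M / eta * (4 * d * ekern (2 * d) t s)); last by ring.
    apply: ler_wpM2l; first by rewrite divr_ge0 ?mulr_ge0// ltW.
    exact: ekernMB_le.
rewrite RintegralD//; last 2 first.
  exact: (integrableZl _ _ (kint _ d0)).
  exact: (integrableZl _ _ (kint _ d20)).
rewrite (RintegralZl e _ (kint _ d0))// (RintegralZl _ _ (kint _ d20))//.
apply: lerD.
  by rewrite ler_piMr ?(ltW e0)// Rintegral_ekern_le1.
rewrite ler_piMr//; last exact: Rintegral_ekern_le1.
by rewrite mulr_ge0 ?(ltW d0)// divr_ge0 ?mulr_ge0// ltW.
Qed.

Lemma cvge0_le (a : (\bar R)^nat) : (forall i, 0 <= a i)%E ->
  (forall e : R, 0 < e -> \forall i \near \oo, (a i <= e%:E)%E) ->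
  a @ \oo --> 0%E.
Proof.
move=> a0 ae; apply/fine_cvgP; split.
  near=> i; rewrite ge0_fin_numE//; apply: (@le_lt_trans _ _ 1%:E); last exact: ltry.
  by near: i; exact: ae.
apply/cvgrPdist_le => e e0; near=> i.
have ai : (a i <= e%:E)%E by near: i; exact: ae.
rewrite sub0r normrN ger0_norm/= ?fine_ge0// -lee_fin fineK//.
by rewrite ge0_fin_numE// (le_lt_trans ai)// ltry.
Unshelve. all: by end_near. Qed.

Lemma cvge0_near (a : (\bar R)^nat) : a @ \oo --> 0%E ->
  forall e : R, 0 < e -> \forall i \near \oo, (a i <= e%:E)%E.
Proof.
move=> /fine_cvgP[afin /cvgrPdist_le a0] e e0; near=> i.
have : `|0 - (fine \o a) i| <= e by near: i; exact: a0.
rewrite sub0r normrN => ai; rewrite -[a i]fineK; last by near: i.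
by rewrite lee_fin (le_trans _ ai)// ler_norm.
Unshelve. all: by end_near. Qed.

(** The convergence is pointwise on ]0,T] only, since at t = 0 the mollification
    vanishes and g need not; it is dominated because g is bounded. *)
Lemma emol_continuous_cvgL1 g T (d_ : nat -> R) : continuous g ->
  (forall i, 0 < d_ i) -> d_ i @[i --> \oo] --> 0 ->
  (\int[mu]_(t in `[0%R, T]) `|emol (d_ i) g t - g t|%:E)%E @[i --> \oo] --> 0%E.
Proof.
move=> cg d0 dcvg.
have [T0|T0] := ltP 0 T; last first.
  under eq_fun.
    move=> i; rewrite (_ : \int[mu]_(t in _) _ = 0)%E; first by over.
    move: T0; rewrite le_eqVlt => /predU1P[->|T0]; first by rewrite set_itv1 integral_set1.
    by rewrite set_itv_ge ?integral_set0// bnd_simp -ltNge.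
  exact: cvg_cst.
have mg D : measurable D -> measurable_fun D g.
  by move=> mD; apply: measurable_funTS; exact: continuous_measurable_fun.
have mf i : measurable_fun `[0, T] (fun t => `|emol (d_ i) g t - g t|%:E).
  apply/measurable_EFinP; apply: measurableT_comp => //.
  apply: measurable_funB; last exact: mg.
  by apply: measurable_emol; exact: mg.
have mf' i : measurable_fun `]0, T] (fun t => `|emol (d_ i) g t - g t|%:E).
  by apply: measurable_funS (mf i) => //; exact: subset_itv_oc_cc.
rewrite (eq_cvg _ _ (fun i => esym (integral_itv_obnd_cbnd (mf' i)))).
rewrite -(@integral0 _ _ _ mu `]0, T]).
have [c _ cM] : exists2 c, c \in `[0, T] & forall t, t \in `[0, T] -> `|g t| <= `|g c|.
  apply: (EVT_max (f := fun s => `|g s|)); first exact: ltW.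
  by apply: continuous_subspaceT => s; exact: cvg_norm (cg s).
apply: (@dominated_cvg _ _ _ mu _ _ _ _ (cst (2 * `|g c|)%:E)) => //.
- move=> t /=; rewrite in_itv/= => /andP[t0 tT].
  apply: cvge0_le => // e e0; have e20 : 0 < e / 2 by rewrite divr_gt0.
  have [C C0 Cest] := emol_continuous_estimate cg t0 e20.
  have C10 : 0 < C + 1 by rewrite ltr_wpDl.
  have /cvgrPdist_le /(_ (e / 2 / (C + 1))) H := dcvg.
  have {}H := H (divr_gt0 e20 C10).
  near=> i; rewrite lee_fin (le_trans (Cest _ (d0 i)))//.
  rewrite [leRHS]splitr lerD2l.
  have : `|0 - d_ i| <= e / 2 / (C + 1) by near: i.
  rewrite sub0r normrN ger0_norm ?(ltW (d0 i))// ler_pdivlMr// => /(le_trans _); apply.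
  by rewrite mulrC ler_wpM2l ?(ltW (d0 i))// lerDl.
- have := @integrable_continuous_itv (cst (2 * `|g c|)) 0 T (@cst_continuous _ _ _).
  by apply: integrableS => //; exact: subset_itv_oc_cc.
- move=> i t /=; rewrite in_itv/= => /andP[/ltW t0 tT].
  rewrite lee_fin normr_id (le_trans (ler_normB _ _))// mulr2n mulrDl mul1r lerD//; last first.
    by apply: cM; rewrite in_itv/= t0.
  have gi : mu.-integrable `[0, t] (EFin \o g) by exact: integrable_continuous_itv.
  rewrite (le_trans (ler_norm_emol _ gi))//.
  apply: (@le_trans _ _ (emol (d_ i) (cst `|g c|) t)).
    apply: le_emol => //; first exact: integrable_norm.
      by apply: integrable_continuous_itv; exact: cst_continuous.
    by move=> s /andP[s0 st]; apply: cM; rewrite in_itv/= s0 (le_trans st).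
  by rewrite emol_cst// ler_piMr// lerBlDl lerDr expR_ge0.
Unshelve. all: by end_near. Qed.

(** The mollification is a contraction of L^1(0,T), so that its convergence to the
    identity need only be checked on the dense class of continuous functions. No
    subsequence has to be extracted. *)
Lemma emol_cvgL1 f T (d_ : nat -> R) : mu.-integrable `[0, T] (EFin \o f) ->
  (forall i, 0 < d_ i) -> d_ i @[i --> \oo] --> 0 ->
  (\int[mu]_(t in `[0%R, T]) `|emol (d_ i) f t - f t|%:E)%E @[i --> \oo] --> 0%E.
Proof.
move=> fi d0 dcvg; apply: cvge0_le => [i|e e0]; first exact: integral_ge0.
have muT : (mu `[0%R, T]%classic < +oo)%E.
  by rewrite lebesgue_measure_itv/=; case: ifP => // _; rewrite ltry.
have [g_ [cg gi fg]] := approximation_continuous_integrable (measurable_itv _) muT fi.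
have e30 : 0 < e / 3 by rewrite divr_gt0.
have [k _ /(_ k (leqnn k)) fgk] := cvge0_near fg e30.
set g := g_ k in fgk.
have gik : mu.-integrable `[0, T] (EFin \o g) := gi k.
have fgi : mu.-integrable `[0, T] (EFin \o (fun s => f s - g s)).
  exact: (integrableB _ fi gik).
have mN (h : R -> R) : mu.-integrable `[0, T] (EFin \o h) -> measurable_fun `[0, T] h.
  by move=> /integrableP[/measurable_EFinP].
have mA (h : R -> R) : measurable_fun `[0, T] h -> measurable_fun `[0, T] (fun t => `|h t|%:E).
  by move=> mh; apply/measurable_EFinP; exact: measurableT_comp.
near=> i.
have mg := mN _ gik; have mf := mN _ fi; have mfg := mN _ fgi.
have m1 := mA _ (measurable_emol (d_ i) mfg).
have m2 := mA _ (measurable_funB (measurable_emol (d_ i) mg) mg).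
have m3 := mA _ mfg.
apply: (@le_trans _ _ (\int[mu]_(t in `[0%R, T])
   (`|emol (d_ i) (fun s => f s - g s)%R t|%:E + `|emol (d_ i) g t - g t|%:E
    + `|f t - g t|%:E))%E).
  apply: ge0_le_integral => //.
  - by apply: mA; apply: measurable_funB => //; exact: measurable_emol.
  - by apply: emeasurable_funD => //; exact: emeasurable_funD.
  - move=> t /=; rewrite in_itv/= => /andP[t0 tT].
    rewrite -!EFinD lee_fin.
    have -> : emol (d_ i) f t = emol (d_ i) (fun s => f s - g s) t + emol (d_ i) g t.
      rewrite -emolD//; first by apply: eq_emol => s _; rewrite subrK.
      + exact: integrable_itvS fgi.
      + exact: integrable_itvS gik.
    rewrite [X in `|X|](_ : _ = emol (d_ i) (fun s => f s - g s) t
       + (emol (d_ i) g t - g t) - (f t - g t)); last by ring.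
    by rewrite (le_trans (ler_normB _ _))// lerD2r ler_normD.
rewrite ge0_integralD//=; [|by move=> t _; rewrite adde_ge0|exact: emeasurable_funD].
rewrite ge0_integralD//=.
have -> : (e%:E = (e / 3)%:E + (e / 3)%:E + (e / 3)%:E)%E.
  by rewrite -!EFinD; congr EFin; field.
apply: leeD => //; apply: leeD.
  exact: le_trans (emol_contraction (d0 i) fgi) _.
by near: i; exact: (cvge0_near (@emol_continuous_cvgL1 _ T _ (cg k) d0 dcvg) e30).
Unshelve. all: by end_near. Qed.

End emol_L1.

(** * Integrals with respect to charges *)

Section bounded_measurable_induction.
Import HBNNSimple.
Context {d : measure_display} {T : measurableType d} {R : realType}.
Variable P : (T -> R) -> Prop.
Hypothesis P_indic : forall B, measurable B -> P \1_B.
Hypothesis P_linear : forall (k : R) (f g : T -> R) (M N : R),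
  measurable_fun setT f -> (forall x, `|f x| <= M) ->
  measurable_fun setT g -> (forall x, `|g x| <= N) ->
  P f -> P g -> P (fun x => k * f x + g x).
Hypothesis P_cvg : forall (f_ : (T -> R)^nat) (f : T -> R) (M : R),
  (forall k, measurable_fun setT (f_ k)) -> (forall k x, `|f_ k x| <= M) ->
  (forall x, f_ ^~ x @ \oo --> f x) -> (forall k, P (f_ k)) -> P f.

Let P0 : P (fun=> 0).
Proof. by have := P_indic measurable0; rewrite indic0. Qed.

Let P_nnsfun (h : {nnsfun T >-> R}) : P h.
Proof.
have -> : (h : T -> R) =
    (fun x => \sum_(r <- finmap.enum_fset (fset_set (range h))) r * \1_(h @^-1` [set r]) x).
  apply/funext => x; rewrite fimfunE fsbig_finite//=.
elim: (finmap.enum_fset _) => [|r s' ih].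
  by under eq_fun do rewrite big_nil.
under eq_fun do rewrite big_cons.
apply: (@P_linear _ _ _ 1 (\sum_(r <- s') `|r|)) => //.
- by move=> x; rewrite indicE ger0_norm ?ler0n//; case: (x \in _).
- by apply: measurable_sum => r'; apply: measurable_funM.
- move=> x; rewrite (le_trans (ler_norm_sum _ _ _))// ler_sum// => r' _.
  by rewrite normrM indicE ler_piMr// ger0_norm ?ler0n//; case: (x \in _).
- exact: P_indic.
Qed.

(** Every bounded measurable function is, up to a constant, nonnegative, hence the
    limit of the simple functions approximating it from below, which are linear
    combinations of indicators. This reduces statements about integrals to
    statements about measures of sets. *)
Lemma bounded_measurable_ind (f : T -> R) (M : R) :
  measurable_fun setT f -> (forall x, `|f x| <= M) -> P f.
Proof.
move=> mf fM.
have fM0 x : 0 <= f x + M by have := fM x; rewrite ler_norml => /andP[]; lra.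
have fMM x : f x + M <= 2 * M by have := fM x; rewrite ler_norml => /andP[]; lra.
pose g x := f x + M.
have mg : measurable_fun setT g by apply: measurable_funD.
have mEg : measurable_fun setT (EFin \o g) by exact/measurable_EFinP.
have g0 x : (0 <= (EFin \o g) x)%E by rewrite /= lee_fin; exact: fM0.
pose h := nnsfun_approx measurableT mEg.
have hg x : h ^~ x @ \oo --> g x.
  have := @cvg_nnsfun_approx _ _ _ _ measurableT _ mEg (fun x _ => g0 x) x I.
  by move=> /fine_cvg.
have Pg : P g.
  apply: (@P_cvg h g (2 * M)) => // k x; rewrite ger0_norm ?fun_ge0//.
  rewrite (le_trans _ (fMM x))// -lee_fin.
  by rewrite nnsfun_approxE; exact: (le_approx k (fun x _ => g0 x)).
have -> : f = fun x => (- M) * \1_setT x + g x.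
  by apply/funext => x; rewrite indicT /g mulr1; lra.
apply: (@P_linear _ _ _ 1 (2 * M)) => //.
- by move=> x; rewrite indicT normr1.
- by move=> x; rewrite ger0_norm; [exact: fMM|exact: fM0].
- exact: P_indic.
Qed.

End bounded_measurable_induction.

Section charge_integral.
Context {R : realType} {n : nat}.
Notation X := 'rV[R]_n.
Implicit Types (nu : {charge set X -> \bar R}) (A B : set X) (f g : X -> R).

Lemma bounded_integrable (mu : {finite_measure set X -> \bar R}) A f (M : R) :
  measurable A -> measurable_fun A f -> (forall x, A x -> `|f x| <= M) ->
  mu.-integrable A (EFin \o f).
Proof.
move=> mA mf fM; apply: measurable_bounded_integrable => //.
  by rewrite -ge0_fin_numE// fin_num_measure.
exists M; split; first by rewrite num_real.
by move=> y My x Ax; exact: le_trans (fM x Ax) (ltW My).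
Qed.

Lemma charge_integralE nu A B : measurable A -> measurable B ->
  charge_integral nu A \1_B = fine (nu (A `&` B)).
Proof.
move=> mA mB; rewrite /charge_integral /Rintegral !integral_indic//.
rewrite (jordan_decomp (hahnP nu)); last exact: measurableI.
rewrite /cadd/= cscaleN1 fineB ?fin_num_measure 1?setIC//; exact: measurableI.
Qed.

Lemma charge_integral_linear nu A f g (k M N : R) : measurable A ->
  measurable_fun A f -> (forall x, A x -> `|f x| <= M) ->
  measurable_fun A g -> (forall x, A x -> `|g x| <= N) ->
  charge_integral nu A (fun x => k * f x + g x) =
  k * charge_integral nu A f + charge_integral nu A g.
Proof.
move=> mA mf fM mg gN; rewrite /charge_integral.
have fp := @bounded_integrable (jordan_pos (hahnP nu)) _ _ _ mA mf fM.
have fn := @bounded_integrable (jordan_neg (hahnP nu)) _ _ _ mA mf fM.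
have gp := @bounded_integrable (jordan_pos (hahnP nu)) _ _ _ mA mg gN.
have gn := @bounded_integrable (jordan_neg (hahnP nu)) _ _ _ mA mg gN.
rewrite RintegralD//; last exact: (integrableZl _ k fp).
rewrite RintegralD//; last exact: (integrableZl _ k fn).
rewrite !RintegralZl//; ring.
Qed.

Lemma bounded_cvg_Rintegral (mu : {finite_measure set X -> \bar R}) A
    (f_ : (X -> R)^nat) f (M : R) : measurable A ->
  (forall k, measurable_fun A (f_ k)) -> (forall k x, A x -> `|f_ k x| <= M) ->
  (forall x, A x -> f_ ^~ x @ \oo --> f x) ->
  \int[mu]_(x in A) f_ k x @[k --> \oo] --> \int[mu]_(x in A) f x.
Proof.
move=> mA mf fM ff.
apply: fine_cvg; rewrite fineK; last first.
  apply: integrable_fin_num => //.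
  apply: (@bounded_integrable _ _ _ M) => //.
    exact: measurable_fun_cvg ff.
  move=> x Ax; have fx : `|f_ k x| @[k --> \oo] --> `|f x| by apply: cvg_norm; exact: ff.
  rewrite -(cvg_lim _ fx)//; apply: limr_le; first by apply/cvg_ex; exists `|f x|.
  by near=> k; exact: fM.
apply: (@dominated_cvg _ _ _ mu _ _ _ _ (cst M%:E)) => //.
- by move=> k; exact/measurable_EFinP.
- by move=> x Ax; apply: cvg_EFin; [near=> k|exact: ff].
- exact: finite_measure_integrable_cst.
Unshelve. all: by end_near. Qed.

Lemma bounded_cvg_charge_integral nu A (f_ : (X -> R)^nat) f (M : R) :
  measurable A ->
  (forall k, measurable_fun A (f_ k)) -> (forall k x, A x -> `|f_ k x| <= M) ->
  (forall x, A x -> f_ ^~ x @ \oo --> f x) ->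
  charge_integral nu A (f_ k) @[k --> \oo] --> charge_integral nu A f.
Proof.
move=> mA mf fM ff; apply: cvgB.
  exact: (@bounded_cvg_Rintegral (jordan_pos (hahnP nu)) _ _ _ M).
exact: (@bounded_cvg_Rintegral (jordan_neg (hahnP nu)) _ _ _ M).
Qed.

Lemma eq_charge_integral nu A f g : (forall x, A x -> f x = g x) ->
  charge_integral nu A f = charge_integral nu A g.
Proof.
move=> fg; rewrite /charge_integral.
by congr (_ - _); apply: eq_Rintegral => x; rewrite inE => /fg.
Qed.

End charge_integral.

(** * Test functions determine Borel sets *)

Section C1_functions.
Context {R : realType} {n : nat}.
Notation X := 'rV[R]_n.
Implicit Types (f g : X -> R) (h : R -> R).

Definition C1 f : Prop := (forall x, differentiable f x) /\
  forall i : 'I_n, continuous ('D_(delta_mx ord0 i) f).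

Lemma C1_continuous f : C1 f -> continuous f.
Proof. by move=> [df _] x; exact: differentiable_continuous. Qed.

Lemma C1_cst (c : R) : C1 (fun=> c).
Proof.
split=> [x|i]; first exact: differentiable_cst.
rewrite (_ : 'D_(delta_mx ord0 i) _ = cst 0); first exact: cst_continuous.
by apply/funext => x; exact: derive_cst.
Qed.

Lemma C1_coord j : C1 (fun x => x ord0 j).
Proof.
split=> [x|i]; first exact: differentiable_coord.
rewrite (_ : 'D_(delta_mx ord0 i) _ = cst ((delta_mx ord0 i : X) ord0 j)).
  exact: cst_continuous.
have @f : {linear X -> R}.
  by exists (fun N : X => N ord0 j); do 2![eexists]; do ?[constructor];
     rewrite ?mxE// => ? *; rewrite ?mxE//; move=> ?; rewrite !mxE.
apply/funext => x; rewrite (_ : (fun _ => _) = f)// deriveE; last first.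
  exact/linear_differentiable/coord_continuous.
by rewrite diff_lin//; exact: coord_continuous.
Qed.

Lemma C1_add f g : C1 f -> C1 g -> C1 (fun x => f x + g x).
Proof.
move=> [df cf] [dg cg]; split=> [x|i]; first exact: (differentiableD (df x) (dg x)).
rewrite (_ : 'D_(delta_mx ord0 i) _ =
    fun x => 'D_(delta_mx ord0 i) f x + 'D_(delta_mx ord0 i) g x).
  by move=> x; exact: (continuousD (cf i x) (cg i x)).
by apply/funext => x; apply: deriveD; exact: diff_derivable.
Qed.

Lemma C1_mul f g : C1 f -> C1 g -> C1 (fun x => f x * g x).
Proof.
move=> Cf Cg; have [df cf] := Cf; have [dg cg] := Cg.
split=> [x|i]; first exact: (differentiableM (df x) (dg x)).
rewrite (_ : 'D_(delta_mx ord0 i) _ =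
    fun x => f x * 'D_(delta_mx ord0 i) g x + g x * 'D_(delta_mx ord0 i) f x).
  move=> x; apply: (continuousD (f := fun x => f x * _) (g := fun x => g x * _)).
    exact: (continuousM (C1_continuous Cf (x := x)) (cg i x)).
  exact: (continuousM (C1_continuous Cg (x := x)) (cf i x)).
by apply/funext => x; apply: deriveM; exact: diff_derivable.
Qed.

Lemma C1_comp f h (h' : R -> R) : C1 f -> (forall y : R, is_derive y 1 h (h' y)) ->
  continuous h' -> C1 (fun x => h (f x)).
Proof.
move=> Cf dh ch'; have [df cf] := Cf.
have dh1 y : differentiable h y by apply/derivable1_diffP; case: (dh y).
split=> [x|i]; first exact: (differentiable_comp (df x) (dh1 _)).
rewrite (_ : 'D_(delta_mx ord0 i) _ =
    fun x => 'D_(delta_mx ord0 i) f x * h' (f x)).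
  move=> x; apply: (continuousM (cf i x) (continuous_comp (C1_continuous Cf (x := x)) _)).
  exact: ch'.
apply/funext => x; rewrite [LHS](@deriveE _ _ _ (h \o f)); last exact: differentiable_comp.
rewrite diff_comp//= (deriveE _ (df x)) diff1E//=.
by congr (_ * _); rewrite derive1E; case: (dh (f x)).
Qed.

(** The square of the positive part is C^1, so that composing it with a polynomial
    gives a compactly supported C^1 function. *)
Lemma is_derive_sqr_pos (y : R) :
  is_derive y 1 (fun y => Num.max 0 y ^+ 2) (2 * Num.max 0 y).
Proof.
have key (z : R) : z != 0 ->
    `|2 * Num.max 0 y - z^-1 * (Num.max 0 (z + y) ^+ 2 - Num.max 0 y ^+ 2)| <= `|z|.
  move=> z0; rewrite -(ler_pM2l (_ : 0 < `|z|)) ?normr_gt0// -normrM mulrBr mulVKf//.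
  rewrite -normrM -expr2 (ger0_norm (sqr_ge0 z)) ler_norml.
  have [y0|y0] := leP 0 y; have [zy|zy] := leP 0 (z + y); apply/andP; split; nra.
have C : (fun z : R => z^-1 *: (((fun y => Num.max 0 y ^+ 2) \o shift y) (z *: 1) -
    Num.max 0 y ^+ 2)) @ 0^' --> (2 * Num.max 0 y : R).
  apply/cvgrPdist_le => e e0; near=> z.
  rewrite /= [_%:A]mulr1 [_ *: _]/(_ * _) (le_trans (key z _))//.
    by near: z; exact: nbhs_dnbhs_neq.
  near: z; apply: nbhs_dnbhs; apply/nbhs_ballP; exists e => //= z.
  by rewrite /ball/= sub0r normrN => /ltW.
by split; [apply/cvg_ex; exists (2 * Num.max 0 y)|exact: cvg_lim C].
Unshelve. all: by end_near. Qed.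

Lemma is_derive_one_sub_exp (k y : R) :
  is_derive y 1 (fun y => 1 - expR (- k * y)) (k * expR (- k * y)).
Proof.
have H : is_derive y 1 (fun x => - k * x) (- k).
  by apply: is_derive_eq; exact: mulr1.
have K := is_derive1_comp (is_derive_expR (- k * y)) H.
have -> : k * expR (- k * y) = 0 - expR (- k * y) * - k.
  by rewrite sub0r mulrN opprK mulrC.
rewrite [X in is_derive _ _ X _](_ : _ = cst 1 - (expR \o (fun x => - k * x)))//.
exact: is_deriveB.
Qed.

End C1_functions.

Section test_functions.
Context {R : realType} {n : nat}.
Notation X := 'rV[R]_n.
Implicit Types (F G phi : X -> R) (Omega : set X).

Lemma open_measurable_rV (U : set X) : open U -> measurable U.
Proof. exact: sub_sigma_algebra. Qed.

Lemma continuous_measurable_rV F : continuous F -> measurable_fun setT F.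
Proof.
move=> cF; apply: (measurability _ (RGenOpens.measurableE R)).
move=> _ [_ [a [b ->]] <-]; rewrite setTI; apply: open_measurable_rV.
by apply: open_comp (interval_open _ _) => // x _; exact: cF.
Qed.

Lemma Cc1P Omega phi : Cc1 Omega phi <-> C1 phi /\
  exists K, [/\ compact K, K `<=` Omega & forall x, ~ K x -> phi x = 0].
Proof. by split=> [[? ? ?]|[[? ?] ?]]; split. Qed.

Lemma Cc1_measurable Omega phi : Cc1 Omega phi -> measurable_fun setT phi.
Proof. by move=> /Cc1P[/C1_continuous + _]; exact: continuous_measurable_rV. Qed.

Lemma Cc1_sub Omega Omega' phi : Omega `<=` Omega' -> Cc1 Omega phi -> Cc1 Omega' phi.
Proof.
move=> OO' /Cc1P[C [K [cK KO K0]]]; apply/Cc1P; split => //.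
by exists K; split => //; exact: subset_trans OO'.
Qed.

(** The sets where these functions are positive form a pi-system, by multiplication,
    which generates the Borel subsets of Omega; see borel_bump_ind. *)
Definition bump Omega F := Cc1 Omega F /\ forall x, 0 <= F x.

Lemma bump0 Omega : bump Omega (fun=> 0).
Proof.
split=> //; apply/Cc1P; split; first exact: C1_cst.
by exists set0; split => //; exact: compact0.
Qed.

Lemma bump_mul Omega F G : bump Omega F -> bump Omega G ->
  bump Omega (fun x => F x * G x).
Proof.
move=> [/Cc1P[CF [K [cK KO F0]]] Fp] [/Cc1P[CG _] Gp]; split; last first.
  by move=> x; rewrite mulr_ge0.
apply/Cc1P; split; first exact: C1_mul.
by exists K; split => // x /F0 ->; rewrite mul0r.
Qed.

Lemma bump_add Omega F G : bump Omega F -> bump Omega G ->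
  bump Omega (fun x => F x + G x).
Proof.
move=> [/Cc1P[CF [K [cK KO F0]]] Fp] [/Cc1P[CG [L [cL LO G0]]] Gp]; split; last first.
  by move=> x; rewrite addr_ge0.
apply/Cc1P; split; first exact: C1_add.
exists (K `|` L); split; first exact: compactU.
  by move=> x [/KO|/LO].
by move=> x /not_orP[/F0 -> /G0 ->]; rewrite addr0.
Qed.

Lemma bump_set_sub Omega F : bump Omega F -> [set x | 0 < F x] `<=` Omega.
Proof.
move=> [/Cc1P[_ [K [_ KO K0]]] _] x /= Fx; apply: KO.
by apply: contrapT => /K0 Fx0; rewrite Fx0 ltxx in Fx.
Qed.

Lemma measurable_bump_set Omega F : bump Omega F -> measurable [set x | 0 < F x].
Proof.
move=> [/Cc1P[/C1_continuous cF _] _].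
by apply: open_measurable_rV; apply: (@open_comp _ _ F [set r | 0 < r]);
  [move=> x _; exact: cF|exact: open_gt].
Qed.

(** 1 - exp(-kF) vanishes where F does, and increases to 1 where F is positive. *)
Lemma bump_cvg_indic Omega F : bump Omega F ->
  exists psi_ : (X -> R)^nat, [/\ forall k, Cc1 Omega (psi_ k),
    forall k x, `|psi_ k x| <= 1 &
    forall x, psi_ ^~ x @ \oo --> (\1_[set x | 0 < F x] x : R)].
Proof.
move=> [/Cc1P[CF [K [cK KO F0]]] Fp].
exists (fun k x => 1 - expR (- k%:R * F x)); split.
- move=> k; apply/Cc1P; split.
    apply: (C1_comp CF (is_derive_one_sub_exp k%:R)) => y.
    apply: (@cvgM _ _ _ _ (cst k%:R)); first exact: cvg_cst.
    have E : (fun y => expR (- k%:R * y)) = (fun y => expR (- k%:R * y + 0) : R).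
      by apply/funext => z; rewrite addr0.
    rewrite [X in X @ _ --> _]E [X in _ --> X](congr1 (@^~ y) E).
    exact: continuous_expR_affine.
  by exists K; split => // x /F0 ->; rewrite mulr0 expR0 subrr.
- move=> k x; have e1 : expR (- k%:R * F x) <= 1.
    by rewrite -expR0 ler_expR mulNr oppr_le0 mulr_ge0.
  by rewrite ger0_norm ?subr_ge0// gerBl expR_ge0.
- move=> x; rewrite indicE; case: (boolP (x \in _)); rewrite ?inE /= => Fx.
    rewrite -[X in _ --> X]subr0; apply: cvgB; first exact: cvg_cst.
    apply: (@squeeze_cvgr _ _ _ _ (cst 0) (fun k : nat => (F x)^-1 * k.+1%:R^-1 * 2)).
    + near=> k; rewrite expR_ge0/=.
      have k0 : (0 < k)%N by near: k; exists 1%N.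
      have kF : 0 < k%:R * F x by rewrite mulr_gt0// ltr0n.
      rewrite mulNr expRN; apply: (@le_trans _ _ (k%:R * F x)^-1).
        rewrite lef_pV2 ?posrE ?expR_gt0//.
        by apply: le_trans (expR_ge1Dx _); rewrite lerDr.
      rewrite invfM mulrC -mulrA ler_wpM2l ?invr_ge0//.
      rewrite mulrC ler_pdivlMr ?ltr0n// mulrC ler_pdivrMr ?ltr0n//.
      by rewrite -natrM ler_nat; lia.
    + exact: cvg_cst.
    + rewrite (_ : nbhs 0 = nbhs ((F x)^-1 * 0 * 2)); last by rewrite mulr0 mul0r.
      apply: cvgM; last exact: cvg_cst.
      apply: cvgM; first exact: cvg_cst.
      exact: cvg_harmonic.
  have -> : F x = 0.
    apply/eqP; rewrite eq_le Fp andbT leNgt; apply/negP => F0x.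
    by move: Fx; rewrite notin_setE/=; exact.
  under eq_fun do rewrite mulr0 expR0 subrr.
  exact: cvg_cst.
Unshelve. all: by end_near. Qed.

Definition sqdist (c x : X) : R := \sum_(i < n) (x ord0 i - c ord0 i) ^+ 2.

Lemma C1_sqdist c : C1 (sqdist c).
Proof.
rewrite /sqdist; elim: (index_enum _) => [|i s ih].
  by under eq_fun do rewrite big_nil; exact: C1_cst.
under eq_fun do rewrite big_cons expr2.
apply: C1_add ih; have C : C1 (fun x : X => x ord0 i - c ord0 i).
  by apply: C1_add; [exact: C1_coord|exact: C1_cst].
exact: C1_mul.
Qed.

(** Countably many functions, positive on the balls with rational centre and rational
    squared radius. *)
Definition ball_bump (p : 'rV[rat]_n * rat) (x : X) : R :=
  Num.max 0 (ratr p.2 - sqdist (map_mx ratr p.1) x) ^+ 2.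

Lemma ball_bump_gt0 p x :
  (0 < ball_bump p x) = (sqdist (map_mx ratr p.1) x < ratr p.2).
Proof.
rewrite /ball_bump exprn_even_gt0//= -[RHS]subr_gt0.
by case: (ltP 0 (_ - _)) => h; [rewrite gt_eqF|rewrite eqxx].
Qed.

Lemma bump_ball_bump Omega p : bounded_set Omega ->
  (forall x, sqdist (map_mx ratr p.1) x <= ratr p.2 -> Omega x) ->
  bump Omega (ball_bump p).
Proof.
move=> bO pO; split; last by move=> x; exact: sqr_ge0.
apply/Cc1P; split.
  apply: (C1_comp (h := fun y => Num.max 0 y ^+ 2)
     (f := fun x => ratr p.2 - sqdist (map_mx ratr p.1) x)).
  - apply: C1_add; first exact: C1_cst.
    rewrite (_ : (fun _ => _) = fun x => -1 * sqdist (map_mx ratr p.1) x); last first.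
      by apply/funext => x; rewrite mulN1r.
    by apply: C1_mul; [exact: C1_cst|exact: C1_sqdist].
  - exact: is_derive_sqr_pos.
  - move=> y; apply: (@cvgM _ _ _ _ (cst 2)); first exact: cvg_cst.
    by apply: (@continuous_max _ _ (cst 0) id y); [exact: cvg_cst|exact: cvg_id].
exists (sqdist (map_mx ratr p.1) @^-1` [set r | r <= ratr p.2]); split => //.
  apply: bounded_closed_compact.
    case: bO => M [Mr MO]; exists M; split => // y My x /pO; exact: MO.
  apply: closed_comp; last exact: closed_le.
  by move=> x _; exact: C1_continuous (C1_sqdist _) _.
move=> x /= /negP; rewrite -ltNge => h.
by rewrite /ball_bump max_l ?expr0n// subr_le0 ltW.
Qed.

Lemma ex_ball_bump (U : set X) x : open U -> bounded_set U -> U x ->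
  exists2 p, bump U (ball_bump p) & 0 < ball_bump p x.
Proof.
move=> oU bU Ux.
have /nbhs_ballP[e /= e0 eU] : nbhs x U by exact: open_nbhs_nbhs.
have e2 : 0 < e / 2 by rewrite divr_gt0.
have [q] := @rat_in_itvoo R 0 ((e / 2) ^+ 2) (exprn_gt0 _ e2).
rewrite in_itv/= => /andP[q0 qe].
(* The squared distance between the approximate centre c and x is at most n eta^2,
   and eta^2 <= eta <= q / (n + 1). *)
pose eta : R := Num.min 1 (Num.min (e / 2) (ratr q / n.+1%:R)).
have eta0 : 0 < eta by rewrite !lt_min ltr01 e2 divr_gt0// ltr0n.
have cP i : exists c : rat, `|x ord0 i - ratr c| < eta.
  have [c] := @rat_in_itvoo R (x ord0 i - eta) (x ord0 i + eta) ltac:(lra).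
  by rewrite in_itv/= => /andP[c1 c2]; exists c; rewrite ltr_norml; apply/andP; split; lra.
have [c {}cP] := choice cP.
exists (\row_i c i, q).
  apply: bump_ball_bump => // y /=; rewrite /sqdist => yq; apply: eU; split => // i j.
  rewrite !ord1 /ball/=.
  have := cP j; rewrite !lt_min => /and3P[_ xc _].
  have yc : `|y ord0 j - ratr (c j)| < e / 2.
    rewrite -(ltr_pXn2r (_ : 0 < 2)%N) ?nnegrE ?(ltW e2)// real_normK ?num_real//.
    apply: le_lt_trans qe; apply: le_trans yq.
    rewrite (bigD1 j)//= !mxE lerDl sumr_ge0// => k _; exact: sqr_ge0.
  rewrite -(subrKA (ratr (c j))) (le_lt_trans (ler_normD _ _))//.
  by rewrite [e]splitr ltrD// distrC.
rewrite ball_bump_gt0/= /sqdist.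
apply: (@le_lt_trans _ _ (\sum_(i < n) ratr q / n.+1%:R)).
  apply: ler_sum => i _; rewrite !mxE -real_normK ?num_real//.
  have := cP i; rewrite !lt_min => /and3P[c1 _ /ltW c3]; apply: le_trans c3.
  by rewrite expr2 ler_piMr// ltW.
rewrite sumr_const card_ord; set r : R := ratr q in q0 *.
rewrite -[ltLHS]mulr_natr -mulrA gtr_pMr// mulrC ltr_pdivrMr ?ltr0n//.
by rewrite mul1r ltr_nat.
Qed.

Definition bump_sets Omega : set (set X) :=
  [set A | exists2 F, bump Omega F & A = [set x | 0 < F x]].

Lemma bump_sets_setI Omega : setI_closed (bump_sets Omega).
Proof.
move=> _ _ [F bF ->] [G bG ->]; exists (fun x => F x * G x); first exact: bump_mul.
apply/seteqP; split=> x /=; first by case=> ? ?; rewrite mulr_gt0.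
move: (bF.2 x) (bG.2 x); rewrite !le_eqVlt => /predU1P[<-|F0]; first by rewrite mul0r ltxx.
by move=> /predU1P[<-|G0]; first by rewrite mulr0 ltxx.
Qed.

(** An open bounded set is exhausted by an increasing sequence of positivity
    sets of test functions. *)
Lemma bump_sets_exhaust U : open U -> bounded_set U ->
  exists A : (set X)^nat, [/\ forall k, bump_sets U (A k), nondecreasing_seq A &
    U = \bigcup_k A k].
Proof.
move=> oU bU.
pose F k : X -> R := if unpickle k is Some p then
  if pselect (bump U (ball_bump p)) then ball_bump p else fun=> 0 else fun=> 0.
have bF k : bump U (F k).
  rewrite /F; case: unpickle => [p|]; last exact: bump0.
  by case: pselect => b //=; exact: bump0.
pose S m x := \sum_(k < m) F k x.
have bS m : bump U (S m).
  rewrite /S; elim: m => [|m ih].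
    by under eq_fun do rewrite big_ord0; exact: bump0.
  by under eq_fun do rewrite big_ord_recr; exact: bump_add.
exists (fun m => [set x | 0 < S m x]); split.
- by move=> k; exists (S k).
- move=> k m km; apply/subsetPset => x /= /lt_le_trans; apply.
  rewrite /S -!(big_mkord xpredT (F ^~ x)) (big_cat_nat (leq0n k) km)/=.
  by rewrite lerDl sumr_ge0// => i _; case: (bF i).
- apply/seteqP; split=> [x Ux|x [k _]]; last exact: bump_set_sub (bS k) x.
  have [p bp p0] := ex_ball_bump oU bU Ux.
  exists (pickle p).+1 => //=; rewrite /S big_ord_recr/= /F pickleK.
  case: pselect => b //=; rewrite ltr_wpDl// sumr_ge0// => i _.
  by have [_] := bF i; exact.
Qed.

(** The pi-lambda theorem for test functions: a property of Borel subsets of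
    Omega that holds on the positivity sets of test functions and passes to
    proper differences and increasing unions holds for all of them. *)
Lemma borel_bump_ind Omega (P : set X -> Prop) : open Omega -> bounded_set Omega ->
  (forall F, bump Omega F -> P [set x | 0 < F x]) ->
  (forall A B, measurable A -> measurable B -> B `<=` A -> A `<=` Omega ->
    P A -> P B -> P (A `\` B)) ->
  (forall A : (set X)^nat, (forall k, measurable (A k)) ->
    (forall k, A k `<=` Omega) -> nondecreasing_seq A -> (forall k, P (A k)) ->
    P (\bigcup_k A k)) ->
  forall B, measurable B -> P (B `&` Omega).
Proof.
move=> oO bO Pbump PD Pnd.
have mbump V : bump_sets Omega V -> measurable V.
  by move=> [F bF ->]; exact: measurable_bump_set bF.
have sub V : bump_sets Omega V -> V `<=` Omega.
  by move=> [F bF ->]; exact: bump_set_sub.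
pose H := [set B : set X | measurable B /\ P (B `&` Omega)].
have mO := open_measurable_rV oO.
have PO : P Omega.
  have [A [AG ndA OA]] := bump_sets_exhaust oO bO.
  rewrite OA; apply: Pnd => // k; [exact: mbump|exact: sub|].
  by have [F bF ->] := AG k; exact: Pbump.
have lH : lambda_system setT H.
  split => //.
  - by split=> //; rewrite setTI.
  - move=> A B BA [mA PA] [mB PB]; split; first exact: measurableD.
    have -> : (A `\` B) `&` Omega = (A `&` Omega) `\` (B `&` Omega).
      by apply/seteqP; split=> x /=; tauto.
    apply: PD => //; [exact: measurableI|exact: measurableI|].
    exact: setSI.
  - move=> A ndA HA; split; first by apply: bigcupT_measurable => k; case: (HA k).
    rewrite setI_bigcupl; apply: Pnd.
    + by move=> k; apply: measurableI => //; case: (HA k).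
    + by move=> k x [].
    + by move=> k m km; apply/subsetPset; apply: setSI; apply/subsetPset; exact: ndA.
    + by move=> k; case: (HA k).
have GH : bump_sets Omega `<=` H.
  move=> V GV; split; first exact: mbump.
  by rewrite setIidl; [have [F bF ->] := GV; exact: Pbump|exact: sub].
have sGH : <<s bump_sets Omega >> `<=` H.
  exact: (lambda_system_subset (@bump_sets_setI Omega) lH GH).
have GO : <<s bump_sets Omega >> Omega.
  have [A [AG ndA OA]] := bump_sets_exhaust oO bO.
  suff : <<s bump_sets Omega >> (\bigcup_k A k) by rewrite -OA.
  by apply: sigma_algebra_bigcup => k; exact: sub_sigma_algebra.
move=> B mB.
suff : <<s bump_sets Omega >> (B `&` Omega).
  by move=> /sGH[_]; rewrite -setIA setIid.
pose C := [set B | <<s bump_sets Omega >> (B `&` Omega)].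
(* mB is membership in the smallest sigma-algebra containing the open sets. *)
apply: (mB C); split; last first.
  move=> V oV; have oVO : open (V `&` Omega) by exact: openI.
  have bVO : bounded_set (V `&` Omega).
    case: bO => M [Mr MO]; exists M; split => // y My x [_]; exact: MO.
  have [A [AG _ VA]] := bump_sets_exhaust oVO bVO.
  rewrite /C/= VA; apply: sigma_algebra_bigcup => k; apply: sub_sigma_algebra.
  have [F [cF Fp] ->] := AG k; exists F => //; split => //.
  by apply: Cc1_sub cF => x [].
split.
- by rewrite /C/= set0I; exact: (@measurable0 _ (g_sigma_algebraType (bump_sets Omega))).
- move=> A CA; rewrite /C/= setTD.
  have -> : ~` A `&` Omega = Omega `\` (A `&` Omega).
    by rewrite setDIr setDv setU0 setDE setIC.
  exact: (@measurableD _ (g_sigma_algebraType (bump_sets Omega))).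
- move=> A CA; rewrite /C/= setI_bigcupl.
  by apply: sigma_algebra_bigcup.
Qed.

End test_functions.

(** * The Euclidean norm and integration *)

Section euclidean_norm.
Context {R : realType} {m : nat}.
Implicit Types (x y : 'rV[R]_m).

Definition dotv x y : R := \sum_(i < m) x ord0 i * y ord0 i.

Lemma dotvDr x y z : dotv x (y + z) = dotv x y + dotv x z.
Proof. by rewrite -big_split/=; apply: eq_bigr => i _; rewrite mxE mulrDr. Qed.

Lemma dotv_sumr x I (s : seq I) (P : pred I) (F : I -> 'rV[R]_m) :
  dotv x (\sum_(i <- s | P i) F i) = \sum_(i <- s | P i) dotv x (F i).
Proof.
elim/big_rec2 : _ => [|i a b _ <-]; last by rewrite dotvDr.
by rewrite /dotv big1// => i _; rewrite mxE mulr0.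
Qed.

Lemma enorm_ge0 x : 0 <= enorm x. Proof. exact: sqrtr_ge0. Qed.

Lemma enorm_sqr x : enorm x ^+ 2 = \sum_(i < m) x ord0 i ^+ 2.
Proof. by rewrite sqr_sqrtr// sumr_ge0// => i _; exact: sqr_ge0. Qed.

Lemma ler_coord_enorm x i : `|x ord0 i| <= enorm x.
Proof.
rewrite -ler_sqr ?nnegrE ?enorm_ge0// enorm_sqr real_normK ?num_real//.
by rewrite (bigD1 i)//= lerDl sumr_ge0// => j _; exact: sqr_ge0.
Qed.

Lemma enorm_eq0 x : enorm x = 0 -> x = 0.
Proof.
by move=> x0; apply/rowP => i; have := ler_coord_enorm x i; rewrite x0 mxE normr_le0 => /eqP.
Qed.

Lemma enorm0 : enorm (0 : 'rV[R]_m) = 0.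
Proof.
by rewrite /enorm big1 ?sqrtr0// => i _; rewrite mxE expr0n.
Qed.

Lemma dotv_le x y : enorm x <= 1 -> dotv x y <= enorm y.
Proof.
move=> x1; have [y0|y0] := eqVneq (enorm y) 0.
  by rewrite y0 (enorm_eq0 y0) /dotv big1// => i _; rewrite mxE mulr0.
have yp : 0 < enorm y by rewrite lt_neqAle eq_sym y0 enorm_ge0.
have : 0 <= \sum_(i < m) (x ord0 i - y ord0 i / enorm y) ^+ 2.
  by apply: sumr_ge0 => i _; exact: sqr_ge0.
have -> : \sum_(i < m) (x ord0 i - y ord0 i / enorm y) ^+ 2 =
    enorm x ^+ 2 - 2 / enorm y * dotv x y + 1.
  have E1 : 1 = (\sum_(i < m) y ord0 i ^+ 2) / enorm y ^+ 2.
    by rewrite -enorm_sqr divff// expf_neq0.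
  rewrite [X in _ = _ + X]E1 (enorm_sqr x) /dotv mulr_suml mulr_sumr -sumrB.
  rewrite -big_split/=; apply: eq_bigr => i _; field.
  exact: y0.
have : enorm x ^+ 2 <= 1 by rewrite expr_le1// enorm_ge0.
move=> h1 h2; have : 2 / enorm y * dotv x y <= 2 by lra.
by rewrite mulrAC ler_pdivrMr// ler_pM2l.
Qed.

(** The norm is a maximum of linear functionals. This gives at once the triangle
    inequality and, by linearity of the integral, its continuous version
    enorm_Rintegral_le. *)
Lemma enorm_dual x : exists2 e, enorm e <= 1 & dotv e x = enorm x.
Proof.
have [x0|x0] := eqVneq (enorm x) 0.
  exists 0; first by rewrite enorm0.
  by rewrite x0 /dotv big1// => i _; rewrite mxE mul0r.
exists (\row_i (x ord0 i / enorm x)).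
  have E1 : 1 = (\sum_(i < m) x ord0 i ^+ 2) / enorm x ^+ 2.
    by rewrite -enorm_sqr divff// expf_neq0.
  rewrite {1}/enorm -[leRHS]sqrtr1 ler_wsqrtr// [leRHS]E1.
  rewrite mulr_suml le_eqVlt; apply/orP; left; apply/eqP.
  by apply: eq_bigr => i _; rewrite mxE exprMn exprVn.
rewrite /dotv -[RHS](mulfK x0) -expr2 enorm_sqr mulr_suml.
by apply: eq_bigr => i _; rewrite mxE expr2 mulrAC.
Qed.

Lemma enorm_sum_le I (s : seq I) (P : pred I) (F : I -> 'rV[R]_m) :
  enorm (\sum_(i <- s | P i) F i) <= \sum_(i <- s | P i) enorm (F i).
Proof.
have [e e1 <-] := enorm_dual (\sum_(i <- s | P i) F i).
by rewrite dotv_sumr; apply: ler_sum => i _; exact: dotv_le.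
Qed.

Lemma enormD_le x y : enorm (x + y) <= enorm x + enorm y.
Proof.
by have [e e1 <-] := enorm_dual (x + y); rewrite dotvDr lerD// dotv_le.
Qed.

Lemma enormZ (k : R) x : enorm (k *: x) = `|k| * enorm x.
Proof.
rewrite /enorm -sqrtr_sqr -sqrtrM ?sqr_ge0// mulr_sumr; congr Num.sqrt.
by apply: eq_bigr => i _; rewrite mxE exprMn.
Qed.

Lemma enormN x : enorm (- x) = enorm x.
Proof. by rewrite -scaleN1r enormZ normrN1 mul1r. Qed.

Lemma enormB_le x y : enorm (x - y) <= enorm x + enorm y.
Proof. by rewrite (le_trans (enormD_le _ _))// enormN. Qed.

Lemma ler_dist_enorm x y : `|enorm x - enorm y| <= enorm (x - y).
Proof.
have H (a b : 'rV[R]_m) : enorm a - enorm b <= enorm (a - b).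
  by have := enormD_le (a - b) b; rewrite subrK lerBlDr.
by rewrite ler_norml H andbT lerNl opprB (le_trans (H _ _))// -enormN opprB.
Qed.

Lemma enorm_le_sum x : enorm x <= \sum_(i < m) `|x ord0 i|.
Proof.
apply: (@le_trans _ _ (\sum_(i < m) enorm (x ord0 i *: (delta_mx ord0 i : 'rV[R]_m)))).
  by rewrite {1}[x]row_sum_delta; exact: enorm_sum_le.
apply: ler_sum => i _.
rewrite enormZ ler_piMr// /enorm (bigD1 i)//= big1 ?addr0 ?mxE ?eqxx ?expr1n ?sqrtr1//.
by move=> j ji; rewrite mxE (negbTE ji) andbF expr0n.
Qed.

End euclidean_norm.

Section enorm_integral.
Context {d : measure_display} {T : measurableType d} {R : realType} {m : nat}.
Variable mu : {measure set T -> \bar R}.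
Implicit Types (D : set T) (F : 'I_m -> T -> R).

Lemma measurable_enorm D F : measurable D ->
  (forall i, measurable_fun D (F i)) ->
  measurable_fun D (fun x => enorm (\row_i F i x)).
Proof.
move=> mD mF.
have ms : measurable_fun setT (@Num.sqrt R).
  by apply: continuous_measurable_fun => x; exact: sqrt_continuous.
apply: (measurableT_comp ms).
under eq_fun do under eq_bigr do rewrite mxE.
by apply: measurable_sum => i; apply: measurable_funX.
Qed.

Lemma integrable_enorm D F : measurable D ->
  (forall i, mu.-integrable D (EFin \o F i)) ->
  mu.-integrable D (EFin \o (fun x => enorm (\row_i F i x))).
Proof.
move=> mD Fi; have mF i : measurable_fun D (F i).
  by move/integrableP: (Fi i) => [/measurable_EFinP].
apply: (@le_integrable _ _ _ _ _ _ _ (fun x => (\sum_(i < m) `|F i x|)%:E)) => //.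
- by apply/measurable_EFinP; exact: measurable_enorm.
- move=> x Dx; rewrite lee_fin ger0_norm ?enorm_ge0// ger0_norm ?sumr_ge0//.
  by rewrite (le_trans (enorm_le_sum _))// ler_sum// => i _; rewrite mxE.
- under eq_fun do rewrite -sumEFin.
  by apply: integrable_sum => // i _; exact: integrable_norm.
Qed.

Lemma Rintegral_sum I (s : seq I) D (F : I -> T -> R) : measurable D ->
  (forall i, mu.-integrable D (EFin \o F i)) ->
  \int[mu]_(x in D) (\sum_(i <- s) F i x) = \sum_(i <- s) \int[mu]_(x in D) F i x.
Proof.
move=> mD Fi; elim: s => [|i s ih].
  rewrite big_nil -[RHS](mul0r (fine (mu D))) -Rintegral_cst//.
  by apply: eq_Rintegral => x _; rewrite big_nil.
rewrite big_cons -ih -RintegralD//; first by apply: eq_Rintegral => x _; rewrite big_cons.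
rewrite (_ : _ \o _ = fun x => (\sum_(i <- s) (F i x)%:E)%E); last first.
  by apply/funext => x; rewrite /= sumEFin.
by apply: (@integrable_sum _ _ _ mu D mD _ s xpredT (fun i x => (F i x)%:E)) => j _; exact: Fi.
Qed.

Lemma enorm_Rintegral_le D F : measurable D ->
  (forall i, mu.-integrable D (EFin \o F i)) ->
  enorm (\row_i \int[mu]_(x in D) F i x) <=
  \int[mu]_(x in D) enorm (\row_i F i x).
Proof.
move=> mD Fi; have [e e1 <-] := enorm_dual (\row_i \int[mu]_(x in D) F i x).
have Zi i : mu.-integrable D (EFin \o (fun x => e ord0 i * F i x)).
  exact: (integrableZl _ _ (Fi i)).
rewrite /dotv; under eq_bigr do rewrite mxE -RintegralZl//.
rewrite -Rintegral_sum//; apply: le_Rintegral => //.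
- rewrite (_ : _ \o _ = fun x => (\sum_(i < m) (e ord0 i * F i x)%:E)%E).
    by apply: (@integrable_sum _ _ _ mu D mD _ _ xpredT
      (fun i x => (e ord0 i * F i x)%:E)) => i _; exact: Zi.
  by apply/funext => x; rewrite /= sumEFin.
- exact: integrable_enorm.
- move=> x Dx; rewrite (le_trans _ (dotv_le _ e1))//.
  by rewrite /dotv; under [leRHS]eq_bigr do rewrite mxE.
Qed.

End enorm_integral.

(** * Total variation through countably many finite partitions *)

Section total_variation.
Context {R : realType} {n m : nat}.
Notation X := 'rV[R]_n.
Implicit Types (c : 'I_m -> {charge set X -> \bar R}) (A B Omega : set X).

(** The number m of components differs from the dimension n of the space because the
    area is the variation of a measure with n + 1 components; for m = n, tvar is
    vvariation. *)
Definition cvec c B : 'rV[R]_m := \row_i fine (c i B).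

Definition tvar c A : \bar R :=
  ereal_sup [set s | exists (N : nat) (B : 'I_N -> set X),
    [/\ forall k, measurable (B k), forall k, B k `<=` A, trivIset setT B &
      s = (\sum_(k < N) enorm (cvec c (B k)))%:E]].

Lemma fine_chargeU (nu : {charge set X -> \bar R}) A B :
  measurable A -> measurable B -> A `&` B = set0 ->
  fine (nu (A `|` B)) = fine (nu A) + fine (nu B).
Proof.
by move=> mA mB AB; rewrite chargeU// fineD// fin_num_measure.
Qed.

Lemma cvecU c A B : measurable A -> measurable B -> A `&` B = set0 ->
  cvec c (A `|` B) = cvec c A + cvec c B.
Proof.
by move=> mA mB AB; apply/rowP => i; rewrite !mxE fine_chargeU.
Qed.

Lemma cvec0 c : cvec c set0 = 0.
Proof. by apply/rowP => i; rewrite !mxE charge0. Qed.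

(** Finite additivity along the fibres of a map g to a finite type. *)
Lemma cvec_fibers (I : finType) (g : X -> I) (E : pred I) c A :
  (forall e, measurable (A `&` [set x | g x = e])) ->
  cvec c (A `&` [set x | E (g x)]) =
  \sum_(e | E e) cvec c (A `&` [set x | g x = e]).
Proof.
move=> mg.
suff H (s : seq I) : uniq s ->
    measurable (A `&` [set x | E (g x) && (g x \in s)]) /\
    cvec c (A `&` [set x | E (g x) && (g x \in s)]) =
    \sum_(e <- s | E e) cvec c (A `&` [set x | g x = e]).
  have [_ <-] := H _ (index_enum_uniq I); congr cvec; congr (_ `&` _).
  by apply/seteqP; split=> x /=; rewrite mem_index_enum andbT.
elim: s => [_|e s ih /= /andP[es us]].
  rewrite big_nil (_ : _ `&` _ = set0) ?cvec0//.
  by apply/seteqP; split=> x //= [_]; rewrite andbF.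
have [ihm ihs] := ih us; rewrite big_cons; case: ifPn => Ee.
  have -> : A `&` [set x | E (g x) && (g x \in e :: s)] =
      (A `&` [set x | g x = e]) `|` (A `&` [set x | E (g x) && (g x \in s)]).
    apply/seteqP; split=> [x /= [Ax /andP[Ex]]|x /= [[Ax ->]|[Ax /andP[-> gs]]]].
    - rewrite in_cons => /predU1P[->|->]; first by left.
      by right; split => //; rewrite Ex.
    - by rewrite Ee mem_head.
    - by rewrite in_cons gs orbT.
  split; first exact: measurableU.
  rewrite cvecU ?ihs//; apply/seteqP; split=> x //= [[_ gx]] [_].
  by rewrite gx (negbTE es) andbF.
have -> : A `&` [set x | E (g x) && (g x \in e :: s)] =
    A `&` [set x | E (g x) && (g x \in s)].
  apply/seteqP; split=> x /= [Ax /andP[Ex gs]]; split=> //; rewrite Ex/=.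
    move: gs; rewrite in_cons => /predU1P[ge|//].
    by rewrite -ge Ex in Ee.
  by rewrite in_cons gs orbT.
by [].
Qed.

Lemma measurable_fibers (I : finType) (g : X -> I) (E : pred I) A :
  (forall e, measurable (A `&` [set x | g x = e])) ->
  measurable (A `&` [set x | E (g x)]).
Proof.
move=> mg; rewrite (_ : _ `&` _ = \bigcup_(e in [set e | E e]) (A `&` [set x | g x = e])).
  by apply: fin_bigcup_measurable => //; exact: finite_finset.
apply/seteqP; split=> [x [Ax Ex]|x [e /= Ee [Ax ge]]]; first by exists (g x).
by split => //=; rewrite ge.
Qed.

Lemma tvar_ge_sum (I : finType) (B : I -> set X) c A :
  (forall i, measurable (B i)) -> (forall i, B i `<=` A) -> trivIset setT B ->
  ((\sum_i enorm (cvec c (B i)))%:E <= tvar c A)%E.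
Proof.
move=> mB BA tB; apply: ereal_sup_ubound => /=.
exists #|I|, (fun k => B (enum_val k)); split => //.
  by apply/trivIsetP => i j _ _ ij; move/trivIsetP : tB; apply => //;
    apply: contra_neq ij; exact: enum_val_inj.
congr EFin; rewrite (reindex (@enum_val I predT))//; last first.
  by apply: onW_bij; exact: enum_val_bij.
Qed.

Lemma tvar_ge0 c A : (0 <= tvar c A)%E.
Proof.
apply: ereal_sup_ubound => /=; exists 0%N, (fun=> set0); split => //.
- by move=> _; exact: sub0set.
- exact: trivIset_set0.
- by rewrite big_ord0.
Qed.

(** An enumeration of the balls with rational centre and radius of the form 1/(k+1),
    which generate the Borel sets. *)
Definition rat_ball (j : nat) : set X :=
  if (unpickle j : option ('rV[rat]_n * nat)) is Some p
  then ball (map_mx ratr p.1 : X) p.2.+1%:R^-1 else set0.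

Lemma measurable_rat_ball j : measurable (rat_ball j).
Proof.
rewrite /rat_ball; case: unpickle => // p; apply: open_measurable_rV; exact: ball_open.
Qed.

(** Its fibres are the atoms of the finite algebra generated by the first k balls. *)
Definition ball_code k (x : X) : {ffun 'I_k -> bool} := [ffun j : 'I_k => `[< rat_ball j x >]].

Lemma measurable_ball_code k e : measurable [set x | ball_code k x = e].
Proof.
rewrite (_ : [set x | _] = \bigcap_(j in [set: 'I_k]) (if e j then rat_ball j else ~` rat_ball j)).
  apply: fin_bigcap_measurable => // j _; case: ifP => _; first exact: measurable_rat_ball.
  by apply: measurableC; exact: measurable_rat_ball.
apply/seteqP; split=> [x /= <- j _|x /= H].
  by rewrite ffunE; case: asboolP.
apply/ffunP => j; rewrite ffunE; have := H j Logic.I.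
by case: (e j) => h; [exact/asboolP|exact/asboolPn].
Qed.

Definition cell Omega k (E : pred {ffun 'I_k -> bool}) : set X :=
  Omega `&` [set x | E (ball_code k x)].

Lemma measurable_atom Omega k e : measurable Omega ->
  measurable (Omega `&` [set x | ball_code k x = e]).
Proof. by move=> mO; apply: measurableI => //; exact: measurable_ball_code. Qed.

Lemma measurable_cell Omega k (E : pred {ffun 'I_k -> bool}) : measurable Omega ->
  measurable (cell Omega E).
Proof. by move=> mO; apply: measurable_fibers => e; exact: measurable_atom. Qed.

Lemma cell_lift Omega k k' (E : pred {ffun 'I_k -> bool}) : (k <= k')%N ->
  exists E' : pred {ffun 'I_k' -> bool}, cell Omega E' = cell Omega E.
Proof.
move=> kk'; exists (fun e' => E [ffun j : 'I_k => e' (widen_ord kk' j)]).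
rewrite /cell; congr (_ `&` _); apply/seteqP; split=> x /=.
  by congr (is_true (E _)); apply/ffunP => j; rewrite !ffunE.
by congr (is_true (E _)); apply/ffunP => j; rewrite !ffunE.
Qed.

(** The variation of c along the partition of Omega into these atoms. It depends on
    the values of c on finitely many fixed sets, so that measurability, convexity and
    convergence in time can be checked on finitely many scalar functions. *)
Definition atom_variation Omega k c : R :=
  \sum_(e : {ffun 'I_k -> bool}) enorm (cvec c (Omega `&` [set x | ball_code k x = e])).

Lemma atom_variation_ge0 Omega k c : 0 <= atom_variation Omega k c.
Proof. by apply: sumr_ge0 => e _; exact: enorm_ge0. Qed.

Lemma atom_variation_nd Omega c : measurable Omega -> nondecreasing_seq (atom_variation Omega ^~ c).
Proof.
move=> mO k k' kk'; rewrite /atom_variation.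
pose res (e' : {ffun 'I_k' -> bool}) := [ffun j : 'I_k => e' (widen_ord kk' j)].
rewrite [leRHS](partition_big res xpredT)//=; apply: ler_sum => e _.
have -> : Omega `&` [set x | ball_code k x = e] =
    Omega `&` [set x | res (ball_code k' x) == e].
  have E x : res (ball_code k' x) = ball_code k x by apply/ffunP => j; rewrite !ffunE.
  by congr (_ `&` _); apply/seteqP; split=> x /=; rewrite E => /eqP.
rewrite (@cvec_fibers _ (ball_code k') (fun e' => res e' == e)).
  exact: enorm_sum_le.
by move=> e'; exact: measurable_atom.
Qed.

Lemma atom_variation_le_tvar Omega k c : measurable Omega ->
  ((atom_variation Omega k c)%:E <= tvar c Omega)%E.
Proof.
move=> mO; apply: tvar_ge_sum => [e|e x []//|]; first exact: measurable_atom.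
apply/trivIsetP => e e' _ _ ee'; apply/seteqP; split=> x //= [[_ h] [_ h']].
by move: ee'; rewrite -h -h' eqxx.
Qed.

(** A finite measure is approximated on every Borel subset of Omega by finite
    unions of atoms, since the sets so approximated form a sigma-algebra. *)
Lemma cell_approx (sigma : {finite_measure set X -> \bar R}) Omega B (e : R) :
  measurable Omega -> measurable B -> 0 < e ->
  exists k (E : pred {ffun 'I_k -> bool}),
    (sigma ((B `&` Omega) `\` cell Omega E) +
     sigma (cell Omega E `\` (B `&` Omega)) < e%:E)%E.
Proof.
move=> mO mB e0.
pose H := [set B : set X | measurable B /\ forall e : R, 0 < e ->
  exists k (E : pred {ffun 'I_k -> bool}),
    (sigma ((B `&` Omega) `\` cell Omega E) +
     sigma (cell Omega E `\` (B `&` Omega)) < e%:E)%E].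
suff : H B by case=> _; exact.
have HU A A' : H A -> H A' -> H (A `|` A').
  move=> [mA HA] [mA' HA']; split; first exact: measurableU.
  move=> r r0; have r20 : 0 < r / 2 by rewrite divr_gt0.
  have [k [E AE]] := HA _ r20; have [k' [E' AE']] := HA' _ r20.
  have [F FE] := @cell_lift Omega _ (maxn k k') E (leq_maxl _ _).
  have [F' FE'] := @cell_lift Omega _ (maxn k k') E' (leq_maxr _ _).
  exists (maxn k k'), (fun e => F e || F' e).
  have -> : cell Omega (fun e => F e || F' e) = cell Omega E `|` cell Omega E'.
    rewrite -FE -FE'; apply/seteqP; split=> x /=.
      by case=> Ox /orP[]; [left|right].
    by case=> -[Ox h]; split => //=; rewrite h ?orbT.
  have mE := measurable_cell E mO; have mE' := measurable_cell E' mO.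
  have mAO := measurableI _ _ mA mO; have mAO' := measurableI _ _ mA' mO.
  have mAAO := measurableI _ _ (measurableU _ _ mA mA') mO.
  have m1 := measurableD mAO mE; have m1' := measurableD mAO' mE'.
  have m2 := measurableD mE mAO; have m2' := measurableD mE' mAO'.
  apply: (@le_lt_trans _ _ ((sigma ((A `&` Omega) `\` cell Omega E) +
      sigma ((A' `&` Omega) `\` cell Omega E')) +
    (sigma (cell Omega E `\` (A `&` Omega)) +
      sigma (cell Omega E' `\` (A' `&` Omega))))%E).
    apply: leeD; (apply: le_trans; last exact: measureU2); apply: le_measure; rewrite ?inE.
    - by apply: measurableD => //; exact: measurableU.
    - exact: measurableU.
    - by move=> x /=; tauto.
    - by apply: measurableD => //; exact: measurableU.
    - exact: measurableU.
    - by move=> x /=; tauto.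
  by rewrite addeACA [r]splitr EFinD; apply: lteD.
have H0 : H set0.
  split => // r r0; exists 0%N, pred0.
  have -> : cell Omega (@pred0 {ffun 'I_0 -> bool}) = set0.
    by apply/seteqP; split=> x //= [].
  by rewrite set0I setD0 !measure0 adde0 lte_fin.
have HC A : H A -> H (~` A).
  move=> [mA HA]; split; first exact: measurableC.
  move=> r r0; have [k [E AE]] := HA _ r0; exists k, (fun e => ~~ E e).
  rewrite addeC; congr (_ + _ < _)%E : AE; congr (sigma _).
    apply/seteqP; split=> x /=.
      by move=> [[Ax Ox] nE]; split; [split => //; apply/negP => Ex; apply: nE|tauto].
    move=> [[Ox /negP nE] nA]; split; last by case.
    by split => //; apply: contrapT => nAx; apply: nA.
  apply/seteqP; split=> x /=.
    by move=> [[Ox Ex] nA]; split; [split => // Ax; apply: nA|case=> _ /=; rewrite Ex].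
  move=> [[nAx Ox] nE]; split; last by case.
  by split => //; apply: contrapT => /negP h; apply: nE.
have Hseq (A : (set X)^nat) : (forall k, H (A k)) -> H (\bigcup_k A k).
  move=> HA; have mA k : measurable (A k) by case: (HA k).
  have HN N : H (\big[setU/set0]_(i < N) A i).
    by elim: N => [|N ih]; rewrite ?big_ord0// big_ord_recr/=; exact: HU.
  have mUA : measurable (\bigcup_k A k) by exact: bigcupT_measurable.
  split => // r r0; have r20 : 0 < r / 2 by rewrite divr_gt0.
  pose D N := (\bigcup_k A k) `\` (\big[setU/set0]_(i < N) A i).
  have mD N : measurable (D N) by apply: measurableD => //; case: (HN N).
  have D0 : (sigma \o D) @ \oo --> 0%E.
    rewrite -(measure0 sigma); have -> : set0 = \bigcap_N D N.
      apply/seteqP; split=> x // h.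
      have [[k _ Akx] _] := h 0%N I.
      by have [_] := h k.+1 I; apply; rewrite big_ord_recr/=; right.
    apply: nonincreasing_cvg_mu => //.
    - by rewrite -ge0_fin_numE// fin_num_measure.
    - exact: bigcapT_measurable.
    - move=> N N' NN'; apply/subsetPset; apply: setDS.
      exact: (subset_bigsetU (F := A)).
  have [N _ /(_ N (leqnn N)) DN] := cvge0_near D0 r20.
  have [mBN /(_ _ r20) [k [E BE]]] := HN N.
  exists k, E; have mE := measurable_cell E mO.
  have mBNO := measurableI _ _ mBN mO; have mUAO := measurableI _ _ mUA mO.
  apply: (@le_lt_trans _ _ ((sigma ((\big[setU/set0]_(i < N) A i `&` Omega) `\` cell Omega E) +
     sigma (D N)) + sigma (cell Omega E `\` (\big[setU/set0]_(i < N) A i `&` Omega)))%E).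
    apply: leeD.
      apply: le_trans; last exact: (measureU2 _ (measurableD mBNO mE) (mD N)).
      apply: le_measure; rewrite ?inE.
      - exact: measurableD.
      - by apply: measurableU => //; exact: measurableD.
      - move=> x /= [[Bx Ox] nC].
        by have [h|h] := pselect ((\big[setU/set0]_(i < N) A i) x); [left|right].
    apply: le_measure; rewrite ?inE.
    - exact: measurableD.
    - exact: measurableD.
    - move=> x /= [Ex h]; split=> // -[Ax Ox]; apply: h; split => //.
      by rewrite -bigcup_mkord in Ax; have [i _ Aix] := Ax; exists i.
  rewrite addeAC [r]splitr EFinD; apply: lte_leD => //; exact: fin_num_measure.
apply: (mB H); split; first split=> //.
- by move=> A HA; rewrite setTD; exact: HC.
- move=> V oV; have [D ->] := open_bigcup_ball oV.
  have -> : \bigcup_(p in D) ball (map_mx ratr p.1 : X) p.2.+1%:R^-1 =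
     \bigcup_j (if `[< exists2 p, unpickle j = Some p & D p >] then rat_ball j else set0).
    apply/seteqP; split=> [x [p Dp px]|x [j _]].
      exists (pickle p) => //; rewrite ifT; first by rewrite /rat_ball pickleK.
      by apply/asboolP; exists p => //; rewrite pickleK.
    by case: asboolP => // -[p jp Dp]; rewrite /rat_ball jp => px; exists p.
  apply: Hseq => j; case: ifP => // _; split; first exact: measurable_rat_ball.
  move=> r r0; exists j.+1, (fun e => e ord_max).
  have -> : cell Omega (fun e : {ffun 'I_j.+1 -> bool} => e ord_max) = rat_ball j `&` Omega.
    apply/seteqP; split=> x /=.
      by move=> [Ox /=]; rewrite ffunE => /asboolP.
    by move=> [jx Ox]; split => //=; rewrite ffunE; exact/asboolP.
  by rewrite setDv measure0 adde0 lte_fin.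
Qed.

(** The variation is attained in the limit along the refining partitions into
    atoms: the sets of a competing partition are approximated by disjoint unions
    of atoms of a common level. *)
Lemma tvar_sup_atom_variation Omega c (sigma : {finite_measure set X -> \bar R}) :
  measurable Omega ->
  (forall i B, measurable B -> B `<=` Omega -> `|fine (c i B)| <= fine (sigma B)) ->
  tvar c Omega = ereal_sup [set (atom_variation Omega k c)%:E | k in [set: nat]].
Proof.
move=> mO csigma; apply/eqP; rewrite eq_le; apply/andP; split; last first.
  by apply: ge_ereal_sup => _ [k _ <-]; exact: atom_variation_le_tvar.
apply: ge_ereal_sup => _ [N [B [mB BO tB ->]]].
apply/lee_addgt0Pr => e e0.
(* eta absorbs the error of N sets with m components, each off by 2 N eta. *)
pose eta := e / (N * (m * (2 * N))).+1%:R.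
have eta0 : 0 < eta by rewrite divr_gt0// ltr0n.
have BOE l : B l `&` Omega = B l by apply: setIidl; exact: BO.
have /choice[k_ kP] : forall l, exists k, exists E : pred {ffun 'I_k -> bool},
    (sigma (B l `\` cell Omega E) + sigma (cell Omega E `\` B l) < eta%:E)%E.
  by move=> l; have := cell_approx sigma mO (mB l) eta0; rewrite BOE.
pose K := (\max_l k_ l)%N.
have /choice[E_ EP] : forall l, exists E : pred {ffun 'I_K -> bool},
    (sigma (B l `\` cell Omega E) + sigma (cell Omega E `\` B l) < eta%:E)%E.
  move=> l; have [E El] := kP l.
  have [E' E'E] := @cell_lift Omega _ K E (leq_bigmax l).
  by exists E'; rewrite E'E.
(* The approximating unions of the sets B l may overlap: each atom is assigned to
   one of those that contain it. *)
pose a e : option 'I_N := [pick l | E_ l e].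
pose A l := cell Omega (fun e => a e == Some l).
have mA l : measurable (A l) by exact: measurable_cell.
have AO l : A l `<=` Omega by move=> x [].
pose D l := (B l `\` cell Omega (E_ l)) `|` (cell Omega (E_ l) `\` B l).
have mD1 l : measurable (B l `\` cell Omega (E_ l)).
  by apply: measurableD => //; exact: measurable_cell.
have mD2 l : measurable (cell Omega (E_ l) `\` B l).
  by apply: measurableD => //; exact: measurable_cell.
have mD l : measurable (D l) by exact: measurableU.
have Deta l : (sigma (D l) <= eta%:E)%E.
  by apply: ltW; apply: le_lt_trans (EP l); exact: measureU2.
have smallD S : measurable S -> S `<=` \bigcup_l D l -> fine (sigma S) <= N%:R * eta.
  move=> mS SD; rewrite -lee_fin fineK ?fin_num_measure//.
  have := @content_sub_fsum _ _ _ sigma _ [set: 'I_N] S D (@finite_finset _ _) (fun l _ => mD l) mS SD.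
  move=> /le_trans; apply.
  have -> : [set: 'I_N] = [set` index_enum 'I_N].
    by apply/seteqP; split=> l //= _; rewrite mem_index_enum.
  rewrite -fsbig_seq ?index_enum_uniq//; apply: (@le_trans _ _ (\sum_(l < N) eta%:E)%E).
    by apply: lee_sum => l _; exact: Deta.
  by rewrite sumEFin lee_fin sumr_const card_ord mulr_natl.
have Esub l x : A l x -> cell Omega (E_ l) x.
  move=> [Ox /= /eqP]; rewrite /a; case: pickP => // l' El' [<-].
  by split.
have AB l : A l `\` B l `<=` \bigcup_l D l.
  by move=> x [/Esub Ax nBx]; exists l => //; right.
have BA l : B l `\` A l `<=` \bigcup_l D l.
  move=> x [Bx nAx]; have Ox := BO _ _ Bx.
  have [Ex|nEx] := boolP (E_ l (ball_code K x)); last first.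
    by exists l => //; left; split => // -[_ /=]; rewrite (negbTE nEx).
  case aE : (a (ball_code K x)) => [j|]; last first.
    by move: aE; rewrite /a; case: pickP => // /(_ l); rewrite Ex.
  have jl : j != l by apply: contra_notN nAx => /eqP <-; split => //=; rewrite aE.
  have Aj : A j x by split => //=; rewrite aE.
  exists j => //; right; split; first exact: Esub.
  move=> Bjx; move/trivIsetP : tB => /(_ j l I I jl) /seteqP[+ _].
  by move=> /(_ x); apply.
have cAB i l : `|fine (c i (B l)) - fine (c i (A l))| <= 2 * (N%:R * eta).
  rewrite (chargeDI (c i) (mB l) (mA l)) (chargeDI (c i) (mA l) (mB l)).
  have m1 := measurableD (mB l) (mA l); have m2 := measurableD (mA l) (mB l).
  have m3 := measurableI _ _ (mB l) (mA l).
  rewrite fineD ?fin_num_measure// fineD ?fin_num_measure//; last first.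
    exact: measurableI.
  rewrite [A l `&` B l]setIC opprD addrACA subrr addr0 (le_trans (ler_normB _ _))//.
  rewrite mulr2n mulrDl mul1r; apply: lerD.
    apply: (le_trans (csigma _ _ m1 _)); last exact: smallD.
    by move=> x [/BO].
  apply: (le_trans (csigma _ _ m2 _)); last exact: smallD.
  by move=> x [/AO].
apply: (@le_trans _ _ (atom_variation Omega K c + e)%:E); last first.
  by rewrite EFinD leeD2r//; apply: ereal_sup_ubound; exists K.
rewrite lee_fin.
apply: (@le_trans _ _ (\sum_(l < N) (enorm (cvec c (A l)) + m%:R * (2 * (N%:R * eta))))).
  apply: ler_sum => l _; rewrite -[X in enorm X](subrK (cvec c (A l))) addrC.
  rewrite (le_trans (enormD_le _ _))// lerD2l (le_trans (enorm_le_sum _))//.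
  apply: (@le_trans _ _ (\sum_(i < m) (2 * (N%:R * eta)))).
    by apply: ler_sum => i _; rewrite !mxE; exact: cAB.
  by rewrite sumr_const card_ord -[leLHS]mulr_natl.
rewrite big_split/= lerD//; last first.
  rewrite sumr_const card_ord -[leLHS]mulr_natl /eta.
  have -> : N%:R * (m%:R * (2 * (N%:R * (e / (N * (m * (2 * N))).+1%:R)))) =
    (N * (m * (2 * N)))%:R * (e / (N * (m * (2 * N))).+1%:R).
    by rewrite !natrM; ring.
  rewrite mulrCA ger_pMr// ler_pdivrMr ?ltr0n// mul1r ler_nat.
  exact: leqnSn.
apply: (@le_trans _ _ (\sum_(l < N) \sum_(e | a e == Some l)
    enorm (cvec c (Omega `&` [set x | ball_code K x = e])))).
  apply: ler_sum => l _; rewrite /A /cell.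
  rewrite (@cvec_fibers _ (ball_code K) (fun e => a e == Some l)); last first.
    by move=> e'; exact: measurable_atom.
  exact: enorm_sum_le.
rewrite /atom_variation (exchange_big_dep xpredT)//=; apply: ler_sum => e' _.
case aE : (a e') => [l|]; last first.
  by rewrite big_pred0 ?enorm_ge0// => l; rewrite aE.
by rewrite (big_pred1 l) ?enorm_ge0// => l'; rewrite aE /= (inj_eq Some_inj) eq_sym.
Qed.

End total_variation.

Section dominating_measure.
Context {R : realType} {n m : nat}.
Notation X := 'rV[R]_n.
Implicit Types (A B Omega : set X).
Variable c : 'I_m -> {charge set X -> \bar R}.

Let comp (j : nat) : {measure set X -> \bar R} :=
  if (insub j : option 'I_m) is Some i then charge_variation (hahnP (c i)) else mzero.

(** The sum of the variations of the components, a finite measure dominating all of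
    them. *)
Definition sum_variations : set X -> \bar R := msum comp m.

HB.instance Definition _ := Measure.on sum_variations.

Let sum_variations_fin : fin_num_fun sum_variations.
Proof.
move=> B mB; rewrite /sum_variations /msum; elim/big_ind : _ => // [a b|j _]; first by rewrite fin_numD => -> ->.
rewrite /comp; case: (insub (j : nat) : option 'I_m) => [i|]; last by [].
exact: fin_num_measure.
Qed.

HB.instance Definition _ := @Measure_isFinite.Build _ _ _ sum_variations sum_variations_fin.

Lemma charge_le_sum_variations i B : measurable B -> `|fine (c i B)| <= fine (sum_variations B).
Proof.
move=> mB; rewrite -lee_fin fineK ?sum_variations_fin//.
rewrite -abse_EFin fineK ?fin_num_measure//.
apply: (le_trans (abse_charge_variation (hahnP (c i)) mB)).
rewrite /sum_variations /msum (bigD1 i)//= /comp valK leeDl//.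
by apply: sume_ge0 => j _; exact: measure_ge0.
Qed.

End dominating_measure.

Section tvar_theory.
Context {R : realType} {n m : nat}.
Notation X := 'rV[R]_n.
Implicit Types (A B Omega : set X) (c : 'I_m -> {charge set X -> \bar R}).

Lemma enorm_le_tvar c A B : measurable B -> B `<=` A ->
  ((enorm (cvec c B))%:E <= tvar c A)%E.
Proof.
move=> mB BA; have := @tvar_ge_sum _ _ _ unit (fun=> B) c A (fun=> mB) (fun=> BA).
rewrite big_const card_unit/= addr0; apply.
by apply/trivIsetP => -[] [] _ _.
Qed.

Lemma le_coord_tvar c A B i : measurable B -> B `<=` A ->
  (`|fine (c i B)|%:E <= tvar c A)%E.
Proof.
move=> mB BA; apply: le_trans (enorm_le_tvar c mB BA).
by rewrite lee_fin -[X in `|X|](_ : cvec c B ord0 i = _) ?ler_coord_enorm// mxE.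
Qed.

Lemma tvar_fin_num c A : measurable A -> tvar c A \is a fin_num.
Proof.
move=> mA; rewrite ge0_fin_numE ?tvar_ge0//.
apply: (@le_lt_trans _ _ (m%:R * fine (sum_variations c A))%:E); last exact: ltry.
apply: ge_ereal_sup => _ [N [B [mB BA tB ->]]]; rewrite lee_fin.
apply: (@le_trans _ _ (\sum_(k < N) m%:R * fine (sum_variations c (B k)))).
  apply: ler_sum => k _; rewrite (le_trans (enorm_le_sum _))//.
  apply: (@le_trans _ _ (\sum_(i < m) fine (sum_variations c (B k)))).
    by apply: ler_sum => i _; rewrite mxE charge_le_sum_variations.
  by rewrite sumr_const card_ord -[leLHS]mulr_natl.
rewrite -mulr_sumr ler_wpM2l// -lee_fin -sumEFin.
under eq_bigr do rewrite fineK ?fin_num_measure//.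
rewrite fineK ?fin_num_measure//.
have := @measure_fin_bigcup _ _ _ (sum_variations c) _ [set` index_enum 'I_N] B.
rewrite -fsbig_seq ?index_enum_uniq// => <-//.
- apply: le_measure; rewrite ?inE//.
    by apply: fin_bigcup_measurable.
  by move=> x [k _ /BA].
- by apply/trivIsetP => i j _ _; move/trivIsetP : tB; apply.
Qed.

Lemma atom_variation_cvg Omega c : measurable Omega ->
  atom_variation Omega k c @[k --> \oo] --> fine (tvar c Omega).
Proof.
move=> mO.
have E := tvar_sup_atom_variation (c := c) (sigma := sum_variations c) mO
  (fun i B mB _ => charge_le_sum_variations c i mB).
have nd : nondecreasing_seq (fun k => (atom_variation Omega k c)%:E).
  by move=> k k' kk'; rewrite lee_fin; exact: atom_variation_nd.
by have := ereal_nondecreasing_cvgn nd;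
  rewrite -E -[tvar c Omega]fineK ?tvar_fin_num// => /fine_cvg.
Qed.

Lemma atom_variation_le Omega k c : measurable Omega ->
  atom_variation Omega k c <= fine (tvar c Omega).
Proof.
by move=> mO; rewrite -lee_fin fineK ?tvar_fin_num//; exact: atom_variation_le_tvar.
Qed.

Lemma vvariationE (D : vcharge) (A : set 'rV[R]_n) : vvariation D A = tvar D A.
Proof. by []. Qed.

End tvar_theory.

(** * Total variation and Lebesgue decomposition *)

Section tvar_decomposition.
Context {R : realType} {n m : nat}.
Notation X := 'rV[R]_n.
Variables (mu : {measure set X -> \bar R}) (Omega N : set X).
Variables (c S : 'I_m -> {charge set X -> \bar R}) (H : 'I_m -> X -> R).
Hypothesis mO : measurable Omega.
Hypothesis muO : (mu Omega < +oo)%E.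
Hypothesis mN : measurable N.
Hypothesis muN : mu N = 0%E.
Hypothesis SN : tvar S (Omega `\` N) = 0%E.
Hypothesis Hi : forall i, mu.-integrable Omega (EFin \o H i).
Hypothesis cE : forall i B, measurable B -> B `<=` Omega ->
  (c i B = \int[mu]_(x in B) (H i x)%:E + S i B)%E.

Let HN x : R := enorm (\row_i H i x).

Let HNi : mu.-integrable Omega (EFin \o HN).
Proof. exact: integrable_enorm. Qed.

Let cvecE B : measurable B -> B `<=` Omega ->
  cvec c B = \row_i \int[mu]_(x in B) H i x + cvec S B.
Proof.
move=> mB BO; apply/rowP => i; rewrite !mxE cE// fineD ?fin_num_measure//.
by apply: integrable_fin_num => //; exact: integrableS (Hi i).
Qed.

Let HNS B : measurable B -> B `<=` Omega -> mu.-integrable B (EFin \o HN).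
Proof. by move=> mB BO; exact: integrableS HNi. Qed.

Let tvar_le : (tvar c Omega <= \int[mu]_(x in Omega) (HN x)%:E + tvar S Omega)%E.
Proof.
apply: ge_ereal_sup => _ [K [B [mB BO tB ->]]].
apply: (@le_trans _ _ (\sum_(k < K) \int[mu]_(x in B k) HN x +
   \sum_(k < K) enorm (cvec S (B k)))%:E).
  rewrite lee_fin -big_split/=; apply: ler_sum => k _.
  rewrite cvecE// (le_trans (enormD_le _ _))// lerD2r.
  by apply: enorm_Rintegral_le => // i; exact: integrableS (Hi i).
rewrite EFinD; apply: leeD; last exact: tvar_ge_sum.
rewrite -sumEFin; under eq_bigr do rewrite fineK ?integrable_fin_num ?HNS//.
have U : trivIset [set` index_enum 'I_K] B.
  by apply/trivIsetP => i j _ _; move/trivIsetP : tB; apply.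
have subO : \big[setU/set0]_(k <- index_enum 'I_K) B k `<=` Omega.
  by elim/big_ind : _ => // A A' hA hA' x [/hA|/hA'].
have mU : measurable (\big[setU/set0]_(k <- index_enum 'I_K) B k).
  exact: bigsetU_measurable.
have mHN : measurable_fun Omega (EFin \o HN) by exact: measurable_int HNi.
rewrite -(ge0_integral_bigsetU mu mB (index_enum_uniq _) U)//=.
- apply: ge0_subset_integral => //.
  by move=> x _; rewrite lee_fin enorm_ge0.
- exact: measurable_funS mHN.
- by move=> x _; rewrite lee_fin enorm_ge0.
Qed.

Let mON : measurable (Omega `\` N). Proof. exact: measurableD. Qed.

Let S0 i B : measurable B -> B `<=` Omega `\` N -> S i B = 0%E.
Proof.
move=> mB BON; have := le_coord_tvar S i mB BON.
by rewrite SN lee_fin normr_le0 => /eqP h; rewrite -[LHS]fineK ?fin_num_measure// h.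
Qed.

Let H0 i B : measurable B -> B `<=` Omega -> B `<=` N -> \int[mu]_(x in B) H i x = 0.
Proof.
move=> mB BO BN; rewrite /Rintegral null_set_integral//.
  by apply: measurable_funS (measurable_int _ (Hi i)).
by apply/eqP; rewrite eq_le measure_ge0 andbT -muN le_measure ?inE.
Qed.

Import HBSimple.

(** For a simple function h the field H is nearly constant on the fibres of h,
    so that the lengths of its integrals over these fibres add up to nearly the
    integral of its length. *)
Let fibers_approx (e : R) : 0 < e -> exists (I : finType) (g : X -> I),
  (forall i, measurable [set x | g x = i]) /\
  (fine (\int[mu]_(x in Omega) (HN x)%:E) - e <=
    \sum_(i : I) enorm (\row_j \int[mu]_(x in (Omega `\` N) `&` [set x | g x = i]) H j x)).
Proof.
move=> e0; pose eta := e / (2 * m.+1%:R).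
have eta0 : 0 < eta by rewrite divr_gt0// mulr_gt0// ltr0n.
have /choice[h hP] : forall j, exists h : {sfun X >-> R}, mu.-integrable Omega (EFin \o h) /\
    (\int[mu]_(x in Omega) `|(H j x)%:E - (h x)%:E| <= eta%:E)%E.
  move=> j; have [g_ [gi _ gcvg]] := approximation_sfun_integrable mO (Hi j).
  have [k _ /(_ k (leqnn k)) hk] := cvge0_near gcvg eta0.
  by exists (g_ k).
pose s := flatten [seq finmap.enum_fset (fset_set (range (h j))) | j <- index_enum 'I_m].
have hs j x : h j x \in s.
  apply/flattenP; exists (finmap.enum_fset (fset_set (range (h j)))).
    by apply/mapP; exists j => //; exact: mem_index_enum.
  have := in_fset_set (@fimfunP _ _ (h j)) (h j x).
  by rewrite (@mem_set _ (range (h j)))//; exists x.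
pose g x : {ffun 'I_m -> seq_sub s} := [ffun j => SeqSub (hs j x)].
have gE x i : (g x = i) <-> forall j, h j x = ssval (i j).
  split=> [<- j|hx]; first by rewrite ffunE.
  by apply/ffunP => j; rewrite ffunE; apply: val_inj; exact: hx.
have mg i : measurable [set x | g x = i].
  rewrite (_ : [set x | _] = \bigcap_(j in [set: 'I_m]) (h j @^-1` [set ssval (i j)])).
    by apply: fin_bigcap_measurable => // j _; exact: measurable_sfunP.
  by apply/seteqP; split=> [x /gE hx j _|x hx]; [exact: hx|apply/gE => j; exact: hx].
exists {ffun 'I_m -> seq_sub s}, g; split => //.
pose B i := (Omega `\` N) `&` [set x | g x = i].
have mB i : measurable (B i) by exact: measurableI.
have BO i : B i `<=` Omega by move=> x [[]].
pose dl j x := H j x - h j x.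
have dli j : mu.-integrable Omega (EFin \o dl j).
  have [hi _] := hP j.
  exact: (integrableB _ (Hi j) hi).
pose Dn x : R := enorm (\row_j dl j x).
have Dni : mu.-integrable Omega (EFin \o Dn) by exact: integrable_enorm.
pose f x := HN x - 2 * Dn x.
have fi : mu.-integrable Omega (EFin \o f).
  exact: (integrableB _ HNi (integrableZl _ 2 Dni)).
have fB i : \int[mu]_(x in B i) f x <= enorm (\row_j \int[mu]_(x in B i) H j x).
  have dB j : mu.-integrable (B i) (EFin \o dl j) by exact: integrableS (dli j).
  have hB j : mu.-integrable (B i) (EFin \o h j) by exact: integrableS (hP j).1.
  have DB : mu.-integrable (B i) (EFin \o Dn) by exact: integrableS Dni.
  have fiB : mu.-integrable (B i) (EFin \o f) by exact: integrableS fi.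
  pose v : 'rV[R]_m := \row_j ssval (i j).
  have vE x : B i x -> \row_j h j x = v.
    by move=> [_ /gE hx]; apply/rowP => j; rewrite !mxE hx.
  have -> : \row_j \int[mu]_(x in B i) H j x =
      fine (mu (B i)) *: v + \row_j \int[mu]_(x in B i) dl j x.
    apply/rowP => j; rewrite !mxE [_ * ssval _]mulrC -Rintegral_cst//.
    have -> : \int[mu]_(x in B i) ssval (i j) = \int[mu]_(x in B i) h j x.
      by apply: eq_Rintegral => x; rewrite inE => -[_ /gE ->].
    rewrite -RintegralD//; apply: eq_Rintegral => x _.
    by rewrite /dl addrC subrK.
  have h1 : enorm (\row_j \int[mu]_(x in B i) dl j x) <= \int[mu]_(x in B i) Dn x.
    exact: enorm_Rintegral_le.
  have h2 : \int[mu]_(x in B i) (f x + Dn x) <= fine (mu (B i)) * enorm v.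
    rewrite mulrC -Rintegral_cst//; apply: le_Rintegral => //.
    - exact: (integrableD _ fiB DB).
    - apply: (@eq_integrable _ _ _ _ _ _ (EFin \o (fun x => enorm (\row_j h j x)))) => //.
        by move=> x; rewrite inE => /vE /= ->.
      exact: integrable_enorm.
    - move=> x Bx; rewrite -(vE _ Bx) /f.
      have : HN x <= enorm (\row_j h j x) + Dn x.
        rewrite /HN (_ : \row_j H j x = \row_j h j x + \row_j dl j x); first exact: enormD_le.
        by apply/rowP => j; rewrite !mxE /dl addrC subrK.
      by lra.
  rewrite RintegralD// in h2.
  have h3 : enorm (fine (mu (B i)) *: v) = fine (mu (B i)) * enorm v.
    by rewrite enormZ ger0_norm// fine_ge0.
  set a := \row_j \int[mu]_(x in B i) dl j x in h1 *.
  have := enormB_le (fine (mu (B i)) *: v + a) a; rewrite addrK h3.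
  by lra.
apply: (@le_trans _ _ (\sum_i \int[mu]_(x in B i) f x)); last exact: ler_sum.
have -> : \sum_i \int[mu]_(x in B i) f x = \int[mu]_(x in Omega) f x.
  transitivity (\sum_i \int[mu]_(x in Omega) (f \_ (B i)) x).
    apply: eq_bigr => i _; rewrite -Rintegral_mkcondr; congr Rintegral.
    by apply/esym/setIidr; exact: BO.
  rewrite -Rintegral_sum//; last first.
    move=> i; rewrite -restrict_EFin; apply/(integrable_restrict mu (mB i) mO).
    by apply: integrableS fi => //; exact: measurableI.
  have mON' : measurable (Omega `&` ~` N) by exact: mON.
  transitivity (\int[mu]_(x in Omega) (f \_ (~` N)) x).
    apply: eq_Rintegral => x; rewrite inE => Ox.
    rewrite (bigD1 (g x))//= big1 ?addr0.
      rewrite !patchE; congr (if _ then _ else _).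
      by apply/idP/idP; rewrite !inE; [case=> -[]|move=> nN; split].
    move=> i gi; rewrite patchE ifF//; apply/negbTE; rewrite notin_setE => -[_ /= gxi].
    by rewrite gxi eqxx in gi.
  rewrite -Rintegral_mkcondr /Rintegral; congr fine.
  by rewrite -setDE -(negligible_integral mN mO fi muN).
rewrite RintegralB//; last exact: (integrableZl _ 2 Dni).
rewrite RintegralZl// lerB//.
have le1 : \int[mu]_(x in Omega) Dn x <= \sum_(j < m) \int[mu]_(x in Omega) `|dl j x|.
  rewrite -Rintegral_sum//; last by move=> j; exact: integrable_norm.
  apply: le_Rintegral => //.
    rewrite (_ : _ \o _ = fun x => (\sum_(j < m) `|dl j x|%:E)%E).
      by apply: (@integrable_sum _ _ _ mu Omega mO _ _ xpredT
        (fun j x => `|dl j x|%:E)) => j _; exact: integrable_norm.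
    by apply/funext => x; rewrite /= sumEFin.
  move=> x Ox; rewrite (le_trans (enorm_le_sum _))//.
  by apply: ler_sum => j _; rewrite mxE.
have le2 : \sum_(j < m) \int[mu]_(x in Omega) `|dl j x| <= m%:R * eta.
  apply: (@le_trans _ _ (\sum_(j < m) eta)); last first.
    by rewrite sumr_const card_ord -[leLHS]mulr_natl.
  apply: ler_sum => j _; have [_ hj] := hP j.
  rewrite -lee_fin fineK//.
  by apply: integrable_fin_num => //; exact: integrable_norm.
have le3 : 2 * (m%:R * eta) <= e.
  have -> : 2 * (m%:R * eta) = m%:R / m.+1%:R * e.
    by rewrite /eta; field; rewrite nat1r pnatr_eq0.
  by rewrite ler_piMl ?(ltW e0)// ler_pdivrMr ?ltr0n// mul1r ler_nat.
lra.
Qed.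

(** The two parts live on the disjoint sets Omega \ N and N, where their variations
    are computed by separate partitions. *)
Lemma tvar_decomposition :
  tvar c Omega = (\int[mu]_(x in Omega) (enorm (\row_i H i x))%:E + tvar S Omega)%E.
Proof.
apply/eqP; rewrite eq_le tvar_le/=.
have tS := tvar_fin_num S mO.
have iH : (\int[mu]_(x in Omega) (HN x)%:E)%E \is a fin_num by exact: integrable_fin_num.
apply/lee_addgt0Pr => e e0; have e20 : 0 < e / 2 by rewrite divr_gt0.
have [I [g [mg hI]]] := fibers_approx e20.
have [_ [K [C [mC CO tC ->]]] hC] := ub_ereal_sup_adherent e20 tS.
pose B (z : I + 'I_K) : set X := match z with
  | inl i => (Omega `\` N) `&` [set x | g x = i] | inr k => C k `&` N end.
have := @tvar_ge_sum _ _ _ _ B c Omega.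
have mB z : measurable (B z) by case: z => [i|k]; exact: measurableI.
have BO z : B z `<=` Omega by case: z => [i|k] x [] => [[]//|/CO].
move=> /(_ mB BO) H1.
have {}H1 : ((\sum_i enorm (cvec c (B i)))%:E <= tvar c Omega)%E.
  apply: H1; apply/trivIsetP => -[i|k] [i'|k'] _ _ zz'; apply/seteqP; split=> x //=.
  - by move=> [[_ h] [_ h']]; move: zz'; rewrite -h -h' eqxx.
  - by move=> [[[_ nN] _] [_ Nx]].
  - by move=> [[_ Nx] [[_ nN] _]].
  - move=> [[Ckx _] [Ck'x _]]; move/trivIsetP : tC => /(_ k k' Logic.I Logic.I).
    have kk' : k != k' by apply: contra_neq zz' => ->.
    by move=> /(_ kk') /seteqP[+ _] => /(_ x); apply.
apply: le_trans (leeD2r _ H1).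
rewrite -(fineK tS) -(fineK iH) -!EFinD lee_fin big_sumType/=.
have -> : \sum_(i : I) enorm (cvec c ((Omega `\` N) `&` [set x | g x = i])) =
    \sum_(i : I) enorm (\row_j \int[mu]_(x in (Omega `\` N) `&` [set x | g x = i]) H j x).
  apply: eq_bigr => i _; rewrite cvecE; [|exact: (mB (inl i))|exact: (BO (inl i))].
  congr enorm; apply/rowP => j; rewrite !mxE S0 ?addr0//; first exact: (mB (inl i)).
have -> : \sum_(k < K) enorm (cvec c (C k `&` N)) = \sum_(k < K) enorm (cvec S (C k)).
  apply: eq_bigr => k _; rewrite cvecE; [|exact: (mB (inr k))|exact: (BO (inr k))].
  congr enorm; apply/rowP => j; rewrite !mxE H0 ?add0r//; last 2 first.
    exact: (mB (inr k)).
    exact: (BO (inr k)).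
  rewrite [in RHS](chargeDI (S j) (mC k) mN).
  have -> : S j (C k `\` N) = 0%E; last by rewrite add0e.
  by apply: S0; [exact: measurableD|move=> x [/CO]].
have {}hC : (tvar S Omega - (e / 2)%:E < (\sum_(k < K) enorm (cvec S (C k)))%:E)%E := hC.
move: hC; rewrite -(fineK tS) -EFinB lte_fin => hC.
lra.
Qed.

End tvar_decomposition.

(** * The area functional as a total variation *)

Section charge_continuity.
Context {R : realType} {n : nat}.
Notation X := 'rV[R]_n.

(** A charge is the difference of two finite measures. *)
Lemma charge_nondecreasing_cvg (nu : {charge set X -> \bar R}) (A : (set X)^nat) :
  (forall k, measurable (A k)) -> nondecreasing_seq A ->
  fine (nu (A k)) @[k --> \oo] --> fine (nu (\bigcup_k A k)).
Proof.
move=> mA ndA; have mU := bigcupT_measurable _ mA.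
have H (mu0 : {finite_measure set X -> \bar R}) :
    fine (mu0 (A k)) @[k --> \oo] --> fine (mu0 (\bigcup_k A k)).
  apply: fine_cvg; rewrite fineK ?fin_num_measure//.
  exact: nondecreasing_cvg_mu.
have E B : measurable B -> fine (nu B) =
    fine (jordan_pos (hahnP nu) B) - fine (jordan_neg (hahnP nu) B).
  move=> mB; rewrite (jordan_decomp (hahnP nu) mB) /cadd/= cscaleN1 fineB//;
  by rewrite fin_num_measure.
rewrite E//; under eq_fun do rewrite E//.
apply: cvgB; exact: H.
Qed.

End charge_continuity.

Section area_formula.
Context {R : realType} {n : nat}.
Notation X := 'rV[R]_n.
Notation mu := (lebesgue_rV n).
Implicit Types (D : 'I_n -> {charge set X -> \bar R}).

(** A null set of maximal mass carries the whole singular part. *)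
Lemma maximal_null_set (mu0 : {measure set X -> \bar R})
    (sigma : {finite_measure set X -> \bar R}) (Omega : set X) : measurable Omega ->
  exists N, [/\ measurable N, N `<=` Omega, mu0 N = 0%E &
    forall A, measurable A -> A `<=` Omega `\` N -> mu0 A = 0%E -> sigma A = 0%E].
Proof.
move=> mO; pose V := [set sigma N | N in
  [set N | [/\ measurable N, N `<=` Omega & mu0 N = 0%E]]].
have Vub x : V x -> (x <= sigma Omega)%E.
  by move=> [N [mN NO _] <-]; apply: le_measure; rewrite ?inE.
have V0 : V 0%E.
  by exists set0; [split; [exact: measurable0|exact: sub0set|exact: measure0]|exact: measure0].
have sV : ereal_sup V \is a fin_num.
  rewrite ge0_fin_numE; last exact: ereal_sup_ubound.
  apply: (@le_lt_trans _ _ (sigma Omega)); first exact: ge_ereal_sup.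
  by rewrite -ge0_fin_numE// fin_num_measure.
have /choice[N_ NP] : forall k : nat, exists N, [/\ measurable N, N `<=` Omega, mu0 N = 0%E &
    (ereal_sup V - k.+1%:R^-1%:E < sigma N)%E].
  move=> k; have k0 : (0 : R) < k.+1%:R^-1 by rewrite invr_gt0 ltr0n.
  have [_ [N [mN NO N0] <-] h] := ub_ereal_sup_adherent k0 sV.
  by exists N.
have mN_ k : measurable (N_ k) by case: (NP k).
have mN : measurable (\bigcup_k N_ k) by exact: bigcupT_measurable.
have N0 : mu0 (\bigcup_k N_ k) = 0%E.
  apply/eqP; rewrite eq_le measure_ge0 andbT.
  apply: (le_trans (measure_sigma_subadditive mu0 mN_ mN (@subset_refl _ _))).
  by rewrite eseries0// => k _ _; case: (NP k).
have NO : \bigcup_k N_ k `<=` Omega by move=> x [k _]; case: (NP k) => _ + _ _; apply.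
exists (\bigcup_k N_ k); split => // A mA AON A0.
have AO : A `<=` Omega by move=> x /AON[].
have AN : (\bigcup_k N_ k) `&` A = set0.
  by apply/seteqP; split=> x // [Nx /AON[]].
have VNA : (sigma ((\bigcup_k N_ k) `|` A) <= ereal_sup V)%E.
  apply: ereal_sup_ubound; exists ((\bigcup_k N_ k) `|` A) => //; split.
  - exact: measurableU.
  - by move=> x [/NO|/AO].
  - have -> : (mu0 ((\bigcup_k N_ k) `|` A) = mu0 (\bigcup_k N_ k) + mu0 A)%E.
      exact: measureU.
    by rewrite N0 A0 adde0.
have VN : (ereal_sup V <= sigma (\bigcup_k N_ k))%E.
  apply/lee_addgt0Pr => e e0.
  have [k ke] : exists k : nat, k.+1%:R^-1 < e.
    by have [k _ kP] := near_infty_natSinv_lt (PosNum e0); exists k; exact: (kP k (leqnn k)).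
  have [_ _ _ hk] := NP k.
  rewrite -leeBlDr//; apply: (@le_trans _ _ (sigma (N_ k))); last first.
    by apply: le_measure; rewrite ?inE//; exact: bigcup_sup.
  apply/ltW; apply: le_lt_trans hk.
  by rewrite leeB// lee_fin ltW.
apply/eqP; rewrite eq_le measure_ge0 andbT.
have := le_trans VNA VN; rewrite measureU//.
by rewrite -[leRHS]adde0 leeD2lE// fin_num_measure.
Qed.

(** Outside a null set N of maximal mass for the dominating measure, D is absolutely
    continuous, so that its density is given by the Radon-Nikodym theorem; the
    singular part is the restriction of D to N. *)
Lemma lebesgue_decomposition_exists Omega D : measurable Omega ->
  exists gS, is_lebesgue_decomposition Omega D gS.
Proof.
move=> mO; have [N [mN NO N0 Nmax]] := maximal_null_set mu (sum_variations D) mO.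
have mON : measurable (Omega `\` N) by exact: measurableD.
pose nu i : {charge set X -> \bar R} := crestr0 (D i) mON.
have numu i : nu i `<< mu.
  apply/null_content_dominatesP => A mA A0.
  rewrite /nu/= /crestr0 mem_set// /crestr.
  have mAON := measurableI _ _ mA mON.
  have vA0 : sum_variations D (A `&` (Omega `\` N)) = 0%E.
    apply: Nmax => //; apply/eqP; rewrite eq_le measure_ge0 andbT -A0.
    by apply: le_measure; rewrite ?inE.
  have := charge_le_sum_variations D i mAON; rewrite vA0/= normr_le0 => /eqP h.
  by rewrite -[LHS]fineK ?fin_num_measure// h.
pose g (x : X) : X := \row_i fine (Radon_Nikodym (nu i) mu x).
have gE i : EFin \o (fun x => g x ord0 i) = Radon_Nikodym (nu i) mu.
  by apply/funext => x; rewrite /= mxE fineK// Radon_Nikodym_fin_num.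
have gi i : mu.-integrable setT (EFin \o (fun x => g x ord0 i)).
  by rewrite gE; exact: Radon_Nikodym_integrable.
pose S : vcharge := fun i => crestr0 (D i) mN.
exists (g, S); split => /=.
- by move=> i; apply: integrableS (gi i).
- exists N; split => //; rewrite vvariationE; apply/eqP; rewrite eq_le tvar_ge0 andbT.
  apply: ge_ereal_sup => _ [K [B [mB BO _ ->]]]; rewrite big1// => k _.
  rewrite (_ : cvec _ _ = 0) ?enorm0//; apply/rowP => i; rewrite !mxE /S/= /crestr0.
  rewrite ifT; last by rewrite inE; exact: mB.
  rewrite /crestr (_ : B k `&` N = set0) ?charge0//.
  by apply/seteqP; split=> x // [/BO[]].
- move=> i B mB BO; rewrite (eq_integral (Radon_Nikodym (nu i) mu)); last first.
    by move=> x _; rewrite -gE.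
  rewrite -(Radon_Nikodym_integral (numu i) mB).
  rewrite /S /nu /= /crestr0 !ifT ?inE// /crestr.
  have -> : B `&` (Omega `\` N) = B `\` N.
    by apply/seteqP; split=> x [Bx h]; split => //; [case: h|split => //; exact: BO].
  exact: chargeDI.
Qed.

Section finite_volume.
Variables (Omega : set X) (mO : measurable Omega) (muO : (mu Omega < +oo)%E).

Definition volume_charge : {charge set X -> \bar R} :=
  charge_of_finite_measure (mfrestr mO muO).

(** The area of v is the length of its graph counted by this vector measure
    (L^n, Dv) with n + 1 components, in the sense of area_tvar. *)
Definition graph_charge D : 'I_n.+1 -> {charge set X -> \bar R} :=
  fun i => if unlift ord0 i is Some j then D j else volume_charge.

Lemma graph_charge0 D : graph_charge D ord0 = volume_charge.
Proof. by rewrite /graph_charge unlift_none. Qed.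

Lemma graph_chargeS D j : graph_charge D (lift ord0 j) = D j.
Proof. by rewrite /graph_charge liftK. Qed.

Lemma volume_chargeE B : measurable B -> B `<=` Omega -> volume_charge B = mu B.
Proof.
by move=> mB BO; rewrite /volume_charge/= /charge_of_finite_measure /mfrestr /mrestr setIidl.
Qed.

(** The integrand sqrt(1 + |g|^2) of the area is the length of (1, g), which is the
    density of (L^n, Dv), and the singular part of (L^n, Dv) is (0, D^s v). *)
Lemma area_tvar v : area Omega v = tvar (graph_charge (BVD Omega v)) Omega.
Proof.
have [gi [N [mN N0 SN]] DE] : is_lebesgue_decomposition Omega (BVD Omega v)
    (lebesgue_decomposition Omega (BVD Omega v)).
  by rewrite /lebesgue_decomposition; apply: xgetPex; exact: lebesgue_decomposition_exists.
rewrite /area /BVgrad /BVDs.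
move: gi SN DE; case: lebesgue_decomposition => g S /= gi SN DE.
pose H (i : 'I_n.+1) (x : X) : R := if unlift ord0 i is Some j then g x ord0 j else 1.
pose S' (i : 'I_n.+1) : {charge set X -> \bar R} :=
  if unlift ord0 i is Some j then S j else czero.
have enormS (x : 'rV[R]_n.+1) :
    enorm x = Num.sqrt (x ord0 ord0 ^+ 2 + enorm (\row_j x ord0 (lift ord0 j)) ^+ 2).
  rewrite enorm_sqr /enorm big_ord_recl; congr (Num.sqrt (_ + _)).
  by apply: eq_bigr => j _; rewrite mxE.
have enormS' B : enorm (cvec S' B) = enorm (cvec S B).
  rewrite enormS !mxE /S' unlift_none/= expr0n/= add0r sqrtr_sqr ger0_norm ?enorm_ge0//.
  by congr enorm; apply/rowP => j; rewrite !mxE liftK.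
have tS A : tvar S' A = vvariation S A.
  congr ereal_sup; apply/seteqP; split=> s [K [B [mB BO tB ->]]]; exists K, B; split => //;
  by congr EFin; apply: eq_bigr => k _; rewrite enormS'.
rewrite (@tvar_decomposition _ _ _ mu Omega N (graph_charge (BVD Omega v)) S' H)//.
- congr (_ + _)%E; last by rewrite tS.
  apply: eq_integral => x _; congr EFin; rewrite enormS !mxE /H unlift_none expr1n.
  by congr (Num.sqrt (_ + enorm _ ^+ 2)); apply/rowP => j; rewrite !mxE liftK.
- by rewrite tS.
- move=> i; rewrite /H; case: unliftP => [j|] _ /=; first exact: gi.
  apply/integrableP; split; first exact/measurable_EFinP.
  by rewrite (eq_integral (cst 1%E)) ?integral_cst ?mul1e// => x _ /=; rewrite normr1.
- move=> i B mB BO; rewrite /H /S'; case: unliftP => [j|] ->.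
    by rewrite graph_chargeS; exact: DE.
  rewrite graph_charge0 volume_chargeE// /czero adde0.
  by rewrite integral_cst// mul1e.
Qed.

End finite_volume.

Lemma BVD_derivative (Omega : set X) (v : X -> R) : BV Omega v -> is_derivative_measure Omega v (BVD Omega v).
Proof. by move=> [_ exD]; exact: xgetPex. Qed.

(** The sequence of test functions does not depend on the charge, so that it transfers
    equalities between charges and measurability in a parameter. *)
Lemma bump_charge_integral_cvg (Omega : set X) F : measurable Omega -> bump Omega F ->
  exists2 psi : (X -> R)^nat, forall k, Cc1 Omega (psi k) &
    forall nu : {charge set X -> \bar R},
      charge_integral nu Omega (psi k) @[k --> \oo] --> fine (nu [set x | 0 < F x]).
Proof.
move=> mO bF; have [psi [Cpsi psi1 psicvg]] := bump_cvg_indic bF.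
have mF := measurable_bump_set bF; have FO := bump_set_sub bF.
exists psi => // nu.
have -> : fine (nu [set x | 0 < F x]) = charge_integral nu Omega \1_[set x | 0 < F x].
  by rewrite charge_integralE// setIidr.
apply: (@bounded_cvg_charge_integral _ _ _ _ _ _ 1) => //.
by move=> k; apply: measurable_funTS; exact: Cc1_measurable (Cpsi k).
Qed.

(** Test functions separate the finite vector measures on Omega, so that the
    derivative measure is determined on the Borel subsets of Omega. *)
Lemma derivative_measure_unique (Omega : set X) (v : X -> R) D D' : open Omega -> bounded_set Omega ->
  is_derivative_measure Omega v D -> is_derivative_measure Omega v D' ->
  forall i B, measurable B -> B `<=` Omega -> D i B = D' i B.
Proof.
move=> oO bO dD dD' i B mB BO; have mO := open_measurable_rV oO.
suff : fine (D i (B `&` Omega)) = fine (D' i (B `&` Omega)).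
  by rewrite setIidl// => h; rewrite -[LHS]fineK ?fin_num_measure// h fineK ?fin_num_measure.
apply: (@borel_bump_ind _ _ Omega (fun B => fine (D i B) = fine (D' i B))) => //.
- move=> F /(bump_charge_integral_cvg mO)[psi Cpsi lim].
  have l1 := lim (D i); rewrite (_ : (fun k => _) =
      fun k => charge_integral (D' i) Omega (psi k)) in l1; last first.
    by apply/funext => k; apply: oppr_inj; rewrite -dD// -dD'.
  exact: (cvg_unique _ l1 (lim (D' i))).
- move=> A A' mA mA' A'A AO hA hA'.
  have AA' : A `&` A' = A' by exact: setIidr.
  by rewrite !chargeD// AA' !fineB ?fin_num_measure// hA hA'.
- move=> A mA AO ndA hA.
  have lim (D0 : vcharge) : fine (D0 i (A k)) @[k --> \oo] --> fine (D0 i (\bigcup_k A k)).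
    exact: charge_nondecreasing_cvg.
  have l1 := lim D; rewrite (_ : (fun k => _) = fun k => fine (D' i (A k))) in l1; last first.
    by apply/funext => k; exact: hA.
  exact: (cvg_unique _ l1 (lim D')).
Qed.

End area_formula.

(** * Mollified families of vector measures *)

Section mollified_variation.
Context {R : realType} {n m : nat}.
Notation X := 'rV[R]_n.
Notation lam := (@lebesgue_measure R).

(** The initial layer has mass of order d. *)
Lemma integral_exp_decay (d T : R) : 0 < d -> 0 <= T ->
  (\int[lam]_(t in `[0%R, T]) (expR (- (t / d)))%:E <= d%:E)%E.
Proof.
move=> d0 T0; have dN0 : - d^-1 != 0 by rewrite oppr_eq0 invr_eq0 gt_eqF.
have E : (\int[lam]_(t in `[0%R, T]) (expR (- (t / d)))%:E =
    \int[lam]_(t in `[0%R, T]) ((- d)%:E * (- d^-1 * expR (- d^-1 * t + 0))%:E))%E.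
  apply: eq_integral => t _; rewrite -EFinM addr0 mulrA mulrNN divff ?gt_eqF// mul1r.
  by rewrite mulNr mulrC.
rewrite E integralZl//; last first.
  apply: (@integrable_continuous_itv _ (fun t => - d^-1 * expR (- d^-1 * t + 0))) => x.
  apply: (@cvgM _ _ _ _ (cst (- d^-1))); first exact: cvg_cst.
  exact: continuous_expR_affine.
rewrite integral_expR_affine// -EFinM lee_fin mulr0 add0r expR0.
by rewrite mulNr -mulrN opprB ler_piMr ?(ltW d0)// gerBl expR_ge0.
Qed.

Lemma continuous_exp_decay (d : R) : continuous (fun t : R => expR (- (t / d))).
Proof.
move=> t; have := @continuous_expR_affine R (- d^-1) 0 t.
have -> : (fun x => expR (- d^-1 * x + 0)) = (fun t : R => expR (- (t / d))).
  by apply/funext => x; rewrite addr0 mulNr mulrC.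
by [].
Qed.

Lemma measurable_exp_decay (d : R) : measurable_fun setT (fun t : R => expR (- (t / d))).
Proof. by apply: continuous_measurable_fun => t; exact: continuous_exp_decay. Qed.

(** The initial value K only matters in a layer of thickness d. *)
Lemma emol_initial_cvgL1 (f : R -> R) (K T : R) (d_ : nat -> R) : 0 <= T ->
  lam.-integrable `[0, T] (EFin \o f) ->
  (forall i, 0 < d_ i) -> d_ i @[i --> \oo] --> 0 ->
  (\int[lam]_(t in `[0%R, T])
    `|expR (- (t / d_ i)) * K + emol (d_ i) f t - f t|%:E)%E @[i --> \oo] --> 0%E.
Proof.
move=> T0 fi d0 dcvg; have mf : measurable_fun `[0, T] f.
  by move/integrableP: fi => [/measurable_EFinP].
have m1 i : measurable_fun `[0, T] (fun t => expR (- (t / d_ i)) * `|K|).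
  by apply: measurable_funM => //; exact: measurable_funTS (measurable_exp_decay _).
have m2 i : measurable_fun `[0, T] (fun t => emol (d_ i) f t - f t).
  by apply: measurable_funB => //; exact: measurable_emol.
apply: cvge0_le => [i|e e0]; first exact: integral_ge0.
have e20 : 0 < e / 2 by rewrite divr_gt0.
have eK : 0 < e / 2 / (`|K| + 1) by rewrite divr_gt0// ltr_wpDl.
have /cvgrPdist_le /(_ _ eK) dK := dcvg.
near=> i.
apply: (@le_trans _ _ (\int[lam]_(t in `[0%R, T])
   ((expR (- (t / d_ i)) * `|K|)%R%:E + `|emol (d_ i) f t - f t|%:E))%E).
  apply: ge0_le_integral => //.
  - apply/measurable_EFinP; apply: measurableT_comp => //; rewrite /=.
    apply: measurable_funB => //; apply: measurable_funD; last exact: measurable_emol.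
    by apply: measurable_funM => //; exact: measurable_funTS (measurable_exp_decay _).
  - apply: emeasurable_funD; apply/measurable_EFinP; first exact: m1.
    by apply: measurableT_comp => //; exact: m2.
  - move=> t _; rewrite -EFinD lee_fin -addrA (le_trans (ler_normD _ _))// lerD2r.
    by rewrite normrM ger0_norm ?expR_ge0.
rewrite ge0_integralD//=; last 2 first.
- by apply/measurable_EFinP; exact: m1.
- by apply/measurable_EFinP; apply: measurableT_comp => //; exact: m2.
rewrite [e]splitr EFinD; apply: leeD; last first.
  by near: i; exact: (cvge0_near (emol_cvgL1 fi d0 dcvg) e20).
under eq_integral do rewrite EFinM.
rewrite ge0_integralZr//; last first.
  by apply/measurable_EFinP; exact: measurable_funTS (measurable_exp_decay _).
apply: (@le_trans _ _ ((d_ i)%:E * `|K|%:E)%E).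
  by rewrite lee_wpmul2r ?lee_fin//; exact: integral_exp_decay.
rewrite -EFinM lee_fin.
have : `|0 - d_ i| <= e / 2 / (`|K| + 1) by near: i.
rewrite sub0r normrN ger0_norm ?(ltW (d0 i))// ler_pdivlMr ?ltr_wpDl// => /(le_trans _).
by apply; rewrite ler_wpM2l ?(ltW (d0 i))// lerDl.
Unshelve. all: by end_near. Qed.

Lemma enorm_emol_le (d t : R) (f : 'I_m -> R -> R) : 0 < d ->
  (forall i, lam.-integrable `[0, t] (EFin \o f i)) ->
  enorm (\row_i emol d (f i) t) <= emol d (fun s => enorm (\row_i f i s)) t.
Proof.
move=> d0 fi; rewrite emolE//; last exact: integrable_enorm.
have -> : \row_i emol d (f i) t = \row_i \int[lam]_(s in `[0, t]) (ekern d t s * f i s).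
  by apply/rowP => i; rewrite !mxE emolE.
apply: le_trans (enorm_Rintegral_le _ _) _ => //.
  by move=> i; exact: integrable_ekernM.
rewrite le_eqVlt; apply/orP; left; apply/eqP; apply: eq_Rintegral => s _.
have -> : \row_i (ekern d t s * f i s) = ekern d t s *: \row_i f i s.
  by apply/rowP => i; rewrite !mxE.
by rewrite enormZ ger0_norm// ekern_ge0.
Qed.

Lemma emol_sum (d t : R) I (s : seq I) (f : I -> R -> R) : 0 < d ->
  (forall i, lam.-integrable `[0, t] (EFin \o f i)) ->
  emol d (fun x => \sum_(i <- s) f i x) t = \sum_(i <- s) emol d (f i) t.
Proof.
move=> d0 fi; elim: s => [|i s ih].
  rewrite big_nil /emol; under eq_Rintegral do rewrite big_nil mulr0.
  by rewrite Rintegral_cst// mul0r mulr0.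
rewrite big_cons -ih -emolD//; first by apply: eq_emol => x _; rewrite big_cons.
rewrite (_ : _ \o _ = fun x => (\sum_(i <- s) (f i x)%:E)%E); last first.
  by apply/funext => x; rewrite /= sumEFin.
by apply: (@integrable_sum _ _ _ lam _ (measurable_itv _) _ s xpredT
  (fun i x => (f i x)%:E)) => j _; exact: fi.
Qed.

(** This makes the mollification of a family of charges sigma-additive. *)
Lemma emol_cvg_dominated (d t : R) (f_ : (R -> R)^nat) (f g : R -> R) : 0 < d ->
  (forall k, measurable_fun `[0, t] (f_ k)) ->
  lam.-integrable `[0, t] (EFin \o g) ->
  (forall k s, 0 <= s <= t -> `|f_ k s| <= g s) ->
  (forall s, 0 <= s <= t -> f_ ^~ s @ \oo --> f s) ->
  emol d (f_ k) t @[k --> \oo] --> emol d f t.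
Proof.
move=> d0 mf gi fg ff.
have It s : `[0, t]%classic s = (0 <= s <= t) by rewrite /= in_itv.
have mfl : measurable_fun `[0, t] f.
  by apply: measurable_fun_cvg mf _ => s; rewrite It; exact: ff.
have fik k : lam.-integrable `[0, t] (EFin \o f_ k).
  apply: (le_integrable _ _ _ gi) => //; first by apply/measurable_EFinP; exact: mf.
  by move=> s; rewrite It => st; rewrite lee_fin (le_trans (fg k s st))// ler_norm.
have fi : lam.-integrable `[0, t] (EFin \o f).
  apply: (le_integrable _ _ _ gi) => //; first exact/measurable_EFinP.
  move=> s; rewrite It => st; rewrite lee_fin (ger0_norm (_ : 0 <= g s)); last first.
    exact: le_trans (fg 0%N s st).
  have fx : `|f_ k s| @[k --> \oo] --> `|f s| by apply: cvg_norm; exact: ff.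
  rewrite -(cvg_lim _ fx)//; apply: limr_le; first by apply/cvg_ex; exists `|f s|.
  by near=> k; exact: fg.
under eq_fun do rewrite emolE//.
rewrite emolE//; apply: fine_cvg; rewrite fineK; last first.
  by apply: integrable_fin_num => //; exact: integrable_ekernM.
apply: (@dominated_cvg _ _ _ lam _ _ _ _ (EFin \o (fun s => ekern d t s * g s))) => //.
- move=> k; apply/measurable_EFinP; apply: measurable_funM; last exact: mf.
  exact: measurable_funTS (measurable_ekern _ _).
- move=> s; rewrite /= in_itv/= => st; apply: cvg_EFin; first exact: nearW.
  by apply: cvgM; [exact: cvg_cst|exact: ff].
- exact: integrable_ekernM.
- move=> k s; rewrite /= in_itv/= => st; rewrite lee_fin normrM (ger0_norm (ekern_ge0 _ _ d0)).
  by apply: ler_wpM2l; [exact: ekern_ge0|exact: fg].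
Unshelve. all: by end_near. Qed.

End mollified_variation.

Section measurable_family.
Context {R : realType} {n m : nat}.
Notation X := 'rV[R]_n.
Variables (Omega : set X) (T : R).
Hypothesis mO : measurable Omega.
Variable c : R -> 'I_m -> {charge set X -> \bar R}.
Hypothesis mc : forall i B, measurable B -> B `<=` Omega ->
  measurable_fun `[0, T] (fun s => fine (c s i B)).

Lemma measurable_atom_variation_family k : measurable_fun `[0, T] (fun s => atom_variation Omega k (c s)).
Proof.
apply: measurable_sum => e; apply: measurable_enorm => // i.
by apply: mc; [exact: measurable_atom|exact: subIsetl].
Qed.

(** The variation is the limit of its values along the partitions into atoms, each of
    which involves finitely many of the measurable functions s |-> c s i B. *)
Lemma measurable_tvar_family : measurable_fun `[0, T] (fun s => fine (tvar (c s) Omega)).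
Proof.
apply: (measurable_fun_cvg measurable_atom_variation_family) => s _.
exact: atom_variation_cvg.
Qed.

End measurable_family.

Section mollified_family.
Context {R : realType} {n m : nat}.
Notation X := 'rV[R]_n.
Notation lam := (@lebesgue_measure R).
Variables (Omega : set X) (T : R).
Hypothesis mO : measurable Omega.
Hypothesis T0 : 0 <= T.
Variables (c : R -> 'I_m -> {charge set X -> \bar R}) (c0 : 'I_m -> {charge set X -> \bar R}).
Hypothesis mc : forall i B, measurable B -> B `<=` Omega ->
  measurable_fun `[0, T] (fun s => fine (c s i B)).

Notation V k c := (atom_variation Omega k c).
Notation W c := (fine (tvar c Omega)).

Hypothesis ic : lam.-integrable `[0, T] (EFin \o (fun s => W (c s))).

Lemma ler_fine_tvar (c' : 'I_m -> {charge set X -> \bar R}) i B : measurable B -> B `<=` Omega ->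
  `|fine (c' i B)| <= W c'.
Proof.
move=> mB BO; rewrite -lee_fin fineK ?tvar_fin_num//; exact: le_coord_tvar.
Qed.

Lemma fine_tvar_ge0 (c' : 'I_m -> {charge set X -> \bar R}) : 0 <= W c'.
Proof. by rewrite fine_ge0// tvar_ge0. Qed.

Lemma integrable_family i B : measurable B -> B `<=` Omega ->
  lam.-integrable `[0, T] (EFin \o (fun s => fine (c s i B))).
Proof.
move=> mB BO; apply: (le_integrable _ _ _ ic) => //.
  by apply/measurable_EFinP; exact: mc.
by move=> s _; rewrite lee_fin (ger0_norm (fine_tvar_ge0 _)); exact: ler_fine_tvar.
Qed.

Lemma integrable_atom_variation_family k : lam.-integrable `[0, T] (EFin \o (fun s => V k (c s))).
Proof.
apply: (le_integrable _ _ _ ic) => //.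
  by apply/measurable_EFinP; exact: (measurable_atom_variation_family mO mc).
move=> s _; rewrite lee_fin (ger0_norm (fine_tvar_ge0 _)) ger0_norm ?atom_variation_ge0//.
exact: atom_variation_le.
Qed.

Section fixed_delta.
Variables (d : R) (cd : R -> 'I_m -> {charge set X -> \bar R}).
Hypothesis d0 : 0 < d.
Hypothesis cdE : forall t, 0 <= t <= T -> forall i B, measurable B -> B `<=` Omega ->
  fine (cd t i B) = expR (- (t / d)) * fine (c0 i B) + emol d (fun s => fine (c s i B)) t.

Lemma measurable_mollified_family i B : measurable B -> B `<=` Omega ->
  measurable_fun `[0, T] (fun t => fine (cd t i B)).
Proof.
move=> mB BO; apply: (eq_measurable_fun (fun t : R => expR (- (t / d)) * fine (c0 i B) +
    emol d (fun s => fine (c s i B)) t)).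
  by move=> t; rewrite inE/= in_itv/= => tT; rewrite cdE.
apply: measurable_funD; last by apply: measurable_emol; exact: mc.
by apply: measurable_funM => //; exact: measurable_funTS (measurable_exp_decay _).
Qed.

(** Jensen's inequality for the variation, which is convex and positively
    homogeneous. *)
Lemma tvar_mollified_le t : 0 <= t <= T ->
  W (cd t) <= expR (- (t / d)) * W c0 + emol d (fun s => W (c s)) t.
Proof.
move=> /[dup] t0T /andP[t0 tT].
have ict := integrable_itvS tT ic.
have iat i k (e : {ffun 'I_k -> bool}) : lam.-integrable `[0, t]
    (EFin \o (fun s => fine (c s i (Omega `&` [set x | ball_code k x = e])))).
  apply: integrable_itvS tT _; apply: integrable_family; last exact: subIsetl.
  exact: measurable_atom.
have Wcvg := atom_variation_cvg (c := cd t) mO.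
rewrite -(cvg_lim _ Wcvg)//; apply: limr_le; first by apply/cvg_ex; exists (W (cd t)).
apply: nearW => k.
apply: (@le_trans _ _ (expR (- (t / d)) * V k c0 + emol d (fun s => V k (c s)) t)); last first.
  apply: lerD; first by rewrite ler_wpM2l ?expR_ge0// atom_variation_le.
  apply: le_emol => //; first by apply: integrable_itvS tT _; exact: integrable_atom_variation_family.
  by move=> s _; exact: atom_variation_le.
rewrite /atom_variation emol_sum//; last first.
  by move=> e; apply: integrable_enorm => // i; exact: iat.
rewrite mulr_sumr -big_split/=; apply: ler_sum => e _.
set A := Omega `&` _.
have mA : measurable A by exact: measurable_atom.
have AO : A `<=` Omega by exact: subIsetl.
have -> : cvec (cd t) A = expR (- (t / d)) *: cvec c0 A +
    \row_i emol d (fun s => fine (c s i A)) t.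
  by apply/rowP => i; rewrite !mxE cdE.
rewrite (le_trans (enormD_le _ _))// enormZ ger0_norm ?expR_ge0// lerD2l.
by apply: enorm_emol_le => // i; exact: iat.
Qed.

End fixed_delta.

(** The Jensen bound gives the upper estimate; the lower one follows by comparing
    the variations over a fixed finite partition, for which the convergence is
    that of finitely many scalar mollifications. *)
Lemma tvar_mollified_cvg (d_ : nat -> R) (cd : nat -> R -> 'I_m -> {charge set X -> \bar R}) :
  (forall j, 0 < d_ j) -> d_ j @[j --> \oo] --> 0 ->
  (forall j t, 0 <= t <= T -> forall i B, measurable B -> B `<=` Omega ->
    fine (cd j t i B) =
    expR (- (t / d_ j)) * fine (c0 i B) + emol (d_ j) (fun s => fine (c s i B)) t) ->
  (\int[lam]_(t in `[0%R, T]) `|W (c t) - W (cd j t)|%:E)%E @[j --> \oo] --> 0%E.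
Proof.
move=> d0 dcvg cdE.
have mcd j := measurable_mollified_family (cdE j).
have mW := measurable_tvar_family mO mc.
have mWd j := measurable_tvar_family mO (mcd j).
have mV k := measurable_atom_variation_family mO mc k.
have mVd j k := measurable_atom_variation_family mO (mcd j) k.
have Vcvg k : (\int[lam]_(t in `[0%R, T]) `|V k (c t) - V k (cd j t)|%:E)%E @[j --> \oo] --> 0%E.
  pose at_ e := Omega `&` [set x | ball_code k x = e].
  have mat e : measurable (at_ e) by exact: measurable_atom.
  have atO e : at_ e `<=` Omega by exact: subIsetl.
  pose r (p : {ffun 'I_k -> bool} * 'I_m) j t : R :=
    expR (- (t / d_ j)) * fine (c0 p.2 (at_ p.1)) +
    emol (d_ j) (fun s => fine (c s p.2 (at_ p.1))) t - fine (c t p.2 (at_ p.1)).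
  have mr p j : measurable_fun `[0, T] (fun t => `|r p j t|%:E).
    apply/measurable_EFinP; apply: measurableT_comp => //.
    apply: measurable_funB; last exact: mc.
    apply: measurable_funD; last by apply: measurable_emol; exact: mc.
    by apply: measurable_funM => //; exact: measurable_funTS (measurable_exp_decay _).
  apply: (@squeeze_cvge _ _ _ _ (cst 0%E) _
      (fun j => \sum_p \int[lam]_(t in `[0%R, T]) `|r p j t|%:E)%E).
  - apply: nearW => j; rewrite /= integral_ge0//=.
    rewrite -ge0_integral_sum//; last by move=> p; exact: mr.
    apply: ge0_le_integral => //.
    + apply/measurable_EFinP; apply: measurableT_comp => //.
      exact: (measurable_funB (mV k) (mVd j k)).
    + by apply: emeasurable_sum => p; exact: mr.
    + move=> t /=; rewrite in_itv/= => tT; rewrite sumEFin lee_fin.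
      rewrite -sumrB; apply: (le_trans (ler_norm_sum _ _ _)).
      rewrite [leRHS](_ : _ = \sum_e \sum_i `|r (e, i) j t|); last first.
        by rewrite pair_big/=; apply: eq_bigr => -[].
      apply: ler_sum => e _; apply: (le_trans (ler_dist_enorm _ _)).
      rewrite -enormN opprB; apply: (le_trans (enorm_le_sum _)); apply: ler_sum => i _.
      by rewrite !mxE (cdE j t tT i _ (mat e) (atO e)); exact: lexx.
  - exact: cvg_cst.
  - rewrite [X in _ --> X](_ : _ = \sum_(p : {ffun 'I_k -> bool} * 'I_m) 0)%E; last first.
      by rewrite big1.
    apply: cvg_nnesum => [p _|p _]; first by apply: nearW => j; exact: integral_ge0.
    by apply: emol_initial_cvgL1 => //; exact: integrable_family.
have VW : (\int[lam]_(t in `[0%R, T]) `|W (c t) - V k (c t)|%:E)%E @[k --> \oo] --> 0%E.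
  rewrite -(@integral0 _ _ _ lam `[0, T]).
  apply: (@dominated_cvg _ _ _ lam _ _ _ _ (EFin \o (fun s => W (c s)))) => //.
  - move=> k; apply/measurable_EFinP; apply: measurableT_comp => //.
    exact: (measurable_funB mW (mV k)).
  - move=> t _; apply: cvg_EFin; first exact: nearW.
    rewrite -[X in _ --> X](@normr0 _ R); apply: cvg_norm.
    rewrite -[X in _ --> X](subrr (W (c t))); apply: cvgB; first exact: cvg_cst.
    exact: atom_variation_cvg.
  - move=> k t _; rewrite lee_fin normr_id ger0_norm ?subr_ge0 ?atom_variation_le//.
    by rewrite gerBl atom_variation_ge0.
(* With J the Jensen bound, W (cd t) <= J and J is close to W (c t); conversely
   W (cd t) >= V (cd t), which is close to V (c t) and hence to W (c t). *)
have Wcvg := emol_initial_cvgL1 (W c0) T0 ic d0 dcvg.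
apply: cvge0_le => [j|e e0]; first exact: integral_ge0.
have e30 : 0 < e / 3 by rewrite divr_gt0.
have [k _ /(_ k (leqnn k)) VWk] := cvge0_near VW e30.
near=> j.
have mJ : measurable_fun `[0, T] (fun t =>
    expR (- (t / d_ j)) * W c0 + emol (d_ j) (fun s => W (c s)) t - W (c t)).
  apply: measurable_funB => //; apply: measurable_funD; last exact: measurable_emol.
  by apply: measurable_funM => //; exact: measurable_funTS (measurable_exp_decay _).
have mN (h : R -> R) : measurable_fun `[0, T] h -> measurable_fun `[0, T] (fun t => `|h t|%:E).
  by move=> mh; apply/measurable_EFinP; exact: measurableT_comp.
apply: (@le_trans _ _ (\int[lam]_(t in `[0%R, T])
   (`|expR (- (t / d_ j)) * W c0 + emol (d_ j) (fun s => W (c s)) t - W (c t)|%:E +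
    `|W (c t) - V k (c t)|%:E + `|V k (c t) - V k (cd j t)|%:E))%E).
  apply: ge0_le_integral => //.
  - by apply: mN; exact: measurable_funB.
  - apply: emeasurable_funD; last by apply: mN; exact: measurable_funB.
    by apply: emeasurable_funD; apply: mN => //; exact: measurable_funB.
  - move=> t /=; rewrite in_itv/= => tT; rewrite -!EFinD lee_fin.
    have h1 := tvar_mollified_le (d0 j) (cdE j) tT.
    have h2 : V k (cd j t) <= W (cd j t) by exact: atom_variation_le.
    set J := expR _ * _ + emol _ _ _ in h1 *.
    have h3 := ler_norm (J - W (c t)).
    have h4 := normr_ge0 (W (c t) - V k (c t)).
    have h5 := normr_ge0 (V k (c t) - V k (cd j t)).
    have h6 := ler_norm (W (c t) - V k (c t)).
    have h7 := ler_norm (V k (c t) - V k (cd j t)).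
    have h8 := normr_ge0 (J - W (c t)).
    by rewrite ler_norml; apply/andP; split; lra.
have mm1 := mN _ mJ; have mm2 := mN _ (measurable_funB mW (mV k)).
have mm3 := mN _ (measurable_funB (mV k) (mVd j k)).
rewrite ge0_integralD//=; [|by move=> t _; rewrite adde_ge0|exact: emeasurable_funD].
rewrite ge0_integralD//=.
have -> : (e%:E = (e / 3)%:E + (e / 3)%:E + (e / 3)%:E)%E.
  by rewrite -!EFinD; congr EFin; field.
apply: leeD; first apply: leeD => //.
  by near: j; exact: (cvge0_near Wcvg e30).
by near: j; exact: (cvge0_near (Vcvg k) e30).
Unshelve. all: by end_near. Qed.

End mollified_family.

(** * Charges and charge integrals of mollified families *)

Section charge_construction.
Context {R : realType} {n : nat}.
Notation X := 'rV[R]_n.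

(** Continuity along increasing sequences turns finite additivity into
    sigma-additivity. *)
Lemma charge_of_additive (f : set X -> R) :
  (forall A B, measurable A -> measurable B -> A `&` B = set0 ->
    f (A `|` B) = f A + f B) ->
  (forall A : (set X)^nat, (forall k, measurable (A k)) -> nondecreasing_seq A ->
    f (A k) @[k --> \oo] --> f (\bigcup_k A k)) ->
  exists nu : {charge set X -> \bar R}, forall B, fine (nu B) = f B.
Proof.
move=> fU fnd; pose mu0 (B : set X) : \bar R := (f B)%:E.
have f0 : f set0 = 0.
  by have := fU _ _ measurable0 measurable0 (setI0 _); rewrite setU0; lra.
have h0 : mu0 set0 = 0%E by rewrite /mu0 f0.
have hfin B : measurable B -> mu0 B \is a fin_num by [].
have hsig : semi_sigma_additive mu0.
  move=> F mF tF mUF.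
  have mU N : measurable (\big[setU/set0]_(i < N) F i) by exact: bigsetU_measurable.
  have sumE N : (\sum_(0 <= i < N) mu0 (F i) = (f (\big[setU/set0]_(i < N) F i))%:E)%E.
    rewrite big_mkord; elim: N => [|N ih]; first by rewrite !big_ord0 f0.
    rewrite !big_ord_recr/= ih fU//; first exact: mU.
    rewrite -subset0 => x [] /=; rewrite -bigcup_mkord => -[j /= jN Fjx] FNx.
    move/trivIsetP : tF => /(_ j N I I); rewrite neq_ltn jN => /(_ isT) /seteqP[+ _].
    by move=> /(_ x); apply.
  under eq_fun do rewrite sumE.
  apply: cvg_EFin; first exact: nearW.
  have -> : \bigcup_i F i = \bigcup_N \big[setU/set0]_(i < N) F i.
    apply/seteqP; split=> [x [i _ Fix]|x [N _]].
      by exists i.+1 => //; rewrite big_ord_recr/=; right.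
    by rewrite -bigcup_mkord => -[i _ Fix]; exists i.
  apply: fnd => // N N' NN'; apply/subsetPset; exact: subset_bigsetU.
have @nu : {charge set X -> \bar R} := HB.pack mu0 (isCharge.Build _ _ _ mu0 h0 hfin hsig).
by exists nu.
Qed.

Lemma ler_charge_integral (nu : {charge set X -> \bar R}) A (f : X -> R) (M : R) :
  measurable A -> measurable_fun A f -> (forall x, A x -> `|f x| <= M) ->
  `|charge_integral nu A f| <=
  M * (fine (jordan_pos (hahnP nu) A) + fine (jordan_neg (hahnP nu) A)).
Proof.
move=> mA mf fM; rewrite /charge_integral (le_trans (ler_normB _ _))// mulrDr.
have H (mu0 : {finite_measure set X -> \bar R}) :
    `|\int[mu0]_(x in A) f x| <= M * fine (mu0 A).
  have fi := @bounded_integrable _ _ mu0 _ _ _ mA mf fM.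
  rewrite (le_trans (le_normr_Rintegral mA fi))// -Rintegral_cst//.
  apply: le_Rintegral => //; first exact: integrable_norm.
  exact: finite_measure_integrable_cst.
by apply: lerD; exact: H.
Qed.

(** The masses of the positive and negative parts of a component are its values on the
    two sets of a Hahn decomposition. *)
Lemma jordan_le_tvar m (c : 'I_m -> {charge set X -> \bar R}) i A : measurable A ->
  fine (jordan_pos (hahnP (c i)) A) + fine (jordan_neg (hahnP (c i)) A) <=
  2 * fine (tvar c A).
Proof.
move=> mA; have hd := hahnP (c i); have [[mP _] [mN _] _ _] := hd.
rewrite mulr2n mulrDl mul1r jordan_posE cjordan_posE jordan_negE cjordan_negE /crestr0.
rewrite mem_set// /crestr.
apply: lerD.
  rewrite -lee_fin (fineK (tvar_fin_num _ mA)).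
  apply: le_trans (le_coord_tvar c i (measurableI _ _ mA mP) (@subIsetl _ _ _)).
  by rewrite lee_fin ler_norm.
rewrite fineN -lee_fin (fineK (tvar_fin_num _ mA)).
apply: le_trans (le_coord_tvar c i (measurableI _ _ mA mN) (@subIsetl _ _ _)).
by rewrite lee_fin -normrN ler_norm.
Qed.

End charge_construction.

Section mollified_charge_integral.
Context {R : realType} {n m : nat}.
Notation X := 'rV[R]_n.
Notation lam := (@lebesgue_measure R).
Variables (Omega : set X) (T : R).
Hypothesis mO : measurable Omega.
Variables (c : R -> 'I_m -> {charge set X -> \bar R}) (c0 : 'I_m -> {charge set X -> \bar R}).
Hypothesis mc : forall i B, measurable B -> B `<=` Omega ->
  measurable_fun `[0, T] (fun s => fine (c s i B)).
Hypothesis ic : lam.-integrable `[0, T] (EFin \o (fun s => fine (tvar (c s) Omega))).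

Lemma charge_integral_le_tvar (c' : 'I_m -> {charge set X -> \bar R}) i (f : X -> R) (M : R) :
  measurable_fun Omega f -> (forall x, Omega x -> `|f x| <= M) -> 0 <= M ->
  `|charge_integral (c' i) Omega f| <= 2 * M * fine (tvar c' Omega).
Proof.
move=> mf fM M0; rewrite (le_trans (ler_charge_integral _ mO mf fM))//.
by rewrite [2 * M]mulrC -mulrA ler_wpM2l// jordan_le_tvar.
Qed.

(** The induction on bounded measurable functions starts from the indicators, for
    which the integrals are values of the charges. *)
Lemma measurable_charge_integral_family i (f : X -> R) (M : R) :
  measurable_fun Omega f -> (forall x, Omega x -> `|f x| <= M) ->
  measurable_fun `[0, T] (fun s => charge_integral (c s i) Omega f).
Proof.
move=> mf fM.
have mfA : measurable_fun setT (f \_ Omega) by exact: ((measurable_restrictT _ mO).1 mf).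
have -> : (fun s => charge_integral (c s i) Omega f) =
    (fun s => charge_integral (c s i) Omega (f \_ Omega)).
  by apply/funext => s; apply: eq_charge_integral => x Ox; rewrite patchE mem_set.
apply: (@bounded_measurable_ind _ _ _ (fun g => measurable_fun `[0, T]
  (fun s => charge_integral (c s i) Omega g)) _ _ _ (f \_ Omega) `|M|) => //.
- move=> B mB; rewrite (_ : (fun s => _) = fun s => fine (c s i (Omega `&` B))); last first.
    by apply/funext => s; rewrite charge_integralE.
  by apply: mc; [exact: measurableI|exact: subIsetl].
- move=> k g h M' N' mg gM mh hN gE hE.
  rewrite (_ : (fun s => _) = fun s => k * charge_integral (c s i) Omega g +
      charge_integral (c s i) Omega h); last first.
    apply/funext => s; rewrite (@charge_integral_linear _ _ _ _ _ _ k M' N')//;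
    exact: measurable_funTS.
  by apply: measurable_funD => //; exact: measurable_funM.
- move=> g_ g M' mg gM gcvg gE; apply: (measurable_fun_cvg gE) => s _.
  by apply: (@bounded_cvg_charge_integral _ _ _ _ _ _ M') => // k; exact: measurable_funTS.
- move=> x; rewrite patchE; case: ifPn; rewrite ?normr0// inE => Ax.
  by rewrite (le_trans (fM x Ax))// ler_norm.
Qed.

Lemma integrable_charge_integral_family i (f : X -> R) (M : R) :
  measurable_fun Omega f -> (forall x, Omega x -> `|f x| <= M) -> 0 <= M ->
  lam.-integrable `[0, T] (EFin \o (fun s => charge_integral (c s i) Omega f)).
Proof.
move=> mf fM M0; apply: (le_integrable _ _ _ (integrableZl _ (2 * M) ic)) => //.
  by apply/measurable_EFinP; exact: measurable_charge_integral_family fM.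
move=> s _ /=; rewrite lee_fin [leRHS]ger0_norm; first exact: charge_integral_le_tvar.
by rewrite mulr_ge0 ?mulr_ge0// fine_ge0// tvar_ge0.
Qed.

(** The identity assumed for indicators extends to bounded measurable functions, by
    linearity and dominated convergence both in space and in time. It exchanges the
    integral in space with the mollification in time, without any joint kernel
    structure on the family of charges. *)
Lemma charge_integral_mollified (d t : R) (c' : 'I_m -> {charge set X -> \bar R}) i
    (f : X -> R) (M : R) : 0 < d -> 0 <= t <= T ->
  (forall B, measurable B -> B `<=` Omega ->
    fine (c' i B) = expR (- (t / d)) * fine (c0 i B) + emol d (fun s => fine (c s i B)) t) ->
  measurable_fun Omega f -> (forall x, Omega x -> `|f x| <= M) ->
  charge_integral (c' i) Omega f = expR (- (t / d)) * charge_integral (c0 i) Omega f +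
    emol d (fun s => charge_integral (c s i) Omega f) t.
Proof.
move=> d0 /andP[t0 tT] c'E mf fM.
have mfA : measurable_fun setT (f \_ Omega) by exact: ((measurable_restrictT _ mO).1 mf).
have fE nu : charge_integral nu Omega f = charge_integral nu Omega (f \_ Omega).
  by apply: eq_charge_integral => x Ox; rewrite patchE mem_set.
rewrite !fE (_ : (fun s => _) = fun s => charge_integral (c s i) Omega (f \_ Omega)); last first.
  by apply/funext => s; rewrite fE.
apply: (@bounded_measurable_ind _ _ _ (fun g => charge_integral (c' i) Omega g =
  expR (- (t / d)) * charge_integral (c0 i) Omega g +
    emol d (fun s => charge_integral (c s i) Omega g) t) _ _ _ (f \_ Omega) `|M|) => //.
- move=> B mB; rewrite !charge_integralE// c'E; [|exact: measurableI|exact: subIsetl].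
  by congr (_ + _); apply: eq_emol => s _; rewrite charge_integralE.
- move=> k g h M' N' mg gM mh hN gE hE.
  have mgO : measurable_fun Omega g by exact: measurable_funTS.
  have mhO : measurable_fun Omega h by exact: measurable_funTS.
  have gM' x : Omega x -> `|g x| <= `|M'| by rewrite (le_trans (gM x))// ler_norm.
  have hN' x : Omega x -> `|h x| <= `|N'| by rewrite (le_trans (hN x))// ler_norm.
  have gi := integrable_itvS tT (integrable_charge_integral_family i mgO gM' (normr_ge0 _)).
  have hi := integrable_itvS tT (integrable_charge_integral_family i mhO hN' (normr_ge0 _)).
  have lin nu := @charge_integral_linear _ _ nu Omega g h k M' N' mO mgO (fun x _ => gM x) mhO (fun x _ => hN x).
  rewrite !lin [emol d _ t](_ : _ = emol d (fun s => k * charge_integral (c s i) Omega g +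
    charge_integral (c s i) Omega h) t); last by apply: eq_emol => s _; rewrite lin.
  have kgi : lam.-integrable `[0, t] (EFin \o (fun s => k * charge_integral (c s i) Omega g)).
    exact: (integrableZl _ k gi).
  by rewrite gE hE (emolD d0 kgi hi) (emolZ k d0 gi); ring.
- move=> g_ g M' mg gM gcvg gE.
  have mgO k : measurable_fun Omega (g_ k) by exact: measurable_funTS.
  have M'0 : 0 <= `|M'| by [].
  have gM' k x : Omega x -> `|g_ k x| <= `|M'| by rewrite (le_trans (gM k x))// ler_norm.
  have C (nu0 : {charge set X -> \bar R}) :
      charge_integral nu0 Omega (g_ k) @[k --> \oo] --> charge_integral nu0 Omega g.
    exact: (@bounded_cvg_charge_integral _ _ _ _ _ _ M').
  apply: (cvg_unique _ (C (c' i))) => //.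
  rewrite (_ : (fun k => _) = (fun k => expR (- (t / d)) * charge_integral (c0 i) Omega (g_ k) +
    emol d (fun s => charge_integral (c s i) Omega (g_ k)) t)); last by apply/funext.
  apply: cvgD; first by apply: cvgM; [exact: cvg_cst|exact: C].
  apply: (emol_cvg_dominated (g := fun s => 2 * `|M'| * fine (tvar (c s) Omega))) => //.
  + move=> k; have := integrable_itvS tT (integrable_charge_integral_family i (mgO k) (gM' k) M'0).
    by move=> /integrableP[/measurable_EFinP].
  + by apply: integrable_itvS tT _; exact: (integrableZl _ (2 * `|M'|) ic).
  + by move=> k s _; exact: charge_integral_le_tvar (gM' k) _.
- move=> x; rewrite patchE; case: ifPn; rewrite ?normr0// inE => Ax.
  by rewrite (le_trans (fM x Ax))// ler_norm.
Qed.

End mollified_charge_integral.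

(** * Mollification in time of a function of space and time *)

Section space_time_mollification.
Context {dX : measure_display} {X : measurableType dX} {R : realType}.
Notation lam := (@lebesgue_measure R).
Variable mu : {sigma_finite_measure set X -> \bar R}.
Implicit Types (f : X * R -> R).

Lemma Rintegral_fubini f : (mu \x lam)%E.-integrable setT (EFin \o f) ->
  \int[mu]_x \int[lam]_s f (x, s) = \int[lam]_s \int[mu]_x f (x, s).
Proof.
move=> fi; have mf : measurable_fun setT (EFin \o f) := measurable_int _ fi.
have -> : \int[mu]_x \int[lam]_s f (x, s) = fine (\int[mu]_x \int[lam]_s (f (x, s))%:E)%E.
  congr fine; apply: ae_eq_integral => //.
  - apply/measurable_EFinP; apply: (measurableT_comp (fine_measurable measurableT)).
    exact: (measurable_fubini_F fi).
  - exact: (measurable_fubini_F fi).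
  - have := ae_integrable1 fi; apply: filterS => x fx _ /=.
    by rewrite fineK//; exact: integrable_fin_num.
have -> : \int[lam]_s \int[mu]_x f (x, s) = fine (\int[lam]_s \int[mu]_x (f (x, s))%:E)%E.
  congr fine; apply: ae_eq_integral => //.
  - apply/measurable_EFinP; apply: (measurableT_comp (fine_measurable measurableT)).
    exact: (measurable_fubini_G fi).
  - exact: (measurable_fubini_G fi).
  - have := ae_integrable2 fi; apply: filterS => s fs _ /=.
    by rewrite fineK//; exact: integrable_fin_num.
by rewrite (Fubini fi).
Qed.

Variable U : X * R -> R.
Hypothesis mU : measurable_fun setT U.
Hypothesis iU : (mu \x lam)%E.-integrable setT (EFin \o U).

Let mEU : measurable_fun setT (EFin \o U). Proof. exact/measurable_EFinP. Qed.

Lemma ae_integrable_slice : {ae mu, forall x, lam.-integrable setT (fun s => (U (x, s))%:E)}.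
Proof. exact: ae_integrable1 iU. Qed.

Let trunc (d t : R) (z : X * R) : R := \1_(`[0, t]%classic) z.2 * (expR ((z.2 - t) / d) * U z).

Let mtrunc d t : measurable_fun setT (trunc d t).
Proof.
apply: measurable_funM; first exact: measurableT_comp.
apply: measurable_funM => //; apply: measurableT_comp => //.
by apply: measurable_funM => //; apply: measurable_funB => //; exact: measurable_snd.
Qed.

Let trunc_le d t z : 0 < d -> `|trunc d t z| <= `|U z|.
Proof.
move=> d0; rewrite /trunc indicE; case: (boolP (z.2 \in _)) => [|_]; last by rewrite mul0r normr0.
rewrite inE/= in_itv/= => /andP[_ zt]; rewrite mul1r normrM ler_piMl// ger0_norm ?expR_ge0//.
by rewrite -expR0 ler_expR pmulr_lle0 ?invr_gt0// subr_le0.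
Qed.

Let emol_trunc d t x : emol d (fun s => U (x, s)) t = d^-1 * \int[lam]_s trunc d t (x, s).
Proof.
congr *%R; rewrite Rintegral_mkcond; apply: eq_Rintegral => s _.
by rewrite /trunc patchE indicE/=; case: ifPn => _; rewrite ?mul1r ?mul0r.
Qed.

Let itrunc d t (psi : X -> R) (M : R) : 0 < d -> measurable_fun setT psi ->
  (forall x, `|psi x| <= M) ->
  (mu \x lam)%E.-integrable setT (EFin \o (fun z => trunc d t z * psi z.1)).
Proof.
move=> d0 mpsi psiM; apply: (le_integrable _ _ _ (integrableZl _ M iU)) => //.
  apply/measurable_EFinP; apply: measurable_funM; first exact: mtrunc.
  exact: (measurableT_comp mpsi measurable_fst).
move=> [x s] _ /=; rewrite lee_fin (normrM (trunc d t _)) (normrM M) mulrC.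
apply: ler_pM => //; first by rewrite (le_trans (psiM x))// ler_norm.
exact: trunc_le.
Qed.

(** Fubini's theorem for the integrand cut off at 0 <= s <= t. The slices of U are
    integrable for almost every parameter only, which is why the linearity of the
    integral is used under an almost-everywhere equality. *)
Lemma emol_fubini d t (psi : X -> R) (M : R) : 0 < d -> measurable_fun setT psi ->
  (forall x, `|psi x| <= M) ->
  \int[mu]_x (emol d (fun s => U (x, s)) t * psi x) =
  emol d (fun s => \int[mu]_x (U (x, s) * psi x)) t.
Proof.
move=> d0 mpsi psiM.
have fi := itrunc t d0 mpsi psiM.
have mE : measurable_fun setT (fun x => emol d (fun s => U (x, s)) t).
  exact: (measurableT_comp (measurable_emol2 d mU) (pair2_measurable t)).
transitivity (\int[mu]_x (d^-1 * \int[lam]_s (trunc d t (x, s) * psi x))).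
  congr fine; apply: ae_eq_integral => //.
  - by apply/measurable_EFinP; apply: measurable_funM.
  - apply/measurable_EFinP; apply: measurable_funM => //.
    apply: (measurableT_comp (fine_measurable measurableT)).
    exact: (measurable_fubini_F fi).
  - have := ae_integrable_slice; apply: filterS => x Ux _ /=.
    congr EFin; rewrite emol_trunc RintegralZr//; first by rewrite mulrA.
    apply: (le_integrable _ _ _ Ux) => //.
      apply/measurable_EFinP.
      exact: (measurableT_comp (mtrunc d t) (pair1_measurable x)).
    by move=> s _; rewrite lee_fin; exact: trunc_le.
rewrite RintegralZl//; last first.
  rewrite (_ : _ \o _ = fun x => (fine (\int[lam]_s (trunc d t (x, s) * psi x)%:E)%E)%:E)//.
  apply/integrableP; split.
    apply/measurable_EFinP; apply: (measurableT_comp (fine_measurable measurableT)).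
    exact: (measurable_fubini_F fi).
  have /integrableP[_] := integrable_fubini_F fi; apply: le_lt_trans.
  apply: ge0_le_integral => //.
  - apply: measurableT_comp => //; apply/measurable_EFinP.
    apply: (measurableT_comp (fine_measurable measurableT)).
    exact: (measurable_fubini_F fi).
  - by apply: measurableT_comp => //; exact: (measurable_fubini_F fi).
  - by move=> x _ /=; rewrite /fubini_F; case: (\int[lam]_s _)%E => [r||]//=; rewrite normr0 leey.
congr *%R; rewrite (@Rintegral_fubini (fun z => trunc d t z * psi z.1))//.
have iV : (mu \x lam)%E.-integrable setT (EFin \o (fun z => U z * psi z.1)).
  apply: (le_integrable _ _ _ (integrableZl _ M iU)) => //.
    apply/measurable_EFinP; apply: measurable_funM; first exact: mU.
    exact: (measurableT_comp mpsi measurable_fst).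
  move=> [x s] _ /=; rewrite lee_fin !normrM mulrC; apply: ler_pM => //.
  by rewrite (le_trans (psiM x))// ler_norm.
rewrite [RHS]Rintegral_mkcond; congr fine; apply: ae_eq_integral => //.
- apply/measurable_EFinP; apply: (measurableT_comp (fine_measurable measurableT)).
  exact: (measurable_fubini_G fi).
- apply/measurable_EFinP.
  apply: (measurable_restrictT _ (measurable_itv `[0, t])).1.
  apply: measurable_funTS; apply: measurable_funM.
    apply: measurableT_comp => //.
    by apply: measurable_funM => //; exact: measurable_funB.
  apply: (measurableT_comp (fine_measurable measurableT)).
  exact: (measurable_fubini_G iV).
- have := ae_integrable2 iV; apply: filterS => s Us _ /=; congr EFin.
  rewrite patchE /trunc /= indicE/=; case: ifPn => _; last first.
    under eq_Rintegral do rewrite !mul0r.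
    by rewrite Rintegral_cst// mul0r.
  rewrite -RintegralZl//; apply: eq_Rintegral => x _.
  by rewrite mul1r mulrA.
Qed.

(** This holds for every t, and not just for almost every t, because the kernel is
    bounded at fixed d. *)
Lemma integrable_emol_slice d t : 0 < d ->
  mu.-integrable setT (fun x => (emol d (fun s => U (x, s)) t)%:E).
Proof.
move=> d0.
have fi : (mu \x lam)%E.-integrable setT (EFin \o trunc d t).
  apply: (le_integrable _ _ _ iU) => //; first by apply/measurable_EFinP; exact: mtrunc.
  by move=> z _; rewrite lee_fin trunc_le.
have mF : measurable_fun setT (fun x => (fine (\int[lam]_s (trunc d t (x, s))%:E)%E)).
  apply: (measurableT_comp (fine_measurable measurableT)).
  exact: (measurable_fubini_F fi).
rewrite (_ : (fun x => _) = fun x => d^-1%:E * (fine (\int[lam]_s (trunc d t (x, s))%:E)%E)%:E)%E; last first.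
  by apply/funext => x; rewrite emol_trunc.
apply: integrableZl => //; apply: (le_integrable _ _ _ (integrable_fubini_F fi)) => //.
  exact/measurable_EFinP.
by move=> x _ /=; rewrite /fubini_F; case: (\int[lam]_s _)%E => [r||]//=; rewrite normr0 leey.
Qed.

Variable T : R.
Hypothesis T0 : 0 <= T.
Variable W : X -> R.
Hypothesis iW : mu.-integrable setT (EFin \o W).

Let mW : measurable_fun setT W. Proof. by move/integrableP: iW => [/measurable_EFinP]. Qed.

Let Ud d (z : X * R) := expR (- (z.2 / d)) * W z.1 + emol d (fun s => U (z.1, s)) z.2.

Lemma measurable_space_time_mollification d : measurable_fun setT (Ud d).
Proof.
apply: measurable_funD; last exact: measurable_emol2.
apply: measurable_funM; last exact: (measurableT_comp mW measurable_fst).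
exact: (measurableT_comp (measurable_exp_decay d) measurable_snd).
Qed.

Lemma space_time_mollification_le d x : 0 < d ->
  lam.-integrable setT (fun s => (U (x, s))%:E) ->
  (\int[lam]_(t in `[0%R, T]) `|Ud d (x, t)|%:E <=
    T%:E * `|W x|%:E + \int[lam]_s `|U (x, s)|%:E)%E.
Proof.
move=> d0 Ux.
have UxT : lam.-integrable `[0, T] (fun s => (U (x, s))%:E) by exact: integrableS Ux.
have mE : measurable_fun setT (fun t => emol d (fun s => U (x, s)) t).
  exact: (measurableT_comp (measurable_emol2 d mU) (pair1_measurable x)).
apply: (@le_trans _ _ (\int[lam]_(t in `[0%R, T]) (`|W x|%:E + `|emol d (fun s => U (x, s)) t|%:E))%E).
  apply: ge0_le_integral => //.
  - apply/measurable_EFinP; apply: measurableT_comp => //; apply: measurable_funTS.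
    exact: (measurableT_comp (measurable_space_time_mollification d) (pair1_measurable x)).
  - by apply: emeasurable_funD => //; apply/measurable_EFinP/measurableT_comp => //; apply: measurable_funTS.
  - move=> t; rewrite /= in_itv/= => /andP[t0 _]; rewrite -EFinD lee_fin.
    rewrite (le_trans (ler_normD _ _))// lerD2r normrM ler_piMl//.
    by rewrite ger0_norm ?expR_ge0// -expR0 ler_expR oppr_le0 divr_ge0// ltW.
rewrite ge0_integralD//; last first.
  by apply/measurable_EFinP/measurableT_comp => //; apply: measurable_funTS.
apply: leeD.
  rewrite integral_cst// muleC; apply: lee_wpmul2r => //.
  rewrite le_eqVlt; apply/orP; left; apply/eqP.
  transitivity (lam `[0%R, T]%classic) => //; rewrite lebesgue_measure_itv/= lte_fin oppr0 adde0.
  by move: T0; rewrite le_eqVlt => /predU1P[<-|->] //; rewrite ltxx.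
apply: le_trans (emol_contraction d0 UxT) _.
apply: ge0_subset_integral => //.
by apply/measurable_EFinP/measurableT_comp => //; exact: (measurableT_comp mU (pair1_measurable x)).
Qed.

Let bound x := (2%:E * (T%:E * `|W x|%:E + \int[lam]_s `|U (x, s)|%:E))%E.

Let ibound : mu.-integrable setT bound.
Proof.
apply: integrableZl => //; apply: integrableD => //.
  by apply: integrableZl => //; exact: integrable_norm iW.
exact: (integrable_fubini_F (integrable_abse iU)).
Qed.

Let mslice (g : X * R -> R) x : measurable_fun setT g ->
  measurable_fun setT (fun t => `|g (x, t)|%:E).
Proof.
move=> mg; apply/measurable_EFinP; apply: measurableT_comp => //.
exact: (measurableT_comp mg (pair1_measurable x)).
Qed.

Section tonelli.
Variable g : X * R -> R.
Hypothesis mg : measurable_fun setT g.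

Let h := ((fun z => `|g z|%:E) \_ ([set: X] `*` `[0%R, T]))%E.

Let mset : measurable ([set: X] `*` `[0, T]%classic).
Proof. by apply: measurableX => //; exact: measurable_itv. Qed.

Let mh : measurable_fun setT h.
Proof.
apply: ((measurable_restrictT _ mset).1 _); apply: measurable_funTS.
by apply/measurable_EFinP; exact: measurableT_comp.
Qed.

Let h0 z : (0 <= h z)%E. Proof. by rewrite /h patchE; case: ifPn. Qed.

Let hE x t : h (x, t) = (((fun t => `|g (x, t)|%:E) \_ `[0%R, T]) t)%E.
Proof. by rewrite /h !patchE in_setX/= in_setT. Qed.

Lemma tonelli_itv1 : (\int[mu \x lam]_(z in setT `*` `[0%R, T]) `|g z|%:E =
  \int[mu]_x \int[lam]_(t in `[0%R, T]) `|g (x, t)|%:E)%E.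
Proof.
rewrite integral_mkcond fubini_tonelli1//; apply: eq_integral => x _.
by rewrite [RHS]integral_mkcond; apply: eq_integral => t _; exact: hE.
Qed.

Lemma measurable_tonelli_itv1 :
  measurable_fun setT (fun x => \int[lam]_(t in `[0%R, T]) `|g (x, t)|%:E)%E.
Proof.
have := measurable_fun_fubini_tonelli_F (m2 := lam) h mh h0; congr (measurable_fun _ _).
apply/funext => x; rewrite [RHS]integral_mkcond; apply: eq_integral => t _; exact: hE.
Qed.

Lemma tonelli_itv2 : (\int[mu \x lam]_(z in setT `*` `[0%R, T]) `|g z|%:E =
  \int[lam]_(t in `[0%R, T]) \int[mu]_x `|g (x, t)|%:E)%E.
Proof.
rewrite integral_mkcond fubini_tonelli2// [RHS]integral_mkcond; apply: eq_integral => t _.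
rewrite /fubini_G patchE; case: ifPn => tT.
  by apply: eq_integral => x _; rewrite -[LHS]/(h (x, t)) hE patchE tT.
by apply: integral0_eq => x _; rewrite -[LHS]/(h (x, t)) hE patchE (negbTE tT).
Qed.
End tonelli.

Lemma integral_space_time_mollification_lty d : 0 < d ->
  (\int[lam]_(t in `[0%R, T]) \int[mu]_x `|Ud d (x, t)|%:E < +oo)%E.
Proof.
move=> d0; have mUd := measurable_space_time_mollification d.
rewrite -tonelli_itv2// tonelli_itv1//.
have /integrableP[_] := ibound; apply: le_lt_trans.
apply: ae_ge0_le_integral => //.
- by move=> x _; exact: integral_ge0.
- exact: measurable_tonelli_itv1.
- by apply: measurableT_comp => //; exact: measurable_int ibound.
- have := ae_integrable_slice; apply: filterS => x Ux _.
  apply: le_trans (space_time_mollification_le d0 Ux) _.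
  rewrite gee0_abs /bound; last first.
    by rewrite mule_ge0// adde_ge0 ?integral_ge0// mule_ge0.
  rewrite -[leLHS]mul1e; apply: lee_wpmul2r; last by rewrite lee_fin ler1n.
  by rewrite adde_ge0 ?integral_ge0// mule_ge0.
Qed.

(** For almost every x the convergence in L^1(0,T) is that of the scalar mollification,
    and the contraction property provides a bound integrable in x: dominated
    convergence applies to the L^1(0,T) norms of the slices. *)
Lemma space_time_mollification_cvgL1 (d_ : nat -> R) :
  (forall i, 0 < d_ i) -> d_ i @[i --> \oo] --> 0 ->
  (\int[mu \x lam]_(z in setT `*` `[0%R, T]) `|Ud (d_ i) z - U z|%:E)%E @[i --> \oo] --> 0%E.
Proof.
move=> d0 dcvg.
have mUd i := measurable_space_time_mollification (d_ i).
have mB i : measurable_fun setT (fun z => Ud (d_ i) z - U z) by exact: measurable_funB.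
under eq_fun do rewrite (tonelli_itv1 (mB _)).
have cvg0 : {ae mu, forall x, [set: X] x ->
    (\int[lam]_(t in `[0%R, T]) `|Ud (d_ i) (x, t) - U (x, t)|%:E)%E @[i --> \oo] --> 0%E}.
  have := ae_integrable_slice; apply: filterS => x Ux _.
  have UxT : lam.-integrable `[0, T] (EFin \o (fun s => U (x, s))) by exact: integrableS Ux.
  exact: (@emol_initial_cvgL1 R (fun s => U (x, s)) (W x) T d_ T0 UxT d0 dcvg).
have dom : {ae mu, forall x (i : nat), [set: X] x ->
    (`|\int[lam]_(t in `[0%R, T]) `|Ud (d_ i) (x, t) - U (x, t)|%:E| <= bound x)%E}.
  have := ae_integrable_slice; apply: filterS => x Ux i _.
  rewrite gee0_abs ?integral_ge0//.
  apply: (@le_trans _ _ (\int[lam]_(t in `[0%R, T]) (`|Ud (d_ i) (x, t)|%:E + `|U (x, t)|%:E))%E).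
    apply: ge0_le_integral => //.
    - by apply: measurable_funTS; exact: (mslice x (mB i)).
    - by apply: emeasurable_funD; apply: measurable_funTS; exact: mslice.
    - by move=> t _; rewrite -EFinD lee_fin ler_normB.
  rewrite ge0_integralD//; last 2 first.
    by apply: measurable_funTS; exact: mslice.
    by apply: measurable_funTS; exact: mslice.
  rewrite /bound -[2%:E]/((1 + 1)%:E) EFinD ge0_muleDl// !mul1e; apply: leeD.
    exact: space_time_mollification_le.
  apply: (@le_trans _ _ (\int[lam]_s `|U (x, s)|%:E)%E).
    by apply: ge0_subset_integral => //; exact: mslice.
  by rewrite leeDr// mule_ge0.
have [_ _ H] := dominated_convergence measurableT
  (fun i => measurable_tonelli_itv1 (mB i)) (measurable_cst (0%E : \bar R)) cvg0 ibound dom.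
by rewrite integral0 in H; exact: H.
Qed.
End space_time_mollification.

(** * Test functions and bounded domains *)

Section test_function_facts.
Context {R : realType} {n : nat}.
Notation X := 'rV[R]_n.
Implicit Types (Omega K : set X) (phi : X -> R).

Lemma bounded_lebesgue_rV_lty Omega : measurable Omega -> bounded_set Omega ->
  (lebesgue_rV n Omega < +oo)%E.
Proof.
move=> mO [M [_ /(_ (M + 1))]]; rewrite ltrDl ltr01 => /(_ isT) OM.
pose A (i : 'I_n) := `[- (M + 1), M + 1]%classic : set R.
have mA i : measurable (A i) by exact: measurable_itv.
have mB : measurable [set x : X | forall i, A i (x ord0 i)].
  rewrite (_ : [set x | _] = \bigcap_(i in [set: 'I_n])
    (fun x : X => x ord0 i) @^-1` A i).
    apply: fin_bigcap_measurable => // i _; rewrite -[X in measurable X]setTI.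
    by apply: ((measurable_fun_rVP _).1 (@measurable_id _ _ setT) i).
  by apply/seteqP; split=> x h i => [_|]; exact: h.
apply: (@le_lt_trans _ _ (lebesgue_rV n [set x : X | forall i, A i (x ord0 i)])).
  apply: le_measure; rewrite ?inE// => x Ox i; rewrite /A /= in_itv/= -ler_norml.
  apply: le_trans (OM _ Ox).
  rewrite [leRHS]/Num.norm /= mx_normrE; apply/bigmax_geP; right => /=.
  by exists (ord0, i).
rewrite lebesgue_rV_box// ltey_eq; apply/orP; left.
apply: (big_ind (fun x : \bar R => x \is a fin_num)) => //.
  by move=> a b; exact: fin_numM.
by move=> i _; rewrite lebesgue_measure_itv/=; case: ifPn.
Qed.

(** Test functions with compact support may be used in the duality pairing. *)
Lemma Cc1_C0 Omega phi : Cc1 Omega phi -> C0 Omega phi.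
Proof.
move=> /Cc1P[/C1_continuous cphi [K [cK KO K0]]]; split=> [x _|e e0]; first exact: cphi.
rewrite (_ : [set x | _] = [set x | e <= `|phi x|] `&` K).
  rewrite setIC; apply: compact_closedI => //.
  apply: (@closed_comp _ _ (fun x => `|phi x|) [set r | e <= r]); last exact: closed_ge.
  by move=> x _; exact: (continuous_comp (cphi x) (@norm_continuous _ _ _)).
apply/seteqP; split=> x /= [].
  move=> Ox ex; split=> //; apply: contrapT => /K0 p0.
  by move: ex; rewrite p0 normr0 leNgt e0.
by move=> ex /KO.
Qed.

Lemma measurable_C0 Omega phi : open Omega -> C0 Omega phi -> measurable_fun Omega phi.
Proof.
move=> oO [cphi _]; apply: (measurability _ (RGenOpens.measurableE R)).
move=> _ [_ [a [b ->]] <-]; apply: open_measurable_rV.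
rewrite openE => x [Ox ab]; apply: filterI; first exact: open_nbhs_nbhs.
by apply: (cphi x Ox); apply: open_nbhs_nbhs; split => //; exact: interval_open.
Qed.

(** The set where |phi| >= 1 is compact. *)
Lemma bounded_C0 Omega phi : C0 Omega phi ->
  exists2 M, 0 <= M & forall x, Omega x -> `|phi x| <= M.
Proof.
move=> [cphi /(_ 1 ltr01) cK]; set K := [set x | _] in cK.
have : compact (phi @` K).
  apply: continuous_compact => //; apply: continuous_in_subspaceT => x.
  by rewrite inE => -[Ox _]; exact: cphi.
move/compact_bounded => [M [_ /(_ (Num.max M 0 + 1))]].
have M1 : M < Num.max M 0 + 1 by rewrite ltr_pwDr// le_max lexx.
move=> /(_ M1) KM; exists (Num.max M 0 + 1).
  by rewrite addr_ge0// le_max lexx orbT.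
move=> x Ox; have [p1|p1] := leP 1 `|phi x|.
  by apply: KM; exists x.
by rewrite (le_trans (ltW p1))// lerDr le_max lexx orbT.
Qed.

Lemma bounded_continuous Omega phi : bounded_set Omega -> continuous phi ->
  exists2 M, 0 <= M & forall x, Omega x -> `|phi x| <= M.
Proof.
move=> [r [_ /(_ (r + 1))]]; rewrite ltrDl ltr01 => /(_ isT) Or cphi.
have cB : compact [set x : X | `|x| <= r + 1].
  apply: bounded_closed_compact.
    exists (r + 1); split; first exact: num_real.
    by move=> s rs x /= xr; rewrite (le_trans xr)// ltW.
  apply: (@closed_comp _ _ (fun x : X => `|x|) [set s | s <= r + 1]); last exact: closed_le.
  by move=> x _; exact: norm_continuous.
have : compact (phi @` [set x : X | `|x| <= r + 1]).
  by apply: continuous_compact => //; exact: continuous_subspaceT.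
move/compact_bounded => [M [_ /(_ (Num.max M 0 + 1))]].
have M1 : M < Num.max M 0 + 1 by rewrite ltr_pwDr// le_max lexx.
move=> /(_ M1) KM; exists (Num.max M 0 + 1).
  by rewrite addr_ge0// le_max lexx orbT.
by move=> x Ox; apply: KM; exists x => //; exact: Or.
Qed.

End test_function_facts.

(** * The derivative measures of a function of L^1(0,T;BV) *)

Section parabolic_BV.
Context {R : realType} {n : nat}.
Notation X := 'rV[R]_n.
Notation mu := (lebesgue_rV n : {sigma_finite_measure set 'rV[R]_n -> \bar R}).
Notation lam := (@lebesgue_measure R).
Variables (Omega : set X) (T : R) (u : R -> X -> R).
Hypotheses (oO : open Omega) (bO : bounded_set Omega).
Hypothesis hu : L1w_BV Omega T u.

Let mO : measurable Omega := open_measurable_rV oO.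

Let itvP s : `[0, T]%classic s <-> 0 <= s <= T.
Proof. by rewrite /= in_itv. Qed.

(** The extension of u by zero to the whole space-time, where Fubini's theorem holds
    for product measures without restriction of the domains. *)
Definition space_time_extension (z : X * R) : R :=
  ((fun z : X * R => u z.2 z.1) \_ (Omega `*` `[0, T])) z.

Notation U := space_time_extension.
Notation D := (fun s => BVD Omega (u s)).

Lemma space_time_extensionE x s : Omega x -> 0 <= s <= T -> U (x, s) = u s x.
Proof. by move=> Ox sT; rewrite /U patchE mem_set//; split => //; exact/itvP. Qed.

Lemma space_time_extension_restrict s : 0 <= s <= T ->
  (fun x => U (x, s)) = u s \_ Omega.
Proof.
move=> sT; apply/funext => x; rewrite /U !patchE in_setX/=.
by rewrite [X in _ && X]mem_set ?andbT//; exact/itvP.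
Qed.

Lemma space_time_extension_out x s : ~ (0 <= s <= T) -> U (x, s) = 0.
Proof.
move=> sT; rewrite /U patchE memNset// => -[_ /itvP]; exact: sT.
Qed.

Lemma measurable_space_time_extension : measurable_fun setT U.
Proof.
have [mu_ _ _ _] := hu; apply: ((measurable_restrictT _ _).1 mu_).
by apply: measurableX => //; exact: measurable_itv.
Qed.

Lemma integral_space_time_extension s (psi : X -> R) : 0 <= s <= T ->
  \int[mu]_x (U (x, s) * (psi \_ Omega) x) = \int[mu]_(x in Omega) (u s x * psi x).
Proof.
move=> sT; rewrite [RHS]Rintegral_mkcond; apply: eq_Rintegral => x _.
have := congr1 (@^~ x) (space_time_extension_restrict sT) => /= ->.
by rewrite !patchE; case: ifPn => _; rewrite ?mul0r.
Qed.

Lemma slice_BV s : 0 <= s <= T -> BV Omega (u s).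
Proof. by move=> sT; have [_ + _ _] := hu; apply; rewrite in_itv. Qed.

(** Weak*-measurability is used for the elements of the predual with phi = 0 and with a
    single nonzero component psi of Phi. *)
Lemma measurable_BVD_test i (psi : X -> R) : Cc1 Omega psi ->
  measurable_fun `[0, T] (fun s => charge_integral (D s i) Omega psi).
Proof.
move=> Cpsi; have [_ _ + _] := hu.
move=> /(_ (fun=> 0) (fun x => \row_j (if j == i then psi x else 0))).
have C00 : C0 Omega (fun=> 0 : R) by exact/Cc1_C0/(bump0 Omega).1.
have ci0 nu : charge_integral nu Omega (fun=> 0 : R) = 0.
  by rewrite /charge_integral !Rintegral_cst// !mul0r subrr.
have -> : (fun t => predual_pairing Omega (u t) (fun=> 0)
    (fun x => \row_j (if j == i then psi x else 0))) =
    (fun s => charge_integral (D s i) Omega psi).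
  apply/funext => t; rewrite /predual_pairing.
  under eq_Rintegral do rewrite mulr0.
  rewrite Rintegral_cst// mul0r add0r (bigD1 i)//= big1 ?addr0.
    by apply: eq_charge_integral => x _; rewrite mxE eqxx.
  move=> j ji; rewrite -[RHS](ci0 (BVD Omega (u t) j)).
  by apply: eq_charge_integral => x _; rewrite mxE (negbTE ji).
apply => // j; case: (eqVneq j i) => [->|ji].
  by under eq_fun do rewrite mxE eqxx; exact: Cc1_C0.
by under eq_fun do rewrite mxE (negbTE ji).
Qed.

(** Test functions approximate the indicators of a pi-system generating the Borel
    subsets of Omega. *)
Lemma measurable_BVD_family i B : measurable B -> B `<=` Omega ->
  measurable_fun `[0, T] (fun s => fine (D s i B)).
Proof.
move=> mB BO.
suff : measurable_fun `[0, T] (fun s => fine (D s i (B `&` Omega))) by rewrite setIidl.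
apply: (@borel_bump_ind _ _ Omega (fun B => measurable_fun `[0, T] (fun s => fine (D s i B)))) => //.
- move=> F /(bump_charge_integral_cvg mO)[psi Cpsi lim].
  apply: (measurable_fun_cvg (h := fun k s => charge_integral (D s i) Omega (psi k))).
    by move=> k; exact: measurable_BVD_test.
  by move=> s _; exact: lim.
- move=> A A' mA mA' A'A AO hA hA'.
  have AA' : A `&` A' = A' by exact: setIidr.
  rewrite (_ : (fun s => _) = fun s => fine (D s i A) - fine (D s i A')).
    exact: measurable_funB.
  by apply/funext => s; rewrite chargeD// AA' fineB ?fin_num_measure.
- move=> A mA AO ndA hA.
  apply: (measurable_fun_cvg (h := fun k s => fine (D s i (A k)))) => // s _.
  exact: charge_nondecreasing_cvg.
Qed.

(** The BV norms are integrable on the open interval, while the mollification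
    integrates over closed ones. *)
Lemma integrable_itv_closure (f g : R -> R) : measurable_fun `[0, T] f ->
  lam.-integrable `]0, T[ (EFin \o g) ->
  (forall s, 0 < s < T -> `|f s| <= `|g s|) ->
  lam.-integrable `[0, T] (EFin \o f).
Proof.
move=> mf gi fg; apply/integrableP; split; first exact/measurable_EFinP.
rewrite integral_itv_bndoo; last first.
  apply: measurableT_comp => //; apply/measurable_EFinP.
  apply: measurable_funS mf => //.
  by move=> s /=; rewrite !in_itv/= => /andP[/ltW -> /ltW ->].
have /integrableP[mg] := gi; apply: le_lt_trans.
apply: ge0_le_integral => //.
- apply: measurableT_comp => //; apply/measurable_EFinP.
  apply: measurable_funS mf => //.
  by move=> s /=; rewrite !in_itv/= => /andP[/ltW -> /ltW ->].
- exact: measurableT_comp.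
Qed.

Let normint s := (\int[mu]_x `|U (x, s)|%:E)%E.

Lemma norm_BVnorm s : 0 <= s <= T ->
  BVnorm Omega (u s) = (normint s + tvar (D s) Omega)%E /\ normint s \is a fin_num.
Proof.
move=> sT; have E : normint s = (\int[mu]_(x in Omega) `|u s x|%:E)%E.
  rewrite [RHS]integral_mkcond; apply: eq_integral => x _.
  have := congr1 (@^~ x) (space_time_extension_restrict sT) => /= ->.
  by rewrite !patchE; case: ifPn => // _; rewrite normr0.
split; first by rewrite E.
have [ui _] := slice_BV sT; rewrite E ge0_fin_numE ?integral_ge0//.
by move/integrableP: ui => [].
Qed.

Lemma fine_BVnorm_integrable : lam.-integrable `]0, T[ (EFin \o (fun s => fine (BVnorm Omega (u s)))).
Proof.
have [_ _ _ hn] := hu; apply: eq_integrable hn => // s; rewrite inE/= in_itv/= => /andP[s0 sT].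
have s0T : 0 <= s <= T by rewrite !ltW.
have [-> nf] := norm_BVnorm s0T; rewrite fineK// fin_numD nf; exact: tvar_fin_num.
Qed.

(** The total variation is a part of the BV norm, and is measurable by itself. *)
Lemma integrable_tvar_BVD : lam.-integrable `[0, T] (EFin \o (fun s => fine (tvar (D s) Omega))).
Proof.
apply: integrable_itv_closure fine_BVnorm_integrable _.
  exact: measurable_tvar_family measurable_BVD_family.
move=> s /andP[s0 sT]; have s0T : 0 <= s <= T by rewrite !ltW.
have [-> nf] := norm_BVnorm s0T; rewrite (fineD nf (tvar_fin_num _ mO)).
have t0 : 0 <= fine (tvar (D s) Omega) by rewrite fine_ge0// tvar_ge0.
have n0 : 0 <= fine (normint s) by rewrite fine_ge0// integral_ge0.
by rewrite !ger0_norm ?addr_ge0// lerDr.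
Qed.

Lemma integrable_space_time_extension : (mu \x lam)%E.-integrable setT (EFin \o U).
Proof.
have mU := measurable_space_time_extension.
have mEU : measurable_fun setT (EFin \o U) by exact/measurable_EFinP.
apply: (integrable21ltyP mu lam mEU).2.
have mn : measurable_fun setT normint.
  apply: (measurable_fun_fubini_tonelli_G (m1 := mu) (fun z => `|U z|%:E)%E) => //.
  by apply/measurable_EFinP; exact: measurableT_comp.
have -> : (\int[lam]_y \int[mu]_x `|(EFin \o U) (x, y)| = \int[lam]_(s in `[0%R, T]) normint s)%E.
  rewrite [RHS]integral_mkcond; apply: eq_integral => s _; rewrite patchE.
  case: ifPn => //; rewrite notin_setE => sT; apply: integral0_eq => x _.
  by rewrite /= space_time_extension_out ?normr0// => /itvP.
have mn' : measurable_fun `[0, T] (fun s => fine (normint s)).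
  exact: (measurableT_comp (fine_measurable measurableT) (measurable_funTS mn)).
have : lam.-integrable `[0, T] (EFin \o (fun s => fine (normint s))).
  apply: integrable_itv_closure fine_BVnorm_integrable _ => // s /andP[s0 sT].
  have s0T : 0 <= s <= T by rewrite !ltW.
  have [-> nf] := norm_BVnorm s0T; rewrite (fineD nf (tvar_fin_num _ mO)).
  have t0 : 0 <= fine (tvar (D s) Omega) by rewrite fine_ge0// tvar_ge0.
  have n0 : 0 <= fine (normint s) by rewrite fine_ge0// integral_ge0.
  by rewrite !ger0_norm ?addr_ge0// lerDl.
move=> /integrableP[_]; apply: le_lt_trans.
rewrite le_eqVlt; apply/orP; left; apply/eqP; apply: eq_integral => s.
rewrite inE => /itvP sT; have [_ nf] := norm_BVnorm sT.
by rewrite /= ger0_norm ?fineK// fine_ge0// integral_ge0.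
Qed.

End parabolic_BV.

(** * The derivative measures of the mollification *)

Section mollified_BV.
Context {R : realType} {n : nat}.
Notation X := 'rV[R]_n.
Notation mu := (lebesgue_rV n : {sigma_finite_measure set 'rV[R]_n -> \bar R}).
Notation lam := (@lebesgue_measure R).
Variables (Omega : set X) (T : R) (u : R -> X -> R) (w : X -> R).
Hypotheses (oO : open Omega) (bO : bounded_set Omega).
Hypotheses (hu : L1w_BV Omega T u) (hw : BV Omega w).

Let mO : measurable Omega := open_measurable_rV oO.

Notation U := (space_time_extension Omega T u).
Notation D := (fun s => BVD Omega (u s)).
Notation um := (time_mollification w u).

Let mU := measurable_space_time_extension oO hu.
Let iU := integrable_space_time_extension oO hu.
Let mD := measurable_BVD_family oO bO hu.
Let iD := integrable_tvar_BVD oO bO hu.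

Definition initial_extension : X -> R := w \_ Omega.
Notation W := initial_extension.

Lemma integrable_initial_extension : mu.-integrable setT (EFin \o W).
Proof. by rewrite /W -restrict_EFin; exact: (integrable_mkcond _ mO).1 hw.1. Qed.

Lemma time_mollificationE d t x : Omega x -> 0 <= t <= T ->
  um d t x = expR (- (t / d)) * W x + emol d (fun s => U (x, s)) t.
Proof.
move=> Ox /andP[t0 tT]; rewrite /time_mollification /W patchE mem_set//; congr (_ + _).
apply: eq_emol => s /andP[s0 st]; rewrite space_time_extensionE// s0/=.
exact: le_trans tT.
Qed.

Lemma measurable_restrict_test (psi : X -> R) : measurable_fun Omega psi ->
  measurable_fun setT (psi \_ Omega).
Proof. exact: (measurable_restrictT _ mO).1. Qed.

Lemma restrict_test_le (psi : X -> R) (M : R) : (forall x, Omega x -> `|psi x| <= M) ->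
  0 <= M -> forall x, `|(psi \_ Omega) x| <= M.
Proof.
by move=> psiM M0 x; rewrite patchE; case: ifPn => [|_]; rewrite ?normr0// inE => /psiM.
Qed.

(** Fubini's theorem: integration against a fixed function of x commutes with the
    mollification. *)
Lemma integral_mollification d t (psi : X -> R) (M : R) : 0 < d -> 0 <= t <= T ->
  measurable_fun Omega psi -> (forall x, Omega x -> `|psi x| <= M) -> 0 <= M ->
  \int[mu]_(x in Omega) (um d t x * psi x) =
  expR (- (t / d)) * (\int[mu]_(x in Omega) (w x * psi x)) +
  emol d (fun s => \int[mu]_(x in Omega) (u s x * psi x)) t.
Proof.
move=> d0 t0T mpsi psiM M0; have mp := measurable_restrict_test mpsi.
have pM := restrict_test_le psiM M0.
have ip (f : X -> R) : mu.-integrable setT (EFin \o f) ->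
    mu.-integrable setT (EFin \o (fun x => f x * (psi \_ Omega) x)).
  move=> fi; have mf : measurable_fun setT f by move/integrableP: fi => [/measurable_EFinP].
  apply: (le_integrable _ _ _ (integrableZl _ M fi)) => //.
    by apply/measurable_EFinP; exact: measurable_funM.
  move=> x _ /=; rewrite lee_fin !normrM mulrC ler_wpM2r//.
  by rewrite (le_trans (pM x))// ler_norm.
have iE := integrable_emol_slice mU iU t d0.
transitivity (\int[mu]_x (expR (- (t / d)) * (W x * (psi \_ Omega) x) +
    emol d (fun s => U (x, s)) t * (psi \_ Omega) x)).
  rewrite Rintegral_mkcond; apply: eq_Rintegral => x _; rewrite patchE [X in _ * (_ * X) + _ * X]patchE.
  case: ifPn => [|_]; last by rewrite !mulr0 addr0.
  by rewrite inE => Ox; rewrite time_mollificationE// mulrDl mulrA.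
rewrite RintegralD//; last 2 first.
- by rewrite -/(EFin \o _); exact: (integrableZl _ _ (ip _ integrable_initial_extension)).
- exact: ip iE.
rewrite RintegralZl//; last exact: ip integrable_initial_extension.
congr (_ * _ + _).
  rewrite [RHS]Rintegral_mkcond; apply: eq_Rintegral => x _; rewrite /W !patchE.
  by case: ifPn => _; rewrite ?mul0r.
rewrite (emol_fubini mU iU t d0 mp pM); apply: eq_emol => s /andP[s0 st].
by rewrite integral_space_time_extension// s0 (le_trans st)//; case/andP: t0T.
Qed.

Lemma measurable_integral_test (psi : X -> R) (M : R) : 
  measurable_fun Omega psi -> (forall x, Omega x -> `|psi x| <= M) -> 0 <= M ->
  measurable_fun `[0, T] (fun s => \int[mu]_(x in Omega) (u s x * psi x)).
Proof.
move=> mpsi psiM M0; have mp := measurable_restrict_test mpsi.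
have pM := restrict_test_le psiM M0.
have iV : (mu \x lam)%E.-integrable setT (EFin \o (fun z => U z * (psi \_ Omega) z.1)).
  apply: (le_integrable _ _ _ (integrableZl _ M iU)) => //.
    apply/measurable_EFinP; apply: measurable_funM; first exact: mU.
    exact: (measurableT_comp mp measurable_fst).
  move=> [x s] _ /=; rewrite lee_fin (normrM (U _)) (normrM M) mulrC ler_wpM2r//.
  by rewrite (le_trans (pM x))// ler_norm.
apply: (eq_measurable_fun (fun s => \int[mu]_x (U (x, s) * (psi \_ Omega) x))).
  by move=> s; rewrite inE/= in_itv/= => sT; exact: integral_space_time_extension.
apply: measurable_funTS; apply: (measurableT_comp (fine_measurable measurableT)).
exact: (measurable_fubini_G iV).
Qed.

Section fixed_parameter.
Variable d : R.
Hypothesis d0 : 0 < d.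

Let mollified_part t i B := expR (- (t / d)) * fine (BVD Omega w i (B `&` Omega)) +
  emol d (fun s => fine (D s i (B `&` Omega))) t.

Let iDt t i B : 0 <= t <= T -> measurable B ->
  lam.-integrable `[0, t] (EFin \o (fun s => fine (D s i (B `&` Omega)))).
Proof.
move=> /andP[_ tT] mB; apply: (integrable_itvS tT).
by apply: (integrable_family mO mD iD) => //; exact: measurableI.
Qed.

(** The set function obtained by mollifying the values s |-> D (u s) B in time is
    additive by linearity, and continuous along increasing sequences by dominated
    convergence, with the total variations as bound. *)
Lemma mollified_charge_exists t : 0 <= t <= T ->
  exists Dd : @vcharge R n, forall i B, fine (Dd i B) = mollified_part t i B.
Proof.
move=> t0T; have /andP[_ tT] := t0T.
suff /choice[Dd DdE] : forall i, exists nu : {charge set X -> \bar R}, forall B,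
    fine (nu B) = mollified_part t i B by exists Dd.
move=> i; apply: charge_of_additive => [A B mA mB AB|A mA ndA].
  have ABO : (A `&` Omega) `&` (B `&` Omega) = set0 by rewrite setIACA AB set0I.
  have E (nu : {charge set X -> \bar R}) : fine (nu ((A `|` B) `&` Omega)) =
      fine (nu (A `&` Omega)) + fine (nu (B `&` Omega)).
    by rewrite setIUl fine_chargeU//; exact: measurableI.
  rewrite /mollified_part E (@eq_emol _ _ _ (fun s => fine (D s i (A `&` Omega)) +
    fine (D s i (B `&` Omega)))); last by move=> s _; exact: E.
  by rewrite emolD//; [rewrite mulrDr addrACA|exact: iDt|exact: iDt].
have mAO k : measurable (A k `&` Omega) by exact: measurableI.
have lim (nu : {charge set X -> \bar R}) : fine (nu (A k `&` Omega)) @[k --> \oo] -->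
    fine (nu ((\bigcup_k A k) `&` Omega)).
  rewrite setI_bigcupl; apply: charge_nondecreasing_cvg => // k k' kk'.
  by apply/subsetPset; apply: setSI; apply/subsetPset; exact: ndA.
apply: cvgD.
  by apply: cvgM; [exact: cvg_cst|exact: lim].
apply: (emol_cvg_dominated (g := fun s => fine (tvar (D s) Omega)) d0).
- move=> k; have /integrableP[/measurable_EFinP] := iDt i t0T (mA k); exact.
- exact: integrable_itvS iD.
- by move=> k s _; apply: ler_fine_tvar => //; exact: subIsetr.
- by move=> s _; exact: lim.
Qed.

(** Both sides of the integration by parts formula commute with the mollification:
    the left one by Fubini's theorem, the right one by charge_integral_mollified. *)
Lemma mollified_derivative t (Dd : @vcharge R n) : 0 <= t <= T ->
  (forall i B, fine (Dd i B) = mollified_part t i B) ->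
  is_derivative_measure Omega (um d t) Dd.
Proof.
move=> t0T DdE phi i Cphi; have [_ /(_ i) cphi _] := Cphi.
have [M M0 psiM] := bounded_continuous bO cphi.
have mpsi : measurable_fun Omega ('D_(delta_mx ord0 i) phi).
  exact: measurable_funTS (continuous_measurable_rV cphi).
have [N N0 phiN] := bounded_C0 (Cc1_C0 Cphi).
have mphi : measurable_fun Omega phi by exact: measurable_funTS (Cc1_measurable Cphi).
rewrite (integral_mollification d0 t0T mpsi psiM M0).
rewrite (BVD_derivative hw)//.
rewrite (@eq_emol _ _ _ (fun s => -1 * charge_integral (D s i) Omega phi)); last first.
  move=> s /andP[s0 st]; rewrite mulN1r (BVD_derivative (slice_BV hu _))//.
  by rewrite s0 (le_trans st)//; case/andP: t0T.
rewrite emolZ//; last first.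
  have /andP[_ tT] := t0T; apply: (integrable_itvS tT).
  exact: (integrable_charge_integral_family mO mD iD i mphi phiN N0).
rewrite mulN1r mulrN -opprD; congr -%R; apply/esym.
apply: (charge_integral_mollified mO mD iD d0 t0T _ mphi phiN) => B mB BO.
by rewrite DdE /mollified_part setIidl.
Qed.

Lemma mollified_integrable t : 0 <= t <= T ->
  mu.-integrable Omega (EFin \o um d t).
Proof.
move=> t0T; have iE := integrable_emol_slice mU iU t d0.
apply: (eq_integrable mO (fun x => ((expR (- (t / d)))%:E * (W x)%:E +
    (emol d (fun s => U (x, s)) t)%:E)%E)) => //.
  by move=> x; rewrite inE => Ox; rewrite /= time_mollificationE.
apply: integrableD => //.
  by apply: integrableZl => //; apply: integrableS integrable_initial_extension.
exact: integrableS iE.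
Qed.

Lemma mollified_BV t : 0 <= t <= T -> BV Omega (um d t).
Proof.
move=> t0T; split; first exact: mollified_integrable.
have [Dd DdE] := mollified_charge_exists t0T.
by exists Dd; exact: mollified_derivative.
Qed.

(** The measure chosen by BVD is the mollified one by uniqueness of the distributional
    derivative. *)
Lemma mollified_BVDE t : 0 <= t <= T -> forall i B, measurable B -> B `<=` Omega ->
  fine (BVD Omega (um d t) i B) = expR (- (t / d)) * fine (BVD Omega w i B) +
    emol d (fun s => fine (D s i B)) t.
Proof.
move=> t0T i B mB BO; have [Dd DdE] := mollified_charge_exists t0T.
rewrite (derivative_measure_unique oO bO (BVD_derivative (mollified_BV t0T))
  (mollified_derivative t0T DdE))//.
by rewrite DdE /mollified_part setIidl.
Qed.

End fixed_parameter.
End mollified_BV.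

(** * Area-strict convergence *)

Section mollification_parabolic_BV.
Context {R : realType} {n : nat}.
Notation X := 'rV[R]_n.
Notation mu := (lebesgue_rV n : {sigma_finite_measure set 'rV[R]_n -> \bar R}).
Notation lam := (@lebesgue_measure R).
Variables (Omega : set X) (T : R) (u : R -> X -> R) (w : X -> R).
Hypotheses (oO : open Omega) (bO : bounded_set Omega) (T0 : 0 < T).
Hypotheses (hu : L1w_BV Omega T u) (hw : BV Omega w).

Let mO : measurable Omega := open_measurable_rV oO.

Notation U := (space_time_extension Omega T u).
Notation W := (initial_extension Omega w).
Notation D := (fun s => BVD Omega (u s)).
Notation um := (time_mollification w u).

Let mU := measurable_space_time_extension oO hu.
Let iU := integrable_space_time_extension oO hu.
Let mD := measurable_BVD_family oO bO hu.
Let iD := integrable_tvar_BVD oO bO hu.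
Let iW := integrable_initial_extension oO hw.
Let BVDE d (d0 : 0 < d) := mollified_BVDE oO bO hu hw d0.

Let Ud d (z : X * R) := expR (- (z.2 / d)) * W z.1 + emol d (fun s => U (z.1, s)) z.2.

Let mUd d : measurable_fun setT (Ud d).
Proof. exact: (@measurable_space_time_mollification _ _ _ mu U mU W iW d). Qed.

Lemma measurable_mollification d :
  measurable_fun (Omega `*` `[0, T]) (fun z : X * R => um d z.2 z.1).
Proof.
apply: (eq_measurable_fun (Ud d)); last exact: measurable_funTS.
move=> [x t]; rewrite inE => -[/= Ox tT].
by apply/esym; apply: time_mollificationE => //; move: tT; rewrite /= in_itv.
Qed.

Lemma measurable_mollification_pairing d phi (Phi : X -> X) : 0 < d ->
  C0 Omega phi -> (forall i, C0 Omega (fun x => Phi x ord0 i)) ->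
  measurable_fun `[0, T] (fun t => predual_pairing Omega (um d t) phi Phi).
Proof.
move=> d0 Cphi CPhi; have [M M0 phiM] := bounded_C0 Cphi.
have mphi := measurable_C0 oO Cphi.
have mexp : measurable_fun `[0, T] (fun t : R => expR (- (t / d))).
  by apply: measurable_funTS; exact: measurable_exp_decay.
pose g (t : R) : R :=
  (expR (- (t / d)) * (\int[mu]_(x in Omega) (w x * phi x)) +
   emol d (fun s => \int[mu]_(x in Omega) (u s x * phi x)) t) +
  \sum_(i < n) (expR (- (t / d)) *
      charge_integral (BVD Omega w i) Omega (fun x => Phi x ord0 i) +
    emol d (fun s => charge_integral (D s i) Omega (fun x => Phi x ord0 i)) t).
apply: (eq_measurable_fun g).
  move=> t; rewrite inE/= in_itv/= => t0T; rewrite /predual_pairing.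
  rewrite (integral_mollification oO hu hw d0 t0T mphi phiM M0); congr (_ + _).
  apply: eq_bigr => i _; have [N N0 PhiN] := bounded_C0 (CPhi i); apply/esym.
  apply: (charge_integral_mollified mO mD iD d0 t0T _ (measurable_C0 oO (CPhi i)) PhiN).
  by move=> B mB BO; exact: BVDE.
apply: measurable_funD.
  apply: measurable_funD; first exact: measurable_funM.
  apply: measurable_emol; exact: (measurable_integral_test oO hu mphi phiM M0).
apply: measurable_sum => i; have [N N0 PhiN] := bounded_C0 (CPhi i).
apply: measurable_funD; first exact: measurable_funM.
apply: measurable_emol.
exact: (measurable_charge_integral_family mO mD i (measurable_C0 oO (CPhi i)) PhiN).
Qed.

Lemma integrable_emol d (f : R -> R) : 0 < d -> lam.-integrable `[0, T] (EFin \o f) ->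
  lam.-integrable `[0, T] (EFin \o emol d f).
Proof.
move=> d0 fi; have /integrableP[/measurable_EFinP mf foo] := fi.
apply/integrableP; split; first by apply/measurable_EFinP; exact: measurable_emol.
exact: le_lt_trans (emol_contraction d0 fi) foo.
Qed.

Let cdE d (d0 : 0 < d) t (t0T : 0 <= t <= T) i B := BVDE d0 t0T i (B := B).

(** Jensen's inequality bounds the total variations by the mollification of an
    integrable function. *)
Lemma integrable_tvar_mollification d : 0 < d ->
  lam.-integrable `[0, T] (EFin \o (fun t => fine (tvar (BVD Omega (um d t)) Omega))).
Proof.
move=> d0; have mE : measurable_fun `[0, T] (fun t => fine (tvar (BVD Omega (um d t)) Omega)).
  apply: measurable_tvar_family => // i B mB BO.
  exact: (measurable_mollified_family mD (cdE d0)).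
pose b t := expR (- (t / d)) * fine (tvar (BVD Omega w) Omega) +
  emol d (fun s => fine (tvar (D s) Omega)) t.
have ib : lam.-integrable `[0, T] (EFin \o b).
  rewrite (_ : _ \o _ = fun t => (expR (- (t / d)) * fine (tvar (BVD Omega w) Omega))%:E +
    (emol d (fun s => fine (tvar (D s) Omega)) t)%:E)%E//.
  apply: integrableD => //; last exact: integrable_emol.
  apply: integrable_continuous_itv => t.
  apply: cvgM; last exact: cvg_cst.
  exact: continuous_exp_decay.
apply: (le_integrable _ _ _ ib) => //; first exact/measurable_EFinP.
move=> t /=; rewrite in_itv/= => t0T.
have h := tvar_mollified_le mO mD iD d0 (cdE d0) t0T.
have t0 : 0 <= fine (tvar (BVD Omega (um d t)) Omega) by rewrite fine_ge0// tvar_ge0.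
by rewrite lee_fin ger0_norm// (le_trans h)// ler_norm.
Qed.

Lemma mollification_L1w_BV d : 0 < d -> L1w_BV Omega T (um d).
Proof.
move=> d0; split.
- exact: measurable_mollification.
- by move=> t; rewrite in_itv => t0T; exact: (mollified_BV oO bO hu hw d0 t0T).
- by move=> phi Phi Cphi CPhi; exact: measurable_mollification_pairing.
pose N t := (\int[mu]_x `|Ud d (x, t)|%:E)%E.
have mN : measurable_fun setT N.
  apply: (measurable_fun_fubini_tonelli_G (m1 := mu) (fun z => `|Ud d z|%:E)%E) => //.
  by apply/measurable_EFinP; exact: measurableT_comp.
have iN : lam.-integrable `[0, T] N.
  apply/integrableP; split; first exact: measurable_funTS.
  under eq_integral do rewrite gee0_abs ?integral_ge0//.
  exact: (integral_space_time_mollification_lty mU iU (ltW T0) iW d0).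
have iV := integrable_tvar_mollification d0.
pose g t := (N t + (fine (tvar (BVD Omega (um d t)) Omega))%:E)%E.
have mI : measurable `[0, T]%classic by exact: measurable_itv.
have ig : lam.-integrable `[0, T] g by exact: integrableD.
have gE : {in `[0, T]%classic, g =1 (fun t => BVnorm Omega (um d t))}.
  move=> t; rewrite inE/= in_itv/= => t0T.
  have E : N t = (\int[mu]_(x in Omega) `|um d t x|%:E)%E.
    rewrite [RHS]integral_mkcond; apply: eq_integral => x _.
    rewrite patchE; case: ifPn => [|xO].
      by rewrite inE => Ox; rewrite (time_mollificationE u w d Ox t0T).
    rewrite /Ud /initial_extension patchE (negbTE xO) mulr0 add0r/=.
    rewrite (@eq_emol _ _ _ (cst 0)); last first => [s _|].
      by rewrite /space_time_extension patchE in_setX/= (negbTE xO).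
    by rewrite emol_cst ?mul0r ?normr0//; case/andP: t0T.
  by rewrite /g E (fineK (tvar_fin_num _ mO)).
have iB : lam.-integrable `[0, T] (fun t => BVnorm Omega (um d t)).
  refine (@eq_integrable _ _ R lam `[0, T]%classic _ g _ gE ig).
  exact: measurable_itv.
by apply: (integrableS _ _ _ iB) => // s /=; rewrite !in_itv/= => /andP[/ltW -> /ltW ->].
Qed.

(** sqrt(1 + |p|^2) <= 1 + |p|, so that the areas are integrable in time. *)
Lemma tvar_graph_charge_le muO (c : @vcharge R n) :
  (tvar (graph_charge mO muO c) Omega <=
   tvar (fun _ : 'I_1 => volume_charge mO muO) Omega + tvar c Omega)%E.
Proof.
apply: ge_ereal_sup => _ [N [B [mB BO tB ->]]].
have le k : enorm (cvec (graph_charge mO muO c) (B k)) <=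
    enorm (cvec (fun _ : 'I_1 => volume_charge mO muO) (B k)) + enorm (cvec c (B k)).
  rewrite -(@ler_pXn2r _ 2)// ?nnegrE ?addr_ge0 ?enorm_ge0// sqrrD !enorm_sqr.
  rewrite big_ord_recl big_ord1 !mxE graph_charge0 -addrA lerD2l.
  under eq_bigr do rewrite mxE graph_chargeS.
  under [in leRHS]eq_bigr do rewrite mxE.
  by rewrite lerDr mulrn_wge0// mulr_ge0// enorm_ge0.
apply: (@le_trans _ _ (\sum_(k < N) (enorm (cvec (fun _ : 'I_1 => volume_charge mO muO) (B k)))%:E +
    \sum_(k < N) (enorm (cvec c (B k)))%:E)%E).
  by rewrite !sumEFin -EFinD lee_fin -big_split/=; exact: ler_sum.
apply: leeD; rewrite sumEFin; apply: ereal_sup_ubound; by exists N, B.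
Qed.

Let muO : (mu Omega < +oo)%E := bounded_lebesgue_rV_lty mO bO.
Notation graph c := (graph_charge mO muO c).

Let mG i B : measurable B -> B `<=` Omega ->
  measurable_fun `[0, T] (fun s => fine (graph (D s) i B)).
Proof.
move=> mB BO; case: (unliftP ord0 i) => [j|] ->.
  rewrite (_ : (fun s => _) = fun s => fine (D s j B)); first exact: mD.
  by apply/funext => s; rewrite graph_chargeS.
rewrite (_ : (fun s => _) = cst (fine (volume_charge mO muO B)))//.
by apply/funext => s; rewrite graph_charge0.
Qed.

Let iG : lam.-integrable `[0, T] (EFin \o (fun s => fine (tvar (graph (D s)) Omega))).
Proof.
have mT := measurable_tvar_family mO mG.
pose K := fine (tvar (fun _ : 'I_1 => volume_charge mO muO) Omega).
have iK : lam.-integrable `[0, T] (EFin \o cst K).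
  by apply: integrable_continuous_itv => t; exact: cvg_cst.
have iKD : lam.-integrable `[0, T] (fun s => K%:E + (fine (tvar (D s) Omega))%:E)%E.
  exact: integrableD.
apply: (le_integrable _ _ _ iKD) => //.
  exact/measurable_EFinP.
move=> s _; have K0 : 0 <= K by rewrite fine_ge0// tvar_ge0.
rewrite -EFinD !lee_fin !ger0_norm ?fine_tvar_ge0 ?addr_ge0 ?fine_tvar_ge0//.
by rewrite -lee_fin EFinD !fineK ?tvar_fin_num//; exact: tvar_graph_charge_le.
Qed.

Let graphE d (d0 : 0 < d) t : 0 <= t <= T -> forall i B, measurable B -> B `<=` Omega ->
  fine (graph (BVD Omega (um d t)) i B) = expR (- (t / d)) * fine (graph (BVD Omega w) i B) +
    emol d (fun s => fine (graph (D s) i B)) t.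
Proof.
move=> t0T i B mB BO; case: (unliftP ord0 i) => [j|] ->.
  rewrite !graph_chargeS (@eq_emol _ _ _ (fun s => fine (D s j B))).
    exact: cdE.
  by move=> s _; rewrite graph_chargeS.
rewrite !graph_charge0 (@eq_emol _ _ _ (cst (fine (volume_charge mO muO B)))).
  by rewrite emol_cst//; [ring|case/andP: t0T].
by move=> s _; rewrite graph_charge0.
Qed.

(** The areas are the variations of the measures (L^n, D u), and this family of vector
    measures is mollified like D u, since constants are fixed by the mollification
    with the same initial value. *)
Lemma area_mollification_cvg (d_ : nat -> R) : (forall i, 0 < d_ i) ->
  d_ i @[i --> \oo] --> 0 ->
  (\int[lam]_(t in `]0%R, T[) `|area Omega (u t) - area Omega (um (d_ i) t)|)%E
    @[i --> \oo] --> 0%E.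
Proof.
move=> d0 dcvg.
have H := tvar_mollified_cvg mO (ltW T0) mG iG d0 dcvg (fun j => graphE (d0 j)).
have aE v : area Omega v = (fine (tvar (graph (BVD Omega v)) Omega))%:E.
  by rewrite (area_tvar mO muO) (fineK (tvar_fin_num _ mO)).
have E j : (\int[lam]_(t in `]0%R, T[) `|area Omega (u t) - area Omega (um (d_ j) t)| =
    \int[lam]_(t in `[0%R, T]) `|fine (tvar (graph (D t)) Omega) -
      fine (tvar (graph (BVD Omega (um (d_ j) t))) Omega)|%:E)%E.
  have mA := measurable_tvar_family mO mG.
  have mB := measurable_tvar_family mO (measurable_mollified_family mG (graphE (d0 j))).
  rewrite [RHS]integral_itv_bndoo.
    by apply: eq_integral => t _; rewrite !aE -EFinB abse_EFin.
  apply/measurable_EFinP; apply: measurableT_comp => //.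
  apply: measurable_funS (measurable_funB mA mB) => //.
  by move=> s /=; rewrite !in_itv/= => /andP[/ltW -> /ltW ->].
by rewrite (funext E).
Qed.

Lemma mollification_cvgL1 (d_ : nat -> R) : (forall i, 0 < d_ i) ->
  d_ i @[i --> \oo] --> 0 ->
  (\int[mu \x lam]_(z in Omega `*` `]0%R, T[) `|um (d_ i) z.2 z.1 - u z.2 z.1|%:E)%E
    @[i --> \oo] --> 0%E.
Proof.
move=> d0 dcvg; have H := space_time_mollification_cvgL1 mU iU (ltW T0) iW d0 dcvg.
apply: (squeeze_cvge _ (cvg_cst _) H); apply: nearW => i.
rewrite integral_ge0//=.
have S : Omega `*` `]0, T[ `<=` [set: X] `*` `[0, T].
  by move=> [x t] [_]; rewrite /= !in_itv/= => /andP[/ltW -> /ltW ->].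
have mS : measurable (Omega `*` `]0, T[%classic).
  by apply: measurableX => //; exact: measurable_itv.
apply: (@le_trans _ _ (\int[mu \x lam]_(z in Omega `*` `]0%R, T[) `|Ud (d_ i) z - U z|%:E)%E).
  rewrite le_eqVlt; apply/orP; left; apply/eqP; apply: eq_integral => -[x t].
  rewrite inE => -[/= Ox]; rewrite in_itv/= => /andP[t0 tT].
  have t0T : 0 <= t <= T by rewrite !ltW.
  by rewrite (time_mollificationE u w _ Ox t0T) space_time_extensionE.
apply: ge0_subset_integral => //.
  by apply: measurableX => //; exact: measurable_itv.
apply: measurable_funTS; apply/measurable_EFinP; apply: measurableT_comp => //.
by apply: measurable_funB => //; exact: mUd.
Qed.
End mollification_parabolic_BV.

Theorem lemma3p3 (R : realType) (n : nat) (n_gt0 : (0 < n)%N)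
    (Omega : set 'rV[R]_n) (hOmega : bounded_lipschitz_domain Omega)
    (T : R) (T_gt0 : 0 < T)
    (u : R -> 'rV[R]_n -> R) (hu : L1w_BV Omega T u)
    (w : 'rV[R]_n -> R) (hw : BV Omega w)
    (hw2 : (lebesgue_rV n).-integrable Omega (fun x => ((w x) ^+ 2)%:E)) :
  (forall delta : R, 0 < delta ->
     L1w_BV Omega T (time_mollification w u delta)) /\
  (exists delta_ : nat -> R,
     [/\ forall i, 0 < delta_ i,
         delta_ i @[i --> \oo] --> 0 &
         area_strict_cvg Omega T
           (fun i => time_mollification w u (delta_ i)) u]).
Proof.
have [_ oO _ bO _] := hOmega; split.
  by move=> d d0; exact: mollification_L1w_BV.
have d0 i : 0 < (harmonic i : R) by rewrite /harmonic invr_gt0 ltr0n.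
exists harmonic; split; [exact: d0|exact: cvg_harmonic|split].
  exact: (mollification_cvgL1 oO T_gt0 hu hw d0 (@cvg_harmonic R)).
exact: (area_mollification_cvg oO bO T_gt0 hu hw d0 (@cvg_harmonic R)).
Qed.
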